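(* Assume $f\in L^\infty(\gamma)$ and, for $r>0$, let $F^r(x)=\int_\gamma f(y)\delta^r(y-x)\,d\sigma_y$. Let the initial subdivision $\mathcal T_0$ satisfy the initial-grid assumption (IG), and let $\widetilde{\mathcal T}=\mathrm{INTERFACE}(\mathcal T_0,r)$ with $r<c_\gamma$. Then for any $\tau>0$ the output $\mathcal T^*=\mathrm{GREEDY}(\widetilde{\mathcal T},F^r,\tau)$ satisfies $$\#(\mathcal T^* )-\#(\widetilde{\mathcal T})\le K_0\,r^{1-d/2}\,\|f\|_{L^\infty(\gamma)}^d\,\tau^{-d},$$ where the constant $K_0$ is independent of $r$ and $\tau$. This implies that, for a fixed bulk parameter $\widetilde\theta\in(0,1)$, there is a constant $G_{1/d}\sim r^{1-d/2}\|f\|_{L^\infty(\gamma)}^d$ such that for every $\tau>0$, $$\#\big(\mathrm{DATA}(\widetilde{\mathcal T},F^r,\tau,\widetilde\theta)\big)-\#(\widetilde{\mathcal T})\le G_{1/d}\,\tau^{-d}.$$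
   Context: $A\sim B$ means $c_1A\le B\le c_2A$ with positive constants independent of $r$, $\tau$ and the meshes (they may depend on $\widetilde\theta$). $\#(\cdot)$ is cardinality. $d\in\{2,3\}$; $\Omega\subset\mathbb R^d$ is a bounded Lipschitz polytope; $\omega\subset\Omega$ is a domain with Lipschitz boundary $\gamma=\partial\omega$, and $c_\gamma>0$ is a constant with $\mathrm{dist}(\gamma,\partial\Omega)>c_\gamma$. **Standing assumption on $f$.** There are finitely many non-overlapping nonempty open sets $\gamma_1,\dots,\gamma_M\subset\gamma$ with $\sum_j|\gamma_j|=|\gamma|$ such that $f$ does not change sign on each $\gamma_j$. **Regularization.** $\psi\in L^\infty(\mathbb R^d)$ is built from an even nonnegative $\psi_{1d}$ supported in $[-1,1]$, nonincreasing on $[0,1]$, with unit integral, either as (normalized) radial extension $\psi_{1d}(|x|)$ or as tensor product $\prod_i\psi_{1d}(x_i)$. Thus $\psi\ge0$, $\psi$ is compactly supported, $\int y_i^\alpha\psi(x-y)\,dy=x_i^\alpha$ for $\alpha=0,1$ and all $i$, and $\psi(x/r_2)\le\psi(x/r_1)$ if $r_2<r_1$. Put $\delta^r(x)=r^{-d}\psi(x/r)$. **Subdivisions.** $\mathcal T_0$ is a conforming simplicial subdivision of $\Omega$. $\mathrm{REFINE}(\mathcal T,\mathcal M)$ bisects the cells in $\mathcal M\subset\mathcal T$ (newest vertex bisection) and makes the additional bisections needed for conformity (other strategies with the same properties are allowed); all generated subdivisions are uniformly shape regular, and successive refinements $\mathcal T_{k+1}=\mathrm{REFINE}(\mathcal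 T_k,\mathcal R_k)$ satisfy $\#(\mathcal T_k)-\#(\mathcal T_0)\le C_{\rm c}\sum_{j<k}\#(\mathcal R_j)$ with a universal $C_{\rm c}\ge1$. $h_T=|T|^{1/d}$; $q>1$ is the volume ratio between a cell and its children. $\mathcal G(\gamma,\mathcal T)=\{T\in\mathcal T:T\cap\gamma\neq\emptyset\}$, $\mathrm{diam}(\mathcal G)=\max_{T\in\mathcal G}h_T$. (IG): $\mathcal G(\gamma,\mathcal T_0)$ is quasi-uniform and, for every uniform refinement $\mathcal T_i$ of level $i$ of $\mathcal T_0$, $\sum_{T\in\mathcal G(\gamma,\mathcal T_i)}|T|\sim q^{-i/d}\sum_{T\in\mathcal G(\gamma,\mathcal T_0)}|T|\sim q^{-i/d}|\gamma|$ (constants independent of $i$). **Data indicators.** For $g\in L^2(\Omega)$, $d(g,T,\mathcal T)=h_T\|g\|_{L^2(T)}$ and $\mathcal D(g,\mathcal T)=(\sum_{T\in\mathcal T}d(g,T,\mathcal T)^2)^{1/2}$. **Algorithms.** $\mathrm{INTERFACE}(\mathcal T,r)$: while $\mathrm{diam}(\mathcal G(\gamma,\mathcal T))>r/2$, replace $\mathcal T$ by $\mathrm{REFINE}(\mathcal T,\{T\in\mathcal G(\gamma,\mathcal T):h_T>r/2\})$; return $\mathcal T$. $\mathrm{GREEDY}(\mathcal T,g,\tau)$: while $\mathcal D(g,\mathcal T)>\tau$, choose $T\in\mathcal T$ maximizing $d(g,T,\mathcal T)$ and replace $\mathcal T$ by $\mathrm{REFINE}(\mathcal T,\{T\})$;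 return $\mathcal T$. $\mathrm{DATA}(\mathcal T,g,\tau,\widetilde\theta)$: while $\mathcal D(g,\mathcal T)>\tau$, take a smallest $\mathcal M\subset\mathcal T$ with $(\sum_{T\in\mathcal M}d(g,T,\mathcal T)^2)^{1/2}\ge\widetilde\theta\,\mathcal D(g,\mathcal T)$ and replace $\mathcal T$ by $\mathrm{REFINE}(\mathcal T,\mathcal M)$; return $\mathcal T$. *)

(* Defs.v *)
From HB Require Import structures.
From mathcomp Require Import all_boot all_order all_algebra finmap.
From mathcomp Require Import all_classical all_reals all_analysis.

Set Implicit Arguments.
Unset Strict Implicit.
Unset Printing Implicit Defensive.
Import Order.TTheory GRing.Theory Num.Theory.
Import numFieldNormedType.Exports.

Local Open Scope classical_set_scope.
Local Open Scope ring_scope.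

(** * Euclidean space *)

(* The library norm of ['rV[R]_d] is the sup norm; it induces the same topology
   as [enorm], so the library's [open], [closure], [connected], ... are usable,
   but lengths are measured by [enorm]. *)
Section Euclidean.
Context {R : realType} {d : nat}.
Implicit Types (x y : 'rV[R]_d) (A B U : set 'rV[R]_d).

Definition dot x y : R := \sum_(i < d) x ord0 i * y ord0 i.

Definition enorm x : R := Num.sqrt (dot x x).

Definition eball x (rho : R) : set 'rV[R]_d := [set y | enorm (y - x) < rho].

Definition set_dist A B : R := inf [set enorm (p.1 - p.2) | p in A `*` B].

Definition boundary A : set 'rV[R]_d := closure A `\` A°.

(* Near each boundary point, [U] is the strict subgraph, in some unit direction
   [e], of a Lipschitz function of the component orthogonal to [e]. *)
Definition lipschitz_boundary U : Prop := forall x, boundary U x ->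
  exists (e : 'rV[R]_d) (rho L : R) (phi : 'rV[R]_d -> R),
    [/\ enorm e = 1, 0 < rho,
        forall y z, `|phi y - phi z| <= L * enorm (y - z) &
        forall y, eball x rho y ->
          (U y <-> dot y e < phi (y - dot y e *: e))].

End Euclidean.

(** * Lebesgue measure and surface measure *)

(* Outer measure generated by a nonnegative weight [w] on all subsets of [T]:
   [mu_ext] over the sigma-algebra of all subsets. *)
Section OuterMeasures.
Context {R : realType}.
Local Open Scope ereal_scope.

Definition cover_outer (T : pointedType) (w : set T -> \bar R) (A : set T) :
  \bar R := @mu_ext _ (g_sigma_algebraType [set: set T]) R w A.

Section cover_outer_theory.
Context (T : pointedType) (w : set T -> \bar R).
Hypotheses (w0 : w set0 = 0) (w_ge0 : forall A, 0 <= w A).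

Lemma cover_outer0 : cover_outer w set0 = 0.
Proof. exact: mu_ext0. Qed.

Lemma cover_outer_ge0 A : 0 <= cover_outer w A.
Proof. exact: mu_ext_ge0. Qed.

Lemma le_cover_outer : {homo cover_outer w : A B / A `<=` B >-> A <= B}.
Proof. exact: (@le_mu_ext _ (g_sigma_algebraType [set: set T]) R w). Qed.

Lemma cover_outer_sigma_subadditive : sigma_subadditive (cover_outer w).
Proof.
exact: (@mu_ext_sigma_subadditive _ (g_sigma_algebraType [set: set T]) R w).
Qed.

End cover_outer_theory.

(* Extent of [A] in the [i]-th coordinate. *)
Definition width d (A : set 'rV[R]_d) (i : 'I_d) : \bar R :=
  ereal_sup [set (p.1 ord0 i - p.2 ord0 i)%:E | p in A `*` A].

(* Volume of the smallest axis-parallel closed box containing [A]; covering by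
   arbitrary sets of this weight is the same as covering by boxes. *)
Definition box_volume d (A : set 'rV[R]_d) : \bar R :=
  if A == set0 then 0 else \prod_(i < d) width A i.

Definition ediam d (A : set 'rV[R]_d) : \bar R :=
  ereal_sup [set (enorm (p.1 - p.2))%:E | p in A `*` A].

Lemma width_ge0 d (A : set 'rV[R]_d) i : A !=set0 -> 0 <= width A i.
Proof.
by move=> [x Ax]; apply: ereal_sup_ubound; exists (x, x); rewrite //= subrr.
Qed.

Lemma box_volume0 d : box_volume (@set0 'rV[R]_d) = 0.
Proof. by rewrite /box_volume eqxx. Qed.

Lemma box_volume_ge0 d (A : set 'rV[R]_d) : 0 <= box_volume A.
Proof.
rewrite /box_volume; case: eqVneq => // /set0P A0.
by apply: prode_ge0 => i _; exact: width_ge0.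
Qed.

Definition lebesgue_outer d : set 'rV[R]_d -> \bar R := cover_outer (@box_volume d).

HB.instance Definition _ d := isOuterMeasure.Build R 'rV[R]_d (@lebesgue_outer d)
  (cover_outer0 (box_volume0 d) (@box_volume_ge0 d))
  (cover_outer_ge0 (@box_volume_ge0 d))
  (@le_cover_outer _ (@box_volume d))
  (cover_outer_sigma_subadditive (@box_volume_ge0 d)).

(* Normalization making the [m]-dimensional Hausdorff measure agree with the
   [m]-dimensional area: (volume of the unit ball of R^m) / 2^m. *)
Definition hausdorff_cst (m : nat) : R :=
  (fine (lebesgue_outer [set x : 'rV[R]_m | enorm x <= 1]) / 2 ^+ m)%R.

Definition hausdorff_weight d (m : nat) (delta : R) (A : set 'rV[R]_d) : \bar R :=
  if A == set0 then 0 else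
  if ediam A <= delta%:E then (hausdorff_cst m)%:E * ediam A ^+ m else +oo.

Lemma hausdorff_cst_ge0 m : (0 <= hausdorff_cst m)%R.
Proof. by rewrite divr_ge0// fine_ge0// outer_measure_ge0. Qed.

Lemma hausdorff_weight0 d m delta : hausdorff_weight m delta (@set0 'rV[R]_d) = 0.
Proof. by rewrite /hausdorff_weight eqxx. Qed.

Lemma hausdorff_weight_ge0 d m delta (A : set 'rV[R]_d) :
  0 <= hausdorff_weight m delta A.
Proof.
rewrite /hausdorff_weight; case: eqVneq => // /set0P[x Ax].
case: ifP => // _; rewrite mule_ge0 ?lee_fin ?hausdorff_cst_ge0//.
apply: expe_ge0; apply: le_ereal_sup_tmp; exists 0 => //.
by exists (x, x) => //=; rewrite subrr /enorm /dot big1 ?sqrtr0// => i _; rewrite mxE mul0r.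
Qed.

Definition hausdorff_outer d (m : nat) (A : set 'rV[R]_d) : \bar R :=
  ereal_sup [set cover_outer (hausdorff_weight m delta) A |
             delta in [set delta : R | (0 < delta)%R]].

Section hausdorff_outer_theory.
Context (d m : nat).
Let H := @hausdorff_outer d m.

Lemma hausdorff_outer_ge0 A : 0 <= H A.
Proof.
apply: le_ereal_sup_tmp; exists (cover_outer (hausdorff_weight m 1) A).
  by exists 1%R; rewrite /= ?ltr01.
exact/cover_outer_ge0/hausdorff_weight_ge0.
Qed.

Lemma hausdorff_outer0 : H set0 = 0.
Proof.
apply/eqP; rewrite eq_le hausdorff_outer_ge0 andbT.
apply: ge_ereal_sup => _ [delta _ <-].
rewrite cover_outer0 ?hausdorff_weight0//.
by move=> A; exact: hausdorff_weight_ge0.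
Qed.

Lemma le_hausdorff_outer : {homo H : A B / A `<=` B >-> A <= B}.
Proof.
move=> A B AB; apply: ge_ereal_sup => _ [delta delta0 <-].
apply: (le_trans (le_cover_outer _ AB)).
by apply: ereal_sup_ubound; exists delta.
Qed.

Lemma hausdorff_outer_sigma_subadditive : sigma_subadditive H.
Proof.
move=> F; apply: ge_ereal_sup => _ [delta delta0 <-].
have w_ge0 A : 0 <= hausdorff_weight (d := d) m delta A.
  exact: hausdorff_weight_ge0.
apply: (le_trans (cover_outer_sigma_subadditive w_ge0 _)).
apply: lee_nneseries => [n *|n _]; first exact: (cover_outer_ge0 w_ge0).
by apply: ereal_sup_ubound; exists delta.
Qed.

End hausdorff_outer_theory.

HB.instance Definition _ d m :=
  isOuterMeasure.Build R 'rV[R]_d (@hausdorff_outer d m)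
  (hausdorff_outer0 d m) (@hausdorff_outer_ge0 d m)
  (@le_hausdorff_outer d m) (@hausdorff_outer_sigma_subadditive d m).

End OuterMeasures.

Definition lebesgue_om (R : realType) (d : nat) :
  {outer_measure set 'rV[R]_d -> \bar R} := @lebesgue_outer R d.

Definition surface_om (R : realType) (d : nat) :
  {outer_measure set 'rV[R]_d -> \bar R} := @hausdorff_outer R d d.-1.

(* Lebesgue measure on R^d, on the sigma-algebra of Lebesgue measurable sets. *)
Definition leb (R : realType) (d : nat) :
  {measure set (caratheodory_type (lebesgue_om R d)) -> \bar R} :=
  lebesgue_om R d.

(* Surface measure: the (d-1)-dimensional Hausdorff measure on R^d. *)
Definition surf (R : realType) (d : nat) :
  {measure set (caratheodory_type (surface_om R d)) -> \bar R} :=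
  surface_om R d.

(** * Interface, boundary data and regularization *)

Section Data.
Context {R : realType} {d : nat}.
Implicit Types (x y : 'rV[R]_d) (gamma Omega omega : set 'rV[R]_d).
Implicit Types (f psi : 'rV[R]_d -> R).

Definition hull (s : {fset 'rV[R]_d}) : set 'rV[R]_d :=
  [set x | exists c : 'rV[R]_d -> R,
     [/\ forall v, v \in s -> 0 <= c v, \sum_(v <- s) c v = 1 &
         x = \sum_(v <- s) c v *: v]].

Definition lipschitz_polytope Omega : Prop :=
  [/\ open Omega, bounded_set Omega, lipschitz_boundary Omega &
      exists P : {fset {fset 'rV[R]_d}},
        closure Omega = \bigcup_(s in [set` P]) hull s].

Definition lipschitz_domain omega : Prop :=
  [/\ open omega, omega !=set0, connected omega & lipschitz_boundary omega].

Definition Linfty_norm gamma f : \bar R :=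
  'N[surf R d]_+oo [EFin \o (f \_ gamma)].

Definition Linfty gamma f : Prop :=
  measurable_fun (gamma : set (caratheodory_type (surface_om R d)))
    (f : caratheodory_type (surface_om R d) -> R) /\
  (Linfty_norm gamma f < +oo)%E.

(* Up to a null set, [gamma] splits into finitely many relatively open pieces on
   each of which [f] has a constant sign. *)
Definition piecewise_signed gamma f : Prop :=
  exists (M : nat) (gamma_ : 'I_M -> set 'rV[R]_d),
    [/\ forall j, gamma_ j !=set0 /\
          exists2 O : set 'rV[R]_d, open O & gamma_ j = O `&` gamma,
        forall i j, i != j -> gamma_ i `&` gamma_ j = set0,
        (\sum_(j < M) surf R d (gamma_ j) = surf R d gamma)%E &
        forall j, {ae surf R d, forall y, gamma_ j y -> 0 <= f y} \/
                  {ae surf R d, forall y, gamma_ j y -> f y <= 0}].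

Definition profile (psi1 : R -> R) : Prop :=
  [/\ forall t, psi1 (- t) = psi1 t, forall t, 0 <= psi1 t,
      forall t, 1 < `|t| -> psi1 t = 0,
      forall s t, 0 <= s -> s <= t -> t <= 1 -> psi1 t <= psi1 s &
      (\int[lebesgue_measure]_t (psi1 t)%:E = 1)%E].

Definition radial_kernel (psi1 : R -> R) x : R :=
  psi1 (enorm x) / \int[leb R d]_y psi1 (enorm y).

Definition tensor_kernel (psi1 : R -> R) x : R :=
  \prod_(i < d) psi1 (x ord0 i).

Definition regularizing_kernel psi : Prop :=
  exists2 psi1 : R -> R, profile psi1 &
    psi = radial_kernel psi1 \/ psi = tensor_kernel psi1.

Definition delta_reg psi (r : R) x : R := r ^- d * psi (r^-1 *: x).

Definition regularized psi gamma f (r : R) x : R :=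
  \int[surf R d]_(y in gamma) (f y * delta_reg psi r (y - x)).

End Data.

(** * Simplicial subdivisions and their refinements *)

(* A cell is represented by its set of vertices, a mesh by its set of cells. *)
Notation cell R d := {fset 'rV[R]_d}.
Notation mesh R d := {fset cell R d}.

Section Meshes.
Context {R : realType} {d : nat}.

Implicit Types (s t : cell R d) (T M S : mesh R d).
Implicit Types (chld : cell R d -> mesh R d).
Implicit Types (refine : mesh R d -> mesh R d -> mesh R d).
Implicit Types (Omega gamma : set 'rV[R]_d).

Definition simplex s : Prop :=
  #|` s| = d.+1 /\
  forall c : 'rV[R]_d -> R, \sum_(v <- s) c v = 0 ->
    \sum_(v <- s) c v *: v = 0 -> forall v, v \in s -> c v = 0.

Definition vol t : R := fine (leb R d (hull t)).

Definition hsize t : R := vol t `^ (d%:R^-1).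

(* [A] is a closed set. *)
Definition triangulates T (A : set 'rV[R]_d) : Prop :=
  [/\ forall t, t \in T -> simplex t,
      forall s t, s \in T -> t \in T -> s != t ->
        (hull s)° `&` (hull t)° = set0 &
      \bigcup_(t in [set` T]) hull t = A].

Definition conforming T : Prop := forall s t, s \in T -> t \in T ->
  hull s `&` hull t = hull (s `&` t)%fset.

(* Cells of the refinement forest rooted at [T0], [chld t] being the set of the
   children of [t]. *)
Inductive forest_cell chld T0 : cell R d -> Prop :=
| forest_root t : t \in T0 -> forest_cell chld T0 t
| forest_child t s : forest_cell chld T0 t -> s \in chld t ->
    forest_cell chld T0 s.

(* [split_into chld T T']: [T'] arises from [T] by successively replacing cells
   by their children. *)
Inductive split_into chld : mesh R d -> mesh R d -> Prop :=
| split_refl T : split_into chld T T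
| split_step T t T' : t \in T -> split_into chld ((T `\ t) `|` chld t)%fset T' ->
    split_into chld T T'.

(* Subdivisions produced from [T0] by successive calls to REFINE. *)
Inductive generated refine T0 : mesh R d -> Prop :=
| generated_init : generated refine T0 T0
| generated_step T M : generated refine T0 T -> (M `<=` T)%fset ->
    generated refine T0 (refine T M).

(* A geometric simplex occurs at most once in the forest rooted at [T0], so the
   labels steering the bisections (newest vertices, types, ...) are functions of
   the cell and need not appear in [chld] and [refine]. Newest vertex bisection
   is the case where [chld t] consists of the two halves of [t], with [q = 2]. *)
Record refinement_strategy (q : R) chld refine T0 : Prop := {
  ratio_gt1 : 1 < q ;
  children_split : forall t, forest_cell chld T0 t ->
    triangulates (chld t) (hull t) /\
    forall s, s \in chld t -> vol t = q * vol s ;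
  refine_split : forall T M, generated refine T0 T -> (M `<=` T)%fset ->
    split_into chld T (refine T M) /\ [disjoint M & refine T M]%fset ;
  refine_conforming : forall T M, generated refine T0 T -> (M `<=` T)%fset ->
    conforming (refine T M) ;
  shape_regular : exists2 kappa : R, 0 < kappa &
    forall T t, generated refine T0 T -> t \in T ->
      exists x rho, [/\ 0 < rho, eball x rho `<=` hull t &
        forall y z, hull t y -> hull t z -> enorm (y - z) <= kappa * rho] ;
  refine_complexity : exists2 Cc : R, 1 <= Cc &
    forall (T_ R_ : nat -> mesh R d) (k : nat), T_ 0%N = T0 ->
      (forall j, (j < k)%N ->
         (R_ j `<=` T_ j)%fset /\ T_ j.+1 = refine (T_ j) (R_ j)) ->
      #|` T_ k|%:R - #|` T0|%:R <= Cc * \sum_(j < k) #|` R_ j|%:R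
}.

Definition interface_cells gamma T : mesh R d :=
  [fset t in T | `[< hull t `&` gamma !=set0 >]]%fset.

Definition diamG gamma T : R :=
  \big[Num.max/0]_(t <- interface_cells gamma T) hsize t.

Fixpoint uniform_refinement chld T0 (i : nat) : mesh R d :=
  if i is j.+1 then (\bigcup_(t <- uniform_refinement chld T0 j) chld t)%fset
  else T0.

Definition sim (c1 c2 A B : R) : Prop := c1 * A <= B <= c2 * A.

Definition initial_grid (q : R) chld T0 gamma : Prop :=
  let S i :=
    \sum_(t <- interface_cells gamma (uniform_refinement chld T0 i)) vol t in
  let qi i := q `^ (- (i%:R / d%:R)) in
  (exists2 c : R, 0 < c & forall s t, s \in interface_cells gamma T0 ->
     t \in interface_cells gamma T0 -> hsize s <= c * hsize t) /\
  exists c1 c2 : R, [/\ 0 < c1, 0 < c2 &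
    forall i, sim c1 c2 (S i) (qi i * S 0%N) /\
              sim c1 c2 (qi i * S 0%N) (qi i * fine (surf R d gamma))].

(** * Data indicators and algorithms *)

Definition indicator (g : 'rV[R]_d -> R) t : R :=
  hsize t * fine ('N[leb R d]_2%:E [EFin \o (g \_ (hull t))]).

Definition data_error (g : 'rV[R]_d -> R) T : R :=
  Num.sqrt (\sum_(t <- T) indicator g t ^+ 2).

(* The algorithms as input-output relations: ties in the selection of marked
   cells may be broken arbitrarily. *)
Inductive INTERFACE refine gamma (r : R) :
  mesh R d -> mesh R d -> Prop :=
| interface_stop T : diamG gamma T <= r / 2 -> INTERFACE refine gamma r T T
| interface_loop T T' : r / 2 < diamG gamma T ->
    INTERFACE refine gamma r
      (refine T [fset t in interface_cells gamma T | r / 2 < hsize t]%fset) T' ->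
    INTERFACE refine gamma r T T'.

Inductive GREEDY refine (g : 'rV[R]_d -> R) (tau : R) :
  mesh R d -> mesh R d -> Prop :=
| greedy_stop T : data_error g T <= tau -> GREEDY refine g tau T T
| greedy_loop T t T' : tau < data_error g T ->
    t \in T -> (forall s, s \in T -> indicator g s <= indicator g t) ->
    GREEDY refine g tau (refine T [fset t]%fset) T' ->
    GREEDY refine g tau T T'.

Definition bulk (g : 'rV[R]_d -> R) (theta : R) T M : Prop :=
  (M `<=` T)%fset /\ theta * data_error g T <= data_error g M.

Inductive DATA refine (g : 'rV[R]_d -> R) (tau theta : R) :
  mesh R d -> mesh R d -> Prop :=
| data_stop T : data_error g T <= tau -> DATA refine g tau theta T T
| data_loop T M T' : tau < data_error g T ->
    bulk g theta T M ->
    (forall M', bulk g theta T M' -> (#|` M| <= #|` M'|)%N) ->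
    DATA refine g tau theta (refine T M) T' ->
    DATA refine g tau theta T T'.

(* The algorithm terminates with an output, and every output satisfies [P]. *)
Definition outputs (alg P : mesh R d -> Prop) : Prop :=
  (exists T, alg T) /\ forall T, alg T -> P T.

End Meshes.

(* Main.v *)
Require Import Defs.
From mathcomp Require Import all_boot all_order all_algebra finmap.
From mathcomp Require Import all_classical all_reals all_analysis.
From mathcomp Require Import measurable_realfun ess_sup_inf.
From mathcomp Require Import ring lra.

Set Implicit Arguments.
Unset Strict Implicit.
Unset Printing Implicit Defensive.
Import Order.TTheory GRing.Theory Num.Theory.
Import numFieldNormedType.Exports.

Local Open Scope classical_set_scope.
Local Open Scope ring_scope.

(** The regularized density satisfies [|F^r| <= C ||f|| / r] and vanishes off the
    [d r]-neighbourhood of [gamma]: locally [gamma] is a Lipschitz graph, so its part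
    in a ball of radius [s] is covered by [C (s / delta)^(d-1)] sets of diameter
    [delta], which bounds its surface measure by [C s^(d-1)] and the volume of its
    [s]-neighbourhood by [C s].  In a conforming shape regular mesh, the size of a
    cell at distance [D] from another one is at most a multiple of [D] or of the
    size of the latter, so the cells which reach the [d r]-neighbourhood after
    INTERFACE have size at most [C r], and their volumes add up to [C r].

    Hence [d(F^r, T)^2 <= A^2 h_T^2 |T|] with [A = C ||f|| / r], and a maximizer [T]
    marked by GREEDY satisfies [tau^2 < C A^2 r h_T^2].  Cells of one level of the
    refinement forest have disjoint interiors and no cell is marked twice, so the
    marks of one level number at most [C r / |T|], and their total is a geometric
    sum governed by the smallest admissible [h_T].  For DATA, the cells with [h_T]
    above a multiple of the current error satisfy the bulk criterion, which bounds
    the number of marks in one step; the error itself decays geometrically.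

    The library integral of a nonnegative, possibly non-measurable function is the
    lower integral; its superadditivity suffices, and the measurability of [F^r]
    is never used. *)

(** * Euclidean space *)

(** [refine_complexity] counts from [T0], whereas the claim counts from the output of INTERFACE. The
    surplus consists of the cells of [T0] and of those marked by INTERFACE, of order [r^(1-d)]. It
    is absorbed as follows: a loop that runs at all has [tau < k C r], where [k], of order
    [||f|| r^(-1/2)], bounds the L2 norm of [F^r]; hence [r^(1-d) <= C^d r k^d / tau^d]. A loop that
    does not run adds no cell. The same quantity [r k^d] is the origin of [r^(1-d/2) ||f||^d].

    Carathéodory measurability is established for half-open cubes and null sets, not for simplices
    or balls. Volumes of cells are therefore summed through cubes in disjoint inscribed balls, at
    the price of a constant factor, and squared norms through the null overlaps of cells.

    Termination belongs to the claim. INTERFACE and GREEDY stop because the bound on the marks holds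
    for every partial run; DATA stops because its error decays. *)

Section EuclideanNorm.
Context {R : realType} {d : nat}.
Implicit Types (x y z : 'rV[R]_d).

Lemma dotC x y : dot x y = dot y x.
Proof. by apply: eq_bigr => i _; rewrite mulrC. Qed.

Lemma dotDl x y z : dot (x + y) z = dot x z + dot y z.
Proof. by rewrite /dot -big_split; apply: eq_bigr => i _; rewrite mxE mulrDl. Qed.

Lemma dotZl (a : R) x y : dot (a *: x) y = a * dot x y.
Proof. by rewrite /dot mulr_sumr; apply: eq_bigr => i _; rewrite mxE mulrA. Qed.

Lemma dotBl x y z : dot (x - y) z = dot x z - dot y z.
Proof. by rewrite -scaleN1r dotDl dotZl mulN1r. Qed.

Lemma dotDr x y z : dot x (y + z) = dot x y + dot x z.
Proof. by rewrite dotC dotDl !(dotC x). Qed.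

Lemma dotZr (a : R) x y : dot x (a *: y) = a * dot x y.
Proof. by rewrite dotC dotZl dotC. Qed.

Lemma dotBr x y z : dot x (y - z) = dot x y - dot x z.
Proof. by rewrite dotC dotBl !(dotC x). Qed.

Lemma dot_ge0 x : 0 <= dot x x.
Proof. by apply: sumr_ge0 => i _; rewrite -expr2 sqr_ge0. Qed.

Lemma enorm_ge0 x : 0 <= enorm x.
Proof. exact: sqrtr_ge0. Qed.

Lemma enorm_sqr x : enorm x ^+ 2 = dot x x.
Proof. by rewrite sqr_sqrtr// dot_ge0. Qed.

Lemma enorm0 : enorm (0 : 'rV[R]_d) = 0.
Proof. by rewrite /enorm -(scale0r 0) dotZl mul0r sqrtr0. Qed.

Lemma enormZ (a : R) x : enorm (a *: x) = `|a| * enorm x.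
Proof.
by rewrite /enorm dotZl dotZr mulrA -expr2 sqrtrM ?sqr_ge0// sqrtr_sqr.
Qed.

Lemma enormN x : enorm (- x) = enorm x.
Proof. by rewrite -scaleN1r enormZ normrN1 mul1r. Qed.

Lemma enormBC x y : enorm (x - y) = enorm (y - x).
Proof. by rewrite -enormN opprB. Qed.

Lemma cauchy_schwarz x y : dot x y <= enorm x * enorm y.
Proof.
have [/eqP y0|y0] := boolP (dot y y == 0).
  have : forall i, y ord0 i = 0.
    move=> i; move: y0 => /eqP; rewrite psumr_eq0; last by move=> j _; rewrite -expr2 sqr_ge0.
    by move=> /allP/(_ i); rewrite mem_index_enum => /(_ isT); rewrite mulf_eq0 orbb => /eqP.
  move=> y0'; rewrite /dot big1 ?mulr_ge0 ?enorm_ge0//.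
  by move=> i _; rewrite y0' mulr0.
have yp : 0 < dot y y by rewrite lt_neqAle eq_sym y0 dot_ge0.
have h : dot x y ^+ 2 <= dot x x * dot y y.
  have := dot_ge0 (dot y y *: x - dot x y *: y).
  rewrite dotBl !dotBr !dotZl !dotZr (dotC y x) => h.
  have : 0 <= dot y y * (dot x x * dot y y - dot x y ^+ 2) by lra.
  by rewrite pmulr_rge0// subr_ge0.
apply: le_trans (ler_norm _) _.
rewrite -ler_sqr ?nnegrE ?mulr_ge0 ?enorm_ge0//.
by rewrite exprMn !enorm_sqr real_normK// num_real.
Qed.

Lemma enormD x y : enorm (x + y) <= enorm x + enorm y.
Proof.
rewrite -ler_sqr ?nnegrE ?addr_ge0 ?enorm_ge0//.
rewrite sqrrD !enorm_sqr dotDl !dotDr (dotC y x) mulr2n.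
have := cauchy_schwarz x y; lra.
Qed.

Lemma enorm_triangle y x z : enorm (x - z) <= enorm (x - y) + enorm (y - z).
Proof. by apply: le_trans (enormD _ _); rewrite addrA subrK. Qed.

Lemma coord_le_enorm x i : `|x ord0 i| <= enorm x.
Proof.
rewrite -ler_sqr ?nnegrE ?enorm_ge0// enorm_sqr real_normK ?num_real//.
rewrite /dot (bigD1 i)//= -expr2 lerDl.
by apply: sumr_ge0 => j _; rewrite -expr2 sqr_ge0.
Qed.

Lemma enorm_le_sum x : enorm x <= \sum_i `|x ord0 i|.
Proof.
rewrite -ler_sqr ?nnegrE ?enorm_ge0 ?sumr_ge0// enorm_sqr.
rewrite expr2 big_distrl; apply: ler_sum => i _ /=.
apply: le_trans (ler_norm _) _; rewrite normrM ler_wpM2l//.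
by rewrite (bigD1 i)//= lerDl sumr_ge0.
Qed.

Lemma enorm_le_coord x (s : R) : (forall i, `|x ord0 i| <= s) -> enorm x <= d%:R * s.
Proof.
move=> xs; apply: le_trans (enorm_le_sum x) _.
apply: le_trans (ler_sum _ (fun i _ => xs i)) _.
by rewrite sumr_const card_ord mulr_natl.
Qed.

Lemma coord_le_norm x i : `|x ord0 i| <= `|x|.
Proof.
rewrite [leRHS]/Num.norm/= mx_normrE.
exact: (le_bigmax _ (fun ij => `|x ij.1 ij.2|) (ord0, i)).
Qed.

Lemma enorm_le_norm x : enorm x <= d%:R * `|x|.
Proof. by apply: enorm_le_coord => i; exact: coord_le_norm. Qed.

Lemma norm_le_enorm x : `|x| <= enorm x.
Proof.
rewrite [leLHS]/Num.norm/= mx_normrE; apply/bigmax_leP; split; first exact: enorm_ge0.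
by move=> [i j] _ /=; rewrite (ord1 i); exact: coord_le_enorm.
Qed.

Lemma eball_open x (r : R) : open (eball x r).
Proof.
rewrite openE => y /= yr.
have e0 : 0 < (r - enorm (y - x)) / d.+1%:R by rewrite divr_gt0// subr_gt0.
apply/nbhs_ballP; exists ((r - enorm (y - x)) / d.+1%:R) => //=.
move=> z; rewrite -ball_normE /= => yz.
apply: le_lt_trans (enorm_triangle y _ _) _; rewrite -ltrBrDr.
rewrite enormBC; apply: le_lt_trans (enorm_le_norm _) _.
rewrite ltr_pdivlMr// in yz; apply: le_lt_trans yz.
by rewrite mulrC ler_wpM2l// ler_nat.
Qed.

Lemma eball_center x (r : R) : 0 < r -> eball x r x.
Proof. by move=> r0; rewrite /eball/= subrr enorm0. Qed.

Lemma nbhs_eball x (A : set 'rV[R]_d) : nbhs x A -> exists2 r : R, 0 < r & eball x r `<=` A.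
Proof.
move=> /nbhs_ballP[e e0 eA]; exists e => // y; rewrite /eball /= => yx.
apply: eA; rewrite -ball_normE/=.
by apply: le_lt_trans yx; rewrite enormBC; exact: norm_le_enorm.
Qed.

Lemma eball_nbhs x (A : set 'rV[R]_d) (r : R) : 0 < r -> eball x r `<=` A -> nbhs x A.
Proof.
move=> r0 rA; apply: (@filterS _ _ _ (eball x r)) => //.
by apply: open_nbhs_nbhs; split; [exact: eball_open|exact: eball_center].
Qed.

End EuclideanNorm.

(** * Lebesgue outer measure *)

Section CoverOuter.
Context {R : realType} (T : pointedType) (w : set T -> \bar R).
Hypotheses (w0 : w set0 = 0%E) (w_ge0 : forall A, (0 <= w A)%E).

Lemma cover_outer_le (A : set T) (B : (set T)^nat) :
  A `<=` \bigcup_k B k -> (cover_outer w A <= \sum_(k <oo) w (B k))%E.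
Proof.
move=> AB; apply: ereal_inf_lbound; exists B => //; split => // i.
exact: sub_sigma_algebra.
Qed.

Lemma cover_outer_le_seq (A : set T) (s : seq (set T)) :
  (forall x, A x -> exists2 B, B \in s & B x) ->
  (cover_outer w A <= \sum_(B <- s) w B)%E.
Proof.
move=> AB; apply: (@le_trans _ _ (\sum_(k <oo) w (nth set0 s k))%E).
  apply: cover_outer_le => x /AB[B Bs Bx].
  have [k kB] : exists k, nth set0 s k = B.
    by exists (index B s); exact: nth_index.
  by exists k => //; rewrite kB.
rewrite (nneseries_split 0 (size s))//= add0n (big_nth set0) eseries0 ?adde0//.
by move=> k sk _; rewrite nth_default.
Qed.

End CoverOuter.

Section LebesgueOuter.
Context {R : realType}.
Local Open Scope ereal_scope.

(** Fubini takes the place of a compactness argument for countable covers. Freezing the first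
    coordinate at [t] multiplies the weight [c k] by an indicator, which is why weights are carried
    through the induction; the resulting series in [t] is integrated term by term. *)
Lemma product_cover_lower_bound (n : nat) (a : nat -> R) (s : R)
    (c : nat -> \bar R) (I : nat -> nat -> set R) : (0 <= s)%R ->
  (forall k, 0 <= c k) -> (forall k i, measurable (I k i)) ->
  (forall x : nat -> R, (forall i, (a i <= x i <= a i + s)%R) ->
     1 <= \sum_(k <oo) c k * \prod_(i < n) (\1_(I k i) (x i))%:E) ->
  (s ^+ n)%:E <= \sum_(k <oo) c k * \prod_(i < n) lebesgue_measure (I k i).
Proof.
move=> s0; elim: n a c I => [|n IH] a c I c0 mI cov.
  have := cov a; rewrite expr0; under eq_eseriesr do rewrite big_ord0.
  under [X in _ -> _ <= X]eq_eseriesr do rewrite big_ord0.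
  by apply => i; rewrite lexx lerDl.
pose C k := c k * \prod_(i < n) lebesgue_measure (I k i.+1).
have C0 k : 0 <= C k by rewrite mule_ge0// prode_ge0.
pose D := `[a 0%N, (a 0%N + s)%R]%classic.
have step (t : R) : D t -> (s ^+ n)%:E <= \sum_(k <oo) C k * (\1_(I k 0%N) t)%:E.
  rewrite /D /= in_itv/= => Dt.
  pose c' k := c k * (\1_(I k 0%N) t)%:E.
  have := IH (fun i => a i.+1) c' (fun k i => I k i.+1).
  under [X in _ -> _ <= X]eq_eseriesr => k _ do rewrite muleAC -/(C k).
  apply => [k|k i //|x xa]; first by rewrite mule_ge0 ?lee_fin.
  have := cov (fun i => if i is j.+1 then x j else t).
  under eq_eseriesr => k _ do rewrite big_ord_recl muleA -/(c' k) /=.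
  by apply => -[|i].
have mD : measurable D by exact: measurable_itv.
have muD : lebesgue_measure D = s%:E.
  rewrite /D lebesgue_measure_itv/= lte_fin ltrDl; case: ltP => // s0'.
    by rewrite -EFinD addrAC subrr add0r.
  by congr EFin; apply/eqP; rewrite eq_le s0 s0'.
apply: (@le_trans _ _ (\int[lebesgue_measure]_(t in D) (s ^+ n)%:E)).
  by rewrite integral_cst// exprSr EFinM; apply: lee_wpmul2l; rewrite ?lee_fin ?exprn_ge0// le_eqVlt; apply/orP; left; apply/eqP.
have mf k : measurable_fun D ((fun t => C k * (\1_(I k 0%N) t)%:E) : R -> \bar R).
  apply: measurable_funTS; apply: measurable_funeM.
  by apply/measurable_EFinP; apply: measurable_indic.
apply: (@le_trans _ _ (\int[lebesgue_measure]_(t in D)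
    (\sum_(k <oo) C k * (\1_(I k 0%N) t)%:E))).
  apply: ge0_le_integral => //.
  - by move=> t _; rewrite lee_fin exprn_ge0.
  - apply: ge0_emeasurable_sum; last by move=> k _; exact: mf.
    by move=> k t _ _; apply: mule_ge0 => //; rewrite lee_fin.
have f0 k t : 0 <= C k * (\1_(I k 0%N) t)%:E by apply: mule_ge0 => //; rewrite lee_fin.
rewrite integral_nneseries; [|exact: mD|exact: mf|by []].
apply: lee_nneseries => [k _ _|k _].
  by apply: integral_ge0 => t _.
have mI0 : measurable_fun D ((fun t => (\1_(I k 0%N) t)%:E) : R -> \bar R).
  by apply: measurable_funTS; apply/measurable_EFinP; exact: measurable_indic.
rewrite ge0_integralZl//.
rewrite integral_indic; [|exact: mD|exact: mI].
rewrite big_ord_recl muleCA [leRHS]muleC -/(C k).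
apply: lee_wpmul2l => //.
apply: le_measure; rewrite ?inE//; [apply: measurableI; [exact: mI|exact: mD]|exact: mI].
Qed.

End LebesgueOuter.

Lemma lee_prod (R : realDomainType) (I : Type) (r : seq I) (F G : I -> \bar R) :
  (forall i, 0 <= F i)%E -> (forall i, F i <= G i)%E ->
  (\prod_(i <- r) F i <= \prod_(i <- r) G i)%E.
Proof.
move=> F0 FG; elim: r => [|i r IH]; first by rewrite !big_nil.
by rewrite !big_cons; apply: lee_pmul => //; apply: prode_ge0 => j _.
Qed.

Section LebesgueOuterBounds.
Context {R : realType} {d : nat}.
Implicit Types (A : set 'rV[R]_d) (c x y : 'rV[R]_d).
Local Open Scope ereal_scope.

Lemma width_le A i (s : R) :
  (forall x y, A x -> A y -> (x ord0 i - y ord0 i <= s)%R) -> width A i <= s%:E.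
Proof. by move=> As; apply: ge_ereal_sup => _ [[x y] /= [Ax Ay] <-]; rewrite lee_fin As. Qed.

Lemma lebesgue_outer_le_cube A c (s : R) :
  (forall x, A x -> forall i, (`|x ord0 i - c ord0 i| <= s)%R) ->
  (0 <= s)%R -> lebesgue_outer A <= ((2 * s) ^+ d)%:E.
Proof.
move=> As s0.
apply: (le_trans (cover_outer_le_seq (s := [:: A]) _ _ _)).
- exact: box_volume0.
- exact: box_volume_ge0.
- by move=> x Ax; exists A => //; rewrite mem_head.
rewrite big_seq1 /box_volume; case: eqVneq => [_|/set0P A0].
  by rewrite lee_fin exprn_ge0// mulr_ge0.
have h i : width A i <= (2 * s)%:E.
  apply: width_le => x y Ax Ay.
  by have := As x Ax i; have := As y Ay i; rewrite !ler_norml; lra.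
rewrite -[in leRHS](card_ord d) -prodr_const -prodEFin.
by apply: lee_prod => // i; exact: width_ge0.
Qed.

(** The factor [2^-d] is lost because each covering set is enlarged to a box centred at one of its
    points, with sides twice its widths. *)
Lemma lebesgue_outer_ge_cube A c (s : R) : (0 <= s)%R ->
  (forall x, (forall i, (c ord0 i <= x ord0 i <= c ord0 i + s)%R) -> A x) ->
  ((s / 2) ^+ d)%:E <= lebesgue_outer A.
Proof.
move=> s0 cA; apply: le_ereal_inf_tmp => _ [B [_ AB] <-].
pose ne k := B k !=set0.
have [p pB] : {p : nat -> 'rV[R]_d & forall k, ne k -> B k (p k)}.
  apply: (@choice _ _ (fun k p => ne k -> B k p)) => k; have [[x Bx]|nB] := pselect (ne k); first by exists x.
  by exists 0%R.
pose W k (i : 'I_d) := width (B k) i.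
(* A set of width [W] lies in [[p - W, p + W]] for each of its points [p]; [setT] serves infinite
   widths, where [fine] would return 0. *)
pose J k (i : 'I_d) : set R := if W k i == +oo then setT else
  `[(p k ord0 i - fine (W k i))%R, (p k ord0 i + fine (W k i))%R]%classic.
pose I k (i : nat) : set R := if insub i is Some j then J k j else set0.
have II k (i : 'I_d) : I k i = J k i by rewrite /I valK.
pose a (i : nat) : R := if insub i is Some j then c ord0 j else 0%R.
(* Weight 0 discards the empty covering sets, for which [p k] is arbitrary. *)
pose C k : \bar R := if `[< ne k >] then 1 else 0.
have C0 k : 0 <= C k by rewrite /C; case: ifP.
have mI k i : measurable (I k i).
  rewrite /I; case: insub => [j|]; last exact: measurable0.
  rewrite /J; case: ifP => _; first exact: measurableT.
  exact: (measurable_itv `[_, _]).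
have cov (x : nat -> R) : (forall i, (a i <= x i <= a i + s)%R) ->
    1 <= \sum_(k <oo) C k * \prod_(i < d) (\1_(I k i) (x i))%:E.
  move=> xa; pose X : 'rV[R]_d := \row_i x i.
  have AX : A X.
    by apply: (cA X) => i; have := xa i; rewrite /a valK mxE.
  have [k _ BkX] := AB _ AX.
  rewrite (nneseriesD1 (n := k))//; last first.
    by move=> j _; apply: mule_ge0 => //; apply: prode_ge0 => i _; rewrite lee_fin.
  apply: (@le_trans _ _ (C k * \prod_(i < d) (\1_(I k i) (x i))%:E)); last first.
    rewrite leeDl//; apply: nneseries_ge0 => j _ _.
    by apply: mule_ge0 => //; apply: prode_ge0 => i _; rewrite lee_fin.
  rewrite /C; case: asboolP => [nek|[]]; last by exists X.
  rewrite mul1e big1// => i _; rewrite II indicE mem_set//= /J.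
  case: eqVneq => // Woo; rewrite /= in_itv/=.
  have Wf : W k i \is a fin_num.
    by rewrite ge0_fin_numE ?ltey//; exact: width_ge0.
  have /andP[h1 h2] : (X ord0 i - p k ord0 i <= fine (W k i))%R &&
                      (p k ord0 i - X ord0 i <= fine (W k i))%R.
    rewrite -!lee_fin !fineK//; apply/andP; split; apply: ereal_sup_ubound.
      by exists (X, p k) => //=; split => //; exact: pB.
    by exists (p k, X) => //=; split => //; exact: pB.
  by move: h1 h2; rewrite !mxE; lra.
have /= := product_cover_lower_bound s0 C0 mI cov.
rewrite expr_div_n EFinM muleC -lee_pdivlMl; last by rewrite invr_gt0 exprn_gt0.
rewrite invrK => /le_trans; apply.
rewrite -nneseriesZl; last by move=> k _; exact: box_volume_ge0.
apply: lee_nneseries => [k _ _|k _].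
  by apply: mule_ge0 => //; apply: prode_ge0.
rewrite /C; case: asboolP => [nek|_]; last first.
  by rewrite mul0e mule_ge0// ?lee_fin ?exprn_ge0//; exact: box_volume_ge0.
rewrite mul1e /box_volume; have /set0P/negbTE-> := nek.
have -> : ((2 ^+ d)%:E = \prod_(i < d) 2%:E :> \bar R).
  by rewrite prodEFin prodr_const card_ord.
rewrite -big_split/=.
apply: lee_prod => // i; rewrite II /J; case: eqVneq => [Woo|Woo].
  by rewrite -/(W k i) Woo gt0_muley ?leey// lte_fin.
have Wf : W k i \is a fin_num.
  by rewrite ge0_fin_numE ?ltey//; exact: width_ge0.
rewrite lebesgue_measure_itv/=; case: ifP => _; last by rewrite mule_ge0//; exact: width_ge0.
by rewrite -/(W k i) -{3}(fineK Wf) -EFinD -EFinM lee_fin; lra.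
Qed.

End LebesgueOuterBounds.

(** * Measurability of half-spaces and cubes; packing of disjoint balls *)

Section HalfSpaces.
Context {R : realType} {d : nat}.
Implicit Types (A B X : set 'rV[R]_d).
Local Open Scope ereal_scope.

Definition half_space (i : 'I_d) (a : R) : set 'rV[R]_d := [set x | (x ord0 i < a)%R].

Lemma le_width A B i : A `<=` B -> width A i <= width B i.
Proof.
move=> AB; apply: ge_ereal_sup => _ [[x y] /= [Ax Ay] <-].
by apply: ereal_sup_ubound; exists (x, y) => //=; split; exact: AB.
Qed.

Lemma le_box_volume A B : A `<=` B -> box_volume A <= box_volume B.
Proof.
move=> AB; have [->|/set0P A0] := eqVneq A set0; first by rewrite box_volume0 box_volume_ge0.
have B0 : B !=set0 by case: A0 => x /AB; exists x.
rewrite /box_volume; move/set0P : (A0) => /negbTE->; move/set0P : (B0) => /negbTE->.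
by apply: lee_prod => i; [exact: width_ge0|exact: le_width].
Qed.

(** For [z], [t] below the cut and [x], [y] above it, [z_i < a <= y_i], so
    [(z_i - t_i) + (x_i - y_i) <= x_i - t_i]. *)
Lemma width_half_space A i (a : R) : A `&` half_space i a !=set0 ->
  width (A `&` half_space i a) i + width (A `&` ~` half_space i a) i <= width A i.
Proof.
move=> A0; have wA : 0 <= width A i.
  by apply: width_ge0; case: A0 => x [Ax _]; exists x.
have [->|wA'] := eqVneq (width A i) +oo; first by rewrite leey.
have wf : width A i \is a fin_num by rewrite ge0_fin_numE ?ltey.
have h1 x y : (A `&` ~` half_space i a) x -> (A `&` ~` half_space i a) y ->
    width (A `&` half_space i a) i <= (fine (width A i) - (x ord0 i - y ord0 i))%:E.
  move=> [Ax _] [_ /= /negP]; rewrite -leNgt => ya.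
  apply: width_le => z t [Az za] [At _]; have {}za : (z ord0 i < a)%R := za.
  have : (x ord0 i - t ord0 i <= fine (width A i))%R.
    by rewrite -lee_fin fineK//; apply: ereal_sup_ubound; exists (x, t).
  lra.
have wHf : width (A `&` half_space i a) i \is a fin_num.
  rewrite ge0_fin_numE; last exact: width_ge0.
  by apply: le_lt_trans (le_width _ (@subIsetl _ _ _)) _; rewrite -ge0_fin_numE.
rewrite -leeBrDl//.
rewrite -[X in _ <= X - _](fineK wf) -[X in _ <= _ - X](fineK wHf) -EFinB; apply: width_le => x y xA yA.
have := h1 _ _ xA yA; rewrite -{1}(fineK wHf) lee_fin; lra.
Qed.

Lemma box_volume_half_space A i (a : R) :
  box_volume (A `&` half_space i a) + box_volume (A `&` ~` half_space i a) <= box_volume A.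
Proof.
have [->|/set0P H1] := eqVneq (A `&` half_space i a) set0.
  by rewrite box_volume0 add0e; apply: le_box_volume; exact: subIsetl.
have [->|/set0P H2] := eqVneq (A `&` ~` half_space i a) set0.
  by rewrite box_volume0 adde0; apply: le_box_volume; exact: subIsetl.
have A0 : A !=set0 by case: H1 => x [Ax _]; exists x.
rewrite /box_volume; move/set0P : (H1) => /negbTE->; move/set0P : (H2) => /negbTE->.
move/set0P : (A0) => /negbTE->.
have E B : \prod_(j < d) width B j = width B i * \prod_(j < d | j != i) width B j.
  by rewrite (bigD1 i).
rewrite !E; set P := \prod_(j < d | j != i) width A j.
have P0 : 0 <= P by apply: prode_ge0 => j _; exact: width_ge0.
have le_P B : B !=set0 -> B `<=` A -> \prod_(j < d | j != i) width B j <= P.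
  move=> B0 BA; rewrite /P !(big_mkcond (fun j => j != i)); apply: lee_prod => j.
    by case: ifP => // _; exact: width_ge0.
  by case: ifP => // _; exact: le_width.
apply: (@le_trans _ _ ((width (A `&` half_space i a) i + width (A `&` ~` half_space i a) i) * P)).
  rewrite ge0_muleDl; [|exact: width_ge0|exact: width_ge0].
  by apply: leeD; (apply: lee_wpmul2l; [exact: width_ge0|apply: le_P => //; exact: subIsetl]).
by apply: lee_wpmul2r => //; exact: width_half_space.
Qed.

(** Cutting every set of a cover along the hyperplane does not increase the total weight, which is
    the Carathéodory inequality. *)
Lemma half_space_measurable i (a : R) : (lebesgue_om R d).-caratheodory (half_space i a).
Proof.
apply: le_caratheodory_measurable => X.
apply: le_ereal_inf_tmp => _ [B [_ XB] <-].
apply: (@le_trans _ _ (\sum_(k <oo) (box_volume (B k `&` half_space i a) +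
                                     box_volume (B k `&` ~` half_space i a)))).
  rewrite nneseriesD; [|by move=> *; exact: box_volume_ge0|by move=> *; exact: box_volume_ge0].
  by apply: leeD; apply: cover_outer_le => x [/XB[k _ Bx] Hx]; exists k.
apply: lee_nneseries => [k _ _|k _]; first by rewrite adde_ge0//; exact: box_volume_ge0.
exact: box_volume_half_space.
Qed.

(** Half-open, hence a finite intersection of half-spaces [x_i < a] and of their complements. *)
Definition cube (c : 'rV[R]_d) (s : R) : set 'rV[R]_d :=
  [set x | forall i, (c ord0 i - s <= x ord0 i < c ord0 i + s)%R].

Lemma cube_measurable c s : (lebesgue_om R d).-caratheodory (cube c s).
Proof.
pose G (i : 'I_d) := half_space i (c ord0 i + s)%R `&` ~` half_space i (c ord0 i - s)%R.
have mG i : (lebesgue_om R d).-caratheodory (G i).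
  apply: caratheodory_measurable_setI; first exact: half_space_measurable.
  by apply: caratheodory_measurable_setC; exact: half_space_measurable.
have mGs (r : seq 'I_d) : (lebesgue_om R d).-caratheodory [set x | forall i, i \in r -> G i x].
  elim: r => [|i r IH].
    rewrite (_ : [set x | _] = ~` set0); last by apply/seteqP; split=> [x _ []|x _ i].
    by apply: caratheodory_measurable_setC; exact: caratheodory_measurable_set0.
  rewrite (_ : [set x | _] = G i `&` [set x | forall i, i \in r -> G i x]).
    exact: caratheodory_measurable_setI.
  apply/seteqP; split=> [x xG|x [xi xr] j].
    by split=> [|j jr]; apply: xG; rewrite inE ?eqxx// jr orbT.
  by rewrite inE => /orP[/eqP->//|/xr].
rewrite (_ : cube c s = [set x | forall i, i \in index_enum 'I_d -> G i x])//.
apply/seteqP; split=> [x xc i _|x xG i].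
  by have /andP[h1 h2] := xc i; split => //; apply/negP; rewrite -leNgt.
have [h1 /negP] := xG i (mem_index_enum i).
by rewrite -leNgt => h2; apply/andP.
Qed.

Lemma lebesgue_outer_ge_cube_half_open c (s : R) : (0 < s)%R ->
  ((s / 2) ^+ d)%:E <= lebesgue_outer (cube c s).
Proof.
move=> s0; apply: (@lebesgue_outer_ge_cube _ _ _ (c - const_mx s)); first exact: ltW.
by move=> x xc i; have := xc i; rewrite !mxE; lra.
Qed.

Lemma cube_sub_eball c (rho : R) : (0 < d)%N -> (0 < rho)%R ->
  cube c (rho / d.+1%:R) `<=` eball c rho.
Proof.
move=> d0 rho0 x xc; rewrite /eball/=.
apply: (@le_lt_trans _ _ (d%:R * (rho / d.+1%:R))%R).
  by apply: enorm_le_coord => i; have := xc i; rewrite !mxE ler_norml; set t := (rho / _)%R; lra.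
by rewrite mulrCA gtr_pMr// ltr_pdivrMr// mul1r ltr_nat.
Qed.

(** Additivity is applied to the measurable cubes inscribed in the balls. Each contains a closed
    cube of side [rho i / (d + 1)], and [lebesgue_outer_ge_cube] halves that side, whence the
    denominator [2 (d + 1)]. *)
Lemma eball_packing (I : choiceType) (S : {fset I}) (c : I -> 'rV[R]_d) (rho : I -> R)
    (E : set 'rV[R]_d) : (0 < d)%N ->
  (forall i, i \in S -> (0 < rho i)%R /\ eball (c i) (rho i) `<=` E) ->
  (forall i j, i \in S -> j \in S -> i != j ->
    eball (c i) (rho i) `&` eball (c j) (rho j) = set0) ->
  (\sum_(i <- S) (rho i / (2 * d.+1%:R)) ^+ d)%:E <= lebesgue_outer E.
Proof.
move=> d0 SE dis; pose Q i := cube (c i) (rho i / d.+1%:R).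
have QB i : i \in S -> Q i `<=` eball (c i) (rho i).
  by move=> /SE[r0 _]; exact: cube_sub_eball.
apply: (@le_trans _ _ (\sum_(i <- S) leb R d (Q i))).
  rewrite -sumEFin big_seq [leRHS]big_seq; apply: lee_sum => i /SE[r0 _].
  rewrite (_ : rho i / (2 * d.+1%:R) = rho i / d.+1%:R / 2)%R; last by rewrite invfM (mulrC 2^-1)%R mulrA.
  by apply: lebesgue_outer_ge_cube_half_open; rewrite divr_gt0.
rewrite -measure_fbigsetU.
- apply: (@le_outer_measure _ _ (lebesgue_om R d)) => x.
  rewrite -bigcup_fset => -[i /= iS /(QB _ iS)]; exact: (SE i iS).2.
- by move=> i _; exact: cube_measurable.
- move=> i j /= iS jS [x [/(QB _ iS) xi /(QB _ jS) xj]].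
  by apply/eqP/negPn/negP => ij; have : set0 x by rewrite -(dis i j).
Qed.

End HalfSpaces.

(** * Coverings of Lipschitz boundaries *)

Section Coverings.
Context {R : realType} {d : nat}.
Implicit Types (A B : set 'rV[R]_d) (e x y z : 'rV[R]_d).

Definition coverable A (N delta : R) : Prop :=
  exists s : seq (set 'rV[R]_d),
    [/\ forall x, A x -> exists2 B, B \in s & B x, (size s)%:R <= N &
        forall B, B \in s -> forall x y, B x -> B y -> enorm (x - y) <= delta].

Lemma coverable_sub A A' N N' delta : A `<=` A' -> N' <= N ->
  coverable A' N' delta -> coverable A N delta.
Proof.
move=> AA' NN' [s [sA sN sd]]; exists s; split => //; last exact: le_trans NN'.
by move=> x /AA'; exact: sA.
Qed.

Lemma coverableU A A' N N' delta : coverable A N delta -> coverable A' N' delta ->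
  coverable (A `|` A') (N + N') delta.
Proof.
move=> [s [sA sN sd]] [s' [sA' sN' sd']]; exists (s ++ s'); split.
- by move=> x [/sA|/sA'] [B Bs Bx]; exists B => //; rewrite mem_cat Bs ?orbT.
- by rewrite size_cat natrD lerD.
- by move=> B ; rewrite mem_cat => /orP[/sd|/sd'].
Qed.

Definition graph e (phi : 'rV[R]_d -> R) : set 'rV[R]_d :=
  [set y | dot y e = phi (y - dot y e *: e)].

Lemma proj_enorm_le e y : enorm e = 1 -> enorm (y - dot y e *: e) <= enorm y.
Proof.
move=> e1; rewrite -ler_sqr ?nnegrE ?enorm_ge0// !enorm_sqr.
have ee : dot e e = 1 by rewrite -enorm_sqr e1 expr1n.
rewrite dotBl !dotBr !dotZl !dotZr (dotC e y) ee mulr1 subrr subr0.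
by rewrite gerBl -expr2 sqr_ge0.
Qed.

(** Points are projected along the unit vector [e] and sorted by a grid of mesh [t] in all
    coordinates but one, [i], chosen with [|e_i| >= 1/d]. Orthogonality to [e] recovers coordinate
    [i] of the projection from the others, and the Lipschitz bound recovers the height; so only
    [d - 1] grid directions are counted. *)
Lemma graph_coverable e phi (L : R) : (0 < d)%N -> enorm e = 1 ->
  (forall y z, `|phi y - phi z| <= L * enorm (y - z)) ->
  exists2 C : R, 0 < C & forall z s delta, 0 < delta -> delta <= s ->
    coverable (graph e phi `&` eball z s) (C * (s / delta) ^+ d.-1) delta.
Proof.
move=> d0 e1 phiL.
have [i ei] : exists i : 'I_d, d%:R^-1 <= `|e ord0 i|.
  apply: contrapT => /forallNP h.
  have : enorm e < 1; last by rewrite e1 ltxx.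
  apply: le_lt_trans (enorm_le_sum e) _.
  have -> : 1 = \sum_(i < d) d%:R^-1 :> R.
    by rewrite sumr_const card_ord -[RHS]mulr_natr mulVf// pnatr_eq0 -lt0n.
  apply: ltr_sum; first by apply/hasP; exists (Ordinal d0) => //; rewrite mem_index_enum.
  by move=> i _; rewrite ltNge; apply/negP/h.
have e_le j : `|e ord0 j| <= 1 by rewrite -e1 coord_le_enorm.
pose P y := y - dot y e *: e.
have PB x y : P (x - y) = P x - P y.
  by apply/rowP => j; rewrite /P dotBl !mxE; ring.
(* Within a piece the projections differ by at most [t] in the grid coordinates, [d^2 t] in
   coordinate [i], hence [d^3 t] in norm; the heights differ by at most [|L| d^3 t]. So
   [t = delta / K] gives diameter [delta]. *)
pose K : R := d%:R ^+ 3 * (1 + `|L|).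
have dge1 : 1 <= d%:R :> R by rewrite ler1n.
have K1 : 1 <= K by rewrite /K mulr_ege1 ?exprn_ege1// lerDl.
have K0 : 0 < K by apply: lt_le_trans K1.
exists ((3 * K) ^+ d.-1); first by rewrite exprn_gt0// mulr_gt0.
move=> z s delta delta0 ds.
pose t := delta / K; have t0 : 0 < t by rewrite divr_gt0.
have ts : t <= s by apply: le_trans ds; rewrite ler_pdivrMr// ler_peMr// ltW.
have s0 : 0 < s by exact: lt_le_trans ts.
pose n := (Num.truncn (2 * s / t)).+1.
pose idx y (j : 'I_d.-1) := Num.truncn ((P y ord0 (lift i j) - P z ord0 (lift i j) + s) / t).
pose piece (g : {ffun 'I_d.-1 -> 'I_n}) :=
  [set y | (graph e phi `&` eball z s) y /\ forall j, idx y j = g j].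
have bnd y j : eball z s y -> 0 <= (P y ord0 j - P z ord0 j + s) / t <= 2 * s / t.
  move=> yz; have : `|P y ord0 j - P z ord0 j| < s.
    apply: le_lt_trans yz; apply: le_trans (proj_enorm_le _ e1); rewrite -/(P _) PB.
    by apply: le_trans (coord_le_enorm _ j); rewrite !mxE.
  rewrite ltr_norml => /andP[h1 h2]; rewrite divr_ge0 ?(ltW t0)//=; last lra.
  by rewrite ler_pM2r ?invr_gt0//; lra.
exists [seq piece g | g <- enum {ffun 'I_d.-1 -> 'I_n}]; split.
- move=> y [yG yz].
  have idx_lt j : (idx y j < n)%N by rewrite ltnS; apply: le_truncn; case/andP: (bnd y (lift i j) yz).
  exists (piece [ffun j => Ordinal (idx_lt j)]).
    by apply: map_f; rewrite mem_enum.
  by split => // j; rewrite ffunE.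
(* The number of intervals is at most [2 s / t + 1 <= 3 s / t], because [t <= s]. *)
- have n3 : n%:R <= 3 * K * (s / delta).
    rewrite /n -natr1.
    have : (Num.truncn (2 * s / t))%:R <= 2 * s / t.
      by rewrite truncn_le; apply: divr_ge0; [apply: mulr_ge0 => //; exact: ltW|exact: ltW].
    have : 1 <= s / t by rewrite ler_pdivlMr// mul1r.
    have -> : 3 * K * (s / delta) = 3 * (s / t) by rewrite /t; field; rewrite !gt_eqF.
    rewrite -mulrA; lra.
  rewrite size_map -cardE card_ffun !card_ord natrX -exprMn.
  by apply: lerXn2r; rewrite ?nnegrE// (le_trans _ n3).
- move=> _ /mapP[g _ ->] x y [[xG xz] xg] [[yG yz] yg].
  pose u := P (x - y).
  have uj j : j != i -> `|u ord0 j| <= t.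
    case: (unliftP i j) => [j' ->|->]; last by rewrite eqxx.
    move=> _; have := etrans (xg j') (esym (yg j')).
    have /andP[hx _] := bnd x (lift i j') xz; have /andP[hy _] := bnd y (lift i j') yz.
    have -> : u ord0 (lift i j') = P x ord0 (lift i j') - P y ord0 (lift i j').
      by rewrite /u PB mxE [X in _ + X]mxE.
    have := truncn_itv hx; have := truncn_itv hy; rewrite -/(idx x j') -/(idx y j') => + + h; rewrite h.
    rewrite -natr1 !(ler_pdivlMr _ _ t0) !(ltr_pdivrMr _ _ t0).
    set px := P x _ _; set py := P y _ _; set pz := P z _ _.
    by rewrite ler_norml; lra.
  have ue : dot e u = 0.
    have ee : dot e e = 1 by rewrite -enorm_sqr e1 expr1n.
    by rewrite /u /P dotBr dotZr ee mulr1 dotC subrr.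
  have ui : `|u ord0 i| <= d%:R ^+ 2 * t.
    have : `|e ord0 i * u ord0 i| <= d%:R * t.
      have -> : e ord0 i * u ord0 i = - \sum_(j < d | j != i) e ord0 j * u ord0 j.
        by move: ue; rewrite /dot (bigD1 i)//=; lra.
      rewrite normrN; apply: le_trans (ler_norm_sum _ _ _) _.
      apply: (@le_trans _ _ (\sum_(j < d | j != i) t)).
        by apply: ler_sum => j /uj h; rewrite normrM -[leRHS]mul1r ler_pM.
      by rewrite sumr_const -[leLHS]mulr_natl ler_wpM2r ?(ltW t0)// ler_nat -[leqRHS]card_ord max_card.
    rewrite normrM => h; rewrite expr2 -mulrA.
    have dp : 0 < d%:R :> R by rewrite ltr0n.
    rewrite -ler_pdivrMl//; apply: le_trans h.
    by rewrite ler_wpM2r.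
  have ub : enorm u <= d%:R ^+ 3 * t.
    rewrite exprS -mulrA; apply: enorm_le_coord => j.
    have [->//|/uj h] := eqVneq j i; apply: le_trans h _.
    by rewrite ler_peMl ?(ltW t0)// exprn_ege1.
  have xye : `|dot (x - y) e| <= `|L| * (d%:R ^+ 3 * t).
    rewrite dotBl xG yG -/(P x) -/(P y); apply: le_trans (phiL _ _) _.
    rewrite -PB -/u; apply: (@le_trans _ _ (`|L| * enorm u)).
      by rewrite ler_wpM2r ?enorm_ge0// ler_norm.
    by rewrite ler_wpM2l.
  have -> : x - y = u + dot (x - y) e *: e by rewrite /u /P subrK.
  apply: le_trans (enormD _ _) _; rewrite enormZ e1 mulr1.
  have -> : delta = d%:R ^+ 3 * t + `|L| * (d%:R ^+ 3 * t).
    by rewrite /t /K; field; rewrite pnatr_eq0 -lt0n d0 /= gt_eqF// ltr_pwDl.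
  exact: lerD.
Qed.

End Coverings.

Lemma bounded_sub_eball (R : realType) (d : nat) (A : set 'rV[R]_d) :
  bounded_set A -> exists2 M : R, 0 < M & A `<=` eball 0 M.
Proof.
move=> [M0 [_ AM]]; exists (d.+1%:R * (`|M0| + 1)); first by rewrite mulr_gt0// ltr_pwDr.
move=> x Ax; rewrite /eball/= subr0; apply: le_lt_trans (enorm_le_norm x) _.
apply: (@le_lt_trans _ _ (d%:R * (`|M0| + 1))).
  by rewrite ler_wpM2l// AM// (le_lt_trans (ler_norm _))// ltrDl.
by rewrite ltr_pM2r ?ltr_nat// ltr_pwDr.
Qed.

Lemma outer_measure_le_seq (R : realType) (T : Type) (mu : {outer_measure set T -> \bar R})
    (A : set T) (s : seq (set T)) :
  (forall x, A x -> exists2 B, B \in s & B x) -> (mu A <= \sum_(B <- s) mu B)%E.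
Proof.
move=> sA; apply: (@le_trans _ _ (mu (\bigcup_k nth set0 s k))).
  apply: le_outer_measure => x /sA[B Bs Bx]; exists (index B s) => //.
  by rewrite nth_index.
apply: le_trans (outer_measure_sigma_subadditive mu _) _.
rewrite (nneseries_split 0 (size s)); last by move=> k _; exact: outer_measure_ge0.
rewrite add0n eseries0 ?adde0; last by move=> k sk _; rewrite nth_default// outer_measure0.
by rewrite (big_nth set0).
Qed.

(** * Measure bounds from coverings; Lipschitz boundaries as local graphs *)

Section CoveringBounds.
Context {R : realType} {d : nat}.
Implicit Types (A B : set 'rV[R]_d) (x y z : 'rV[R]_d).

Definition thickening A (rho : R) : set 'rV[R]_d :=
  [set x | exists2 y, A y & enorm (x - y) <= rho].

Lemma lebesgue_outer_thickening A (N delta rho : R) : 0 <= delta -> 0 <= rho ->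
  coverable A N delta ->
  (lebesgue_outer (thickening A rho) <= (N * (2 * (delta + rho)) ^+ d)%:E)%E.
Proof.
move=> delta0 rho0 [s [sA sN sd]].
pose b : R := (2 * (delta + rho)) ^+ d.
have b0 : 0 <= b by rewrite exprn_ge0// mulr_ge0// addr_ge0.
have h B : B \in s -> (lebesgue_outer (thickening B rho) <= b%:E)%E.
  move=> Bs; have [->|/set0P[y By]] := eqVneq B set0.
    rewrite (_ : thickening _ _ = set0) ?outer_measure0//.
    by apply/seteqP; split=> // x [].
  apply: (lebesgue_outer_le_cube (c := y)); last exact: addr_ge0.
  move=> x [y' By' xy'] i.
  have := coord_le_enorm (x - y) i; rewrite !mxE => /le_trans; apply.
  rewrite [leRHS]addrC; apply: le_trans (enorm_triangle y' _ _) _.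
  by apply: lerD => //; exact: (sd B).
pose f B := thickening B rho.
apply: (le_trans (outer_measure_le_seq (lebesgue_om R d) (s := [seq f B | B <- s]) _)).
  move=> x [y /sA[B Bs By] xy].
  by exists (f B); [exact: map_f|exists y].
rewrite big_map big_seq.
apply: (@le_trans _ _ (\sum_(B <- s | B \in s) b%:E)%E); first exact: lee_sum.
rewrite -big_seq sumEFin lee_fin big_const_seq count_predT iter_addr_0.
by rewrite -[leLHS]mulr_natl ler_wpM2r.
Qed.

Lemma ediam_le B (delta : R) : (forall x y, B x -> B y -> enorm (x - y) <= delta) ->
  (ediam B <= delta%:E)%E.
Proof. by move=> Bd; apply: ge_ereal_sup => _ [[x y] /= [Bx By] <-]; rewrite lee_fin Bd. Qed.

Lemma hausdorff_weight_le m B (delta eta : R) : 0 <= delta -> delta <= eta ->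
  (forall x y, B x -> B y -> enorm (x - y) <= delta) ->
  (hausdorff_weight m eta B <= (hausdorff_cst m * delta ^+ m)%:E)%E.
Proof.
move=> delta0 de Bd; rewrite /hausdorff_weight; case: eqVneq => [_|/set0P[x Bx]].
  by rewrite lee_fin mulr_ge0 ?exprn_ge0 ?hausdorff_cst_ge0.
have Bd' := ediam_le Bd.
rewrite (le_trans Bd') ?lee_fin//.
rewrite [leRHS]EFinM EFin_expe; apply: lee_wpmul2l; first by rewrite lee_fin hausdorff_cst_ge0.
have Bd0 : (0 <= ediam B)%E.
  apply: le_ereal_sup_tmp; exists 0%E => //.
  by exists (x, x) => //=; rewrite subrr enorm0.
elim: m => [|m IH]; first by rewrite !expe0.
by rewrite !expeS; apply: lee_pmul => //; exact: expe_ge0.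
Qed.

(** [C (s / delta)^m] sets of weight proportional to [delta^m] have a total weight independent of
    [delta], so the bound passes to the supremum over the mesh parameter. *)
Lemma hausdorff_outer_coverable A (m : nat) (s C : R) : 0 < s -> 0 <= C ->
  (forall delta, 0 < delta -> delta <= s -> coverable A (C * (s / delta) ^+ m) delta) ->
  (hausdorff_outer m A <= (C * hausdorff_cst m * s ^+ m)%:E)%E.
Proof.
move=> s0 C0 cA; apply: ge_ereal_sup => _ [eta /= eta0 <-].
pose delta := Num.min s eta.
have d0 : 0 < delta by rewrite lt_min s0.
have ds : delta <= s by rewrite ge_min lexx.
have de : delta <= eta by rewrite ge_min lexx orbT.
have [r [rA rN rd]] := cA delta d0 ds.
apply: (le_trans (cover_outer_le_seq (s := r) _ _ rA)).
- exact: hausdorff_weight0.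
- exact: hausdorff_weight_ge0.
apply: (@le_trans _ _ (\sum_(B <- r | B \in r) (hausdorff_cst m * delta ^+ m)%:E)%E).
  rewrite big_seq; apply: lee_sum => B Br; apply: hausdorff_weight_le; first exact: ltW.
    exact: de.
  exact: rd.
rewrite -big_seq sumEFin lee_fin big_const_seq count_predT iter_addr_0.
rewrite -[leLHS]mulr_natl.
have w0 : 0 <= hausdorff_cst m * delta ^+ m by rewrite mulr_ge0 ?hausdorff_cst_ge0// exprn_ge0// ltW.
apply: le_trans (ler_wpM2r w0 rN) _; rewrite le_eqVlt; apply/orP; left; apply/eqP.
rewrite expr_div_n; field; by rewrite expf_neq0// gt_eqF.
Qed.

(** A hyperplane is the graph of a constant function: a bounded part of it is covered by about
    [delta^(1-d)] sets, whose [delta]-thickenings have total volume of order [delta]. *)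
Lemma hyperplane_null A (n : 'rV[R]_d) (a : R) : (1 < d)%N -> n != 0 -> bounded_set A ->
  (forall x, A x -> dot x n = a) -> lebesgue_outer A = 0%E.
Proof.
move=> d1 n0 bA An; have d0 : (0 < d)%N by exact: ltnW.
have nn : 0 < enorm n.
  rewrite lt_neqAle enorm_ge0 andbT eq_sym; apply: contra n0 => /eqP nn0.
  apply/eqP/rowP => i; rewrite mxE; apply/eqP; rewrite -normr_eq0 eq_le normr_ge0 andbT.
  by rewrite -nn0 coord_le_enorm.
pose e := (enorm n)^-1 *: n.
have e1 : enorm e = 1 by rewrite enormZ ger0_norm ?invr_ge0 ?enorm_ge0// mulVf ?gt_eqF.
have Ag : A `<=` graph e (fun=> (enorm n)^-1 * a).
  by move=> x /An xa; rewrite /graph/= dotZr xa.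
have [C C0 cov] : exists2 C : R, 0 < C & forall z s delta, 0 < delta -> delta <= s ->
    coverable (graph e (fun=> (enorm n)^-1 * a) `&` eball z s) (C * (s / delta) ^+ d.-1) delta.
  by apply: (graph_coverable (L := 0)) => // y z; rewrite subrr normr0 mul0r.
have [M M0 AM] := bounded_sub_eball bA.
have le_delta delta : 0 < delta -> delta <= M ->
    (lebesgue_outer A <= (C * 4 ^+ d * M ^+ d.-1 * delta)%:E)%E.
  move=> dp dM; have cA : coverable A (C * (M / delta) ^+ d.-1) delta.
    by apply: coverable_sub (cov 0 M delta dp dM) => // x Ax; split; [exact: Ag|exact: AM].
  apply: (@le_trans _ _ (lebesgue_outer (thickening A delta))).
    by apply: (@le_outer_measure _ _ (lebesgue_om R d)) => x Ax; exists x; rewrite // subrr enorm0 ltW.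
  apply: le_trans (lebesgue_outer_thickening (ltW dp) (ltW dp) cA) _.
  rewrite lee_fin le_eqVlt; apply/orP; left; apply/eqP.
  have -> : 2 * (delta + delta) = 4 * delta by ring.
  rewrite -[in X in _ * X](prednK d0) -[in 4 ^+ d](prednK d0) expr_div_n exprMn !exprS.
  by field; rewrite expf_neq0// gt_eqF.
apply/eqP; rewrite eq_le (outer_measure_ge0 (lebesgue_om R d)) andbT.
apply/lee_addgt0Pr => eps eps0; rewrite add0e.
set K := C * 4 ^+ d * M ^+ d.-1 in le_delta.
have K0 : 0 < K by rewrite !mulr_gt0 ?exprn_gt0.
pose delta := Num.min M (eps / K).
have dp : 0 < delta by rewrite lt_min M0 divr_gt0.
apply: le_trans (le_delta delta dp _) _; first by rewrite ge_min lexx.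
by rewrite lee_fin mulrC -ler_pdivlMr// ge_min lexx orbT.
Qed.

(** The signed height [g] below the graph is Lipschitz. Where it is positive a whole ball lies in
    [U], so the point is interior; where it is negative a whole ball misses [U], so the point is not
    in the closure. *)
Lemma boundary_sub_graph (U : set 'rV[R]_d) x e (rho L : R) (phi : 'rV[R]_d -> R) :
  (forall y z, `|phi y - phi z| <= L * enorm (y - z)) -> enorm e = 1 ->
  (forall y, eball x rho y -> (U y <-> dot y e < phi (y - dot y e *: e))) ->
  boundary U `&` eball x rho `<=` graph e phi.
Proof.
move=> phiL e1 Ue y [[cUy niUy] xy].
pose g z := phi (z - dot z e *: e) - dot z e.
have gL z z' : `|g z - g z'| <= (`|L| + 1) * enorm (z - z').
  have -> : g z - g z' = (phi (z - dot z e *: e) - phi (z' - dot z' e *: e)) - dot (z - z') e.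
    by rewrite /g dotBl; ring.
  apply: le_trans (ler_normB _ _) _; rewrite mulrDl mul1r; apply: lerD.
    apply: le_trans (phiL _ _) _.
    rewrite (_ : _ - (z' - _) = (z - z') - dot (z - z') e *: e); last first.
      by apply/rowP => j; rewrite dotBl !mxE; ring.
    apply: le_trans (ler_wpM2r (enorm_ge0 _) (ler_norm _)) _.
    by rewrite ler_wpM2l// proj_enorm_le.
  rewrite ler_norml; have := cauchy_schwarz (z - z') e; have := cauchy_schwarz (- (z - z')) e.
  by rewrite enormN e1 mulr1 -scaleN1r dotZl; lra.
have [r r0 ry] := nbhs_eball (open_nbhs_nbhs (conj (@eball_open _ _ x rho) xy)).
have K0 : 0 < `|L| + 1 by rewrite ltr_pwDr.
have near_y z : eball y (`|g y| / (`|L| + 1)) z -> `|g z - g y| < `|g y|.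
  by rewrite /eball/= => yz; apply: le_lt_trans (gL _ _) _; rewrite mulrC -ltr_pdivlMr.
have nbhs_y (P : set 'rV[R]_d) : g y != 0 ->
    (forall z, eball x rho z -> eball y (`|g y| / (`|L| + 1)) z -> P z) -> nbhs y P.
  move=> gy0 hP; apply: (@eball_nbhs _ _ _ _ (Num.min r (`|g y| / (`|L| + 1)))).
    by rewrite lt_min r0 divr_gt0// normr_gt0.
  by move=> z; rewrite /eball/= lt_min => /andP[zr zg]; apply: hP; [exact: ry|].
apply/eqP; rewrite eq_sym -subr_eq0 -/(g y); apply/negPn/negP => gy0.
have [gyp|gyn] := ltP 0 (g y).
  apply: niUy; apply: nbhs_y => // z zx /near_y zy; apply/(Ue z zx).
  by move: zy; rewrite (gtr0_norm gyp) ltr_norml /g; lra.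
have {}gyn : g y < 0 by rewrite lt_neqAle gy0.
have [z [Uz nUz]] : U `&` [set z | ~ U z] !=set0.
  apply: cUy; apply: nbhs_y => // z zx /near_y zy /(Ue z zx).
  by move: zy; rewrite (ltr0_norm gyn) ltr_norml /g; lra.
exact: nUz.
Qed.

End CoveringBounds.

(** * Uniform constants for bounded Lipschitz boundaries *)

Section LipschitzBoundary.
Context {R : realType} {d : nat}.
Variable U : set 'rV[R]_d.
Hypotheses (d0 : (0 < d)%N) (bU : bounded_set U) (lU : lipschitz_boundary U).

Lemma boundary_bounded : bounded_set (boundary U).
Proof.
have [M M0 UM] := bounded_sub_eball bU.
exists (M + 1); split; first exact: num_real.
move=> t Mt x [cUx _]; apply: le_trans (ltW Mt).
have [y [/UM yM xy]] := cUx _ (eball_nbhs (x := x) ltr01 (fun _ => id)).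
apply: le_trans (norm_le_enorm x) _; rewrite -[x](subr0).
apply: le_trans (enorm_triangle y _ _) _; rewrite enormBC addrC.
by move: yM xy; rewrite /eball/= subr0 => /ltW yM /ltW xy; exact: lerD.
Qed.

Lemma boundary_compact : compact (boundary U).
Proof.
apply: bounded_closed_compact; first exact: boundary_bounded.
rewrite /boundary setDE; apply: closedI; first exact: closed_closure.
by apply: open_closedC; exact: open_interior.
Qed.

(** Compactness leaves finitely many graph charts, whose constants add up; each chart bound already
    holds for all [z], [s] and [delta]. *)
Lemma boundary_coverable : exists2 C : R, 0 < C &
  forall z s delta, 0 < delta -> delta <= s ->
    coverable (boundary U `&` eball z s) (C * (s / delta) ^+ d.-1) delta.
Proof.
have loc x : exists p : R * R, boundary U x -> [/\ 0 < p.1, 0 < p.2 &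
    forall z s delta, 0 < delta -> delta <= s ->
      coverable (boundary U `&` eball x p.1 `&` eball z s) (p.2 * (s / delta) ^+ d.-1) delta].
  have [Ux|nUx] := pselect (boundary U x); last by exists (0, 0).
  have [e [rho [L [phi [e1 rho0 phiL Ue]]]]] := lU Ux.
  have [C C0 cov] := graph_coverable d0 e1 phiL.
  exists (rho, C) => _; split => // z s delta delta0 ds.
  apply: coverable_sub (cov z s delta delta0 ds) => // y [yU yz]; split => //.
  exact: (boundary_sub_graph phiL e1 Ue).
have [p pP] := choice loc.
have := boundary_compact; rewrite compact_cover => /(_ _ (boundary U) (fun x => eball x (p x).1)).
case.
- by move=> x _; exact: eball_open.
- by move=> x Ux; exists x => //; apply: eball_center; have [] := pP x Ux.
move=> D DU cD.
have pos x : x \in D -> [/\ 0 < (p x).1, 0 < (p x).2 &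
    forall z s delta, 0 < delta -> delta <= s ->
      coverable (boundary U `&` eball x (p x).1 `&` eball z s) ((p x).2 * (s / delta) ^+ d.-1) delta].
  by move=> xD; apply: pP; have := DU x xD; rewrite inE.
exists (1 + \sum_(x <- D) (p x).2).
  by rewrite ltr_pwDl// big_seq sumr_ge0// => x /pos[_ /ltW].
move=> z s delta delta0 ds.
have h (r : seq 'rV[R]_d) : {subset r <= D} ->
    coverable (\bigcup_(x in [set` r]) (boundary U `&` eball x (p x).1 `&` eball z s))
      ((\sum_(x <- r) (p x).2) * (s / delta) ^+ d.-1) delta.
  elim: r => [|x r IH] rD.
    rewrite big_nil mul0r; exists [::]; split => //.
    by move=> y [x].
  rewrite big_cons mulrDl.
  have xD : x \in D by apply: rD; rewrite mem_head.
  have rD' : {subset r <= D} by move=> y yr; apply: rD; rewrite inE yr orbT.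
  have [_ _ hx] := pos x xD.
  apply: coverable_sub (coverableU (hx z s delta delta0 ds) (IH rD')) => // y [x' /=].
  by rewrite inE => /orP[/eqP-> ?|x'r ?]; [left|right; exists x'].
apply: coverable_sub (h D (fun _ => id)).
  by move=> y [yU yz]; have [x xD yx] := cD y yU; exists x.
by rewrite ler_wpM2r ?lerDr// exprn_ge0// divr_ge0 ?ltW// (lt_le_trans delta0).
Qed.

Lemma surface_boundary_eball : exists2 C : R, 0 < C & forall z s, 0 < s ->
  (surf R d (boundary U `&` eball z s) <= (C * s ^+ d.-1)%:E)%E.
Proof.
have [C C0 cov] := boundary_coverable.
exists (C * hausdorff_cst d.-1 + 1).
  by rewrite ltr_pwDr// mulr_ge0 ?hausdorff_cst_ge0// ltW.
move=> z s s0; apply: (@le_trans _ _ (C * hausdorff_cst d.-1 * s ^+ d.-1)%:E).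
  by apply: hausdorff_outer_coverable => // [|delta *]; [exact: ltW|exact: cov].
by rewrite lee_fin ler_wpM2r ?lerDl// exprn_ge0// ltW.
Qed.

Lemma lebesgue_boundary_thickening (rmax : R) : exists2 C : R, 0 < C & forall rho,
  0 < rho -> rho <= rmax ->
  (lebesgue_outer (thickening (boundary U) rho) <= (C * rho)%:E)%E.
Proof.
have [C C0 cov] := boundary_coverable.
have [M M0 UM] := bounded_sub_eball boundary_bounded.
(* [S] dominates the boundary, so that one ball contains it, and also [rho], as the covering bound
   demands; [(S / rho)^(d-1) (4 rho)^d] is then linear in [rho]. *)
pose S := Num.max M rmax.
have S0 : 0 < S by rewrite lt_max M0.
exists (C * 4 ^+ d * S ^+ d.-1); first by rewrite !mulr_gt0 ?exprn_gt0.
move=> rho rho0 rhomax.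
have rS : rho <= S by rewrite le_max rhomax orbT.
have cU : coverable (boundary U) (C * (S / rho) ^+ d.-1) rho.
  apply: coverable_sub (cov 0 S rho rho0 rS) => // x Ux; split => //.
  by apply: lt_le_trans (UM _ Ux) _; rewrite le_max lexx.
apply: le_trans (lebesgue_outer_thickening (ltW rho0) (ltW rho0) cU) _.
rewrite lee_fin le_eqVlt; apply/orP; left; apply/eqP.
have -> : 2 * (rho + rho) = 4 * rho by ring.
rewrite -[in X in _ * X](prednK d0) -[in 4 ^+ d](prednK d0) expr_div_n exprMn !exprS.
by field; rewrite expf_neq0// gt_eqF.
Qed.

End LipschitzBoundary.

(** * Lower integrals *)

Section LowerIntegral.
Context {R : realType} {T : pointedType} (mu : {outer_measure set T -> \bar R}).
Let m : {measure set (caratheodory_type mu) -> \bar R} := mu.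
Import HBNNSimple.
Implicit Types (f g : T -> \bar R) (A B N : set T).
Local Open Scope ereal_scope.

Lemma outer_null_measurable N : mu N = 0 -> measurable (N : set (caratheodory_type mu)).
Proof.
move=> N0; apply: le_caratheodory_measurable => X.
rewrite (_ : mu (X `&` N) = 0) ?add0e; first by apply: le_outer_measure; exact: subIsetl.
by apply/eqP; rewrite eq_le outer_measure_ge0 andbT -N0; apply: le_outer_measure; exact: subIsetr.
Qed.

Lemma lower_integral_leP f (c : \bar R) : (forall x, 0 <= f x) ->
  (forall h : {nnsfun (caratheodory_type mu) >-> R},
     (forall x, (h x)%:E <= f x) -> \int[m]_x (h x)%:E <= c) ->
  \int[m]_x f x <= c.
Proof.
move=> f0 hc; rewrite ge0_integralTE//; apply: ge_ereal_sup => _ [h /= hf <-].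
by rewrite -integralT_nnsfun; exact: hc.
Qed.

Lemma simple_le_lower_integral f (h : {nnsfun (caratheodory_type mu) >-> R}) :
  (forall x, 0 <= f x) -> (forall x, (h x)%:E <= f x) ->
  \int[m]_x (h x)%:E <= \int[m]_x f x.
Proof.
move=> f0 hf; rewrite [leRHS]ge0_integralTE// integralT_nnsfun.
by apply: ereal_sup_ubound; exists h.
Qed.

Lemma le_lower_integral f g : (forall x, 0 <= f x) -> (forall x, f x <= g x) ->
  \int[m]_x f x <= \int[m]_x g x.
Proof.
move=> f0 fg; apply: lower_integral_leP => // h hf.
by apply: simple_le_lower_integral => x; [exact: le_trans (fg x)|exact: le_trans (fg x)].
Qed.

(** The set [A] may be arbitrary: a simple minorant of [f] has a measurable support, and this
    support lies in [A]. *)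
Lemma lower_integral_le_cst f A (M : R) : (0 <= M)%R -> (forall x, 0 <= f x) ->
  (forall x, ~ A x -> f x = 0) -> (\forall x \ae m, f x <= M%:E) ->
  \int[m]_x f x <= M%:E * mu A.
Proof.
move=> M0 f0 fA fM; apply: lower_integral_leP => // h hf.
pose S : set (caratheodory_type mu) := ~` (h @^-1` [set 0%R]).
have mS : measurable S by apply: measurableC; exact: measurable_sfunP.
have SA : S `<=` A.
  move=> x Sx; apply: contrapT => /fA fx0; apply: Sx => /=.
  apply/eqP; rewrite eq_le; apply/andP; split; last exact: fun_ge0.
  by have := hf x; rewrite fx0 lee_fin.
apply: (@le_trans _ _ (\int[m]_x (M%:E * (\1_S x)%:E))).
  apply: ae_ge0_le_integral => //.
  - by move=> x _; rewrite lee_fin; exact: fun_ge0.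
  - by apply/measurable_EFinP; exact: measurable_funP.
  - by move=> x _; rewrite mule_ge0.
  - by apply: measurable_funeM; apply/measurable_EFinP; exact: measurable_indic.
  case: fM => N [mN N0 NM]; exists N; split => // x /= /not_implyP[_ nle].
  apply: NM => /= fxM; apply: nle; have [Sx|nSx] := pselect (S x).
    by rewrite indicE mem_set// mule1; exact: le_trans fxM.
  by rewrite indicE memNset// mule0 lee_fin; move/contrapT : nSx => /= ->.
have mS1 : measurable_fun setT ((fun x => (\1_S x)%:E) : caratheodory_type mu -> \bar R).
  by apply/measurable_EFinP; exact: measurable_indic.
rewrite ge0_integralZl//.
rewrite integral_indic// setIT; apply: lee_wpmul2l => //.
exact: (@le_outer_measure _ _ mu).
Qed.

Lemma ereal_sup_add_le (S1 S2 : set (\bar R)) (c : \bar R) : S1 !=set0 -> S2 !=set0 ->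
  (forall a, S1 a -> 0 <= a) -> (forall b, S2 b -> 0 <= b) ->
  (forall a b, S1 a -> S2 b -> a + b <= c) -> ereal_sup S1 + ereal_sup S2 <= c.
Proof.
move=> [a0 Sa0] [b0 Sb0] S1_0 S2_0 h.
have c0 : 0 <= c by apply: le_trans (h a0 b0 Sa0 Sb0); apply: adde_ge0; [exact: S1_0|exact: S2_0].
case: c c0 h => [c c0 h|_ _|//]; last by rewrite leey.
have fin a b : S1 a -> S2 b -> a \is a fin_num /\ b \is a fin_num.
  move=> Sa Sb; have := h a b Sa Sb; have := S1_0 a Sa; have := S2_0 b Sb.
  by case: a {Sa} => [a||]; case: b {Sb} => [b||].
have h1 b : S2 b -> ereal_sup S1 <= c%:E - b.
  move=> Sb; apply: ge_ereal_sup => a Sa.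
  by have [fa fb] := fin a b Sa Sb; rewrite leeBrDr//; exact: h.
have f1 : ereal_sup S1 \is a fin_num.
  have s0 : 0 <= ereal_sup S1 by apply: le_ereal_sup_tmp; exists a0 => //; exact: S1_0.
  rewrite ge0_fin_numE//; apply: le_lt_trans (h1 b0 Sb0) _.
  by have [_ /fineK<-] := fin a0 b0 Sa0 Sb0; rewrite -EFinB ltey.
rewrite -leeBrDl//; apply: ge_ereal_sup => b Sb.
have [_ fb] := fin a0 b Sa0 Sb; rewrite leeBrDl// -leeBrDr//; exact: h1.
Qed.

(** The sum of two simple minorants is a simple minorant of the sum. *)
Lemma lower_integral_superadditive f g : (forall x, 0 <= f x) -> (forall x, 0 <= g x) ->
  \int[m]_x f x + \int[m]_x g x <= \int[m]_x (f x + g x).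
Proof.
move=> f0 g0; rewrite [X in X + _]ge0_integralTE// [X in _ + X]ge0_integralTE//.
have ne (k : T -> \bar R) : (forall x, 0 <= k x) ->
    [set sintegral m h | h in [set h : {nnsfun (caratheodory_type mu) >-> R} | forall x, (h x)%:E <= k x]] !=set0.
  by move=> k0; exists (sintegral m (nnsfun0 : {nnsfun (caratheodory_type mu) >-> R})), nnsfun0 => //=.
apply: ereal_sup_add_le; [exact: ne|exact: ne| | |].
- by move=> _ [h _ <-]; exact: sintegral_ge0.
- by move=> _ [h _ <-]; exact: sintegral_ge0.
move=> _ _ [h1 /= h1f <-] [h2 /= h2g <-].
rewrite -sintegralD -(integralT_nnsfun m (add_nnsfun h1 h2)).
apply: (@simple_le_lower_integral (fun x => f x + g x) (add_nnsfun h1 h2)) => x.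
  exact: adde_ge0.
by rewrite /= EFinD leeD.
Qed.

(** An outer null set is measurable, so a simple minorant can be set to zero on [N] without changing
    its integral. *)
Lemma lower_integral_setD_null f A N : (forall x, 0 <= f x) -> mu N = 0 ->
  \int[m]_x (f \_ A) x <= \int[m]_x (f \_ (A `\` N)) x.
Proof.
move=> f0 N0; have fA0 B x : 0 <= (f \_ B) x by rewrite patchE; case: ifP.
apply: lower_integral_leP => // h hf.
have mN := outer_null_measurable N0; have mNC := measurableC mN.
apply: (@le_trans _ _ (\int[m]_x (proj_nnsfun h mNC x)%:E)).
  rewrite le_eqVlt; apply/orP; left; apply/eqP; apply: ge0_ae_eq_integral => //.
  - by apply/measurable_EFinP; exact: measurable_funP.
  - by apply/measurable_EFinP; exact: measurable_funP.
  - by move=> x _; rewrite lee_fin; exact: fun_ge0.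
  - by move=> x _; rewrite lee_fin; exact: fun_ge0.
  exists N; split => // x /= /not_implyP[_ hne]; apply: contrapT => Nx; apply: hne.
  by rewrite /= mindicE mem_set// mulr1.
apply: simple_le_lower_integral => // x /=; rewrite mindicE.
have [Nx|Nx] := pselect (N x); first by rewrite memNset ?mulr0//= => /(_ Nx).
rewrite mem_set// mulr1; apply: le_trans (hf x) _; rewrite !patchE.
case: ifPn => [/set_mem Ax|_]; first by rewrite mem_set.
by case: ifP.
Qed.

(** One set is peeled off at a time: its overlap with the union of the others is null, and once
    removed it leaves disjoint supports to which superadditivity applies. *)
Lemma lower_integral_almost_disjoint (I : eqType) (s : seq I) (K : I -> set T) f A :
  (forall x, 0 <= f x) -> uniq s -> (forall i, i \in s -> K i `<=` A) ->
  (forall i j, i \in s -> j \in s -> i != j -> mu (K i `&` K j) = 0) ->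
  \sum_(i <- s) \int[m]_x (f \_ (K i)) x <= \int[m]_x (f \_ A) x.
Proof.
move=> f0; have fA0 B x : 0 <= (f \_ B) x by rewrite patchE; case: ifP.
have le_f B B' x : B `<=` B' -> (f \_ B) x <= (f \_ B') x.
  move=> BB'; rewrite !patchE; case: ifPn => [|_]; last by case: ifP.
  by rewrite inE => /BB' B'x; rewrite mem_set.
elim: s A => [|i s IH] A; first by rewrite big_nil => *; exact: integral_ge0.
move=> /= /andP[is_ us] KA dis; rewrite big_cons.
pose U := \bigcup_(j in [set` s]) K j.
have null : mu (K i `&` U) = 0.
  apply/eqP; rewrite eq_le outer_measure_ge0 andbT.
  apply: le_trans (outer_measure_le_seq mu (s := [seq K i `&` K j | j <- s]) _) _.
    move=> x [Kix [j /= js Kjx]]; exists (K i `&` K j) => //.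
    exact: map_f.
  rewrite big_map big_seq big1// => j js; apply: dis; rewrite ?mem_head//.
    by rewrite inE js orbT.
  by apply: contraNneq is_ => ->.
have h1 : \sum_(j <- s) \int[m]_x (f \_ (K j)) x <= \int[m]_x (f \_ U) x.
  apply: IH => // [j js x Kx|j j' js js' jj']; first by exists j.
  by apply: dis => //; rewrite inE ?js ?js' orbT.
apply: (@le_trans _ _ (\int[m]_x (f \_ (K i `\` (K i `&` U))) x + \int[m]_x (f \_ U) x)).
  by apply: leeD => //; exact: lower_integral_setD_null.
apply: le_trans (lower_integral_superadditive _ _) _ => //.
apply: le_lower_integral => x; first exact: adde_ge0.
have [Ux|nUx] := pselect (U x).
  rewrite [X in X + _]patchE memNset ?add0e.
    by apply: le_f => y [j /= js Ky]; apply: (KA j) => //; rewrite inE js orbT.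
  by move=> [Kix]; apply.
rewrite [X in _ + X]patchE memNset// adde0; apply: le_f => y [Kiy _].
by apply: (KA i) => //; rewrite mem_head.
Qed.

End LowerIntegral.

(** * The regularized data *)

Section Regularization.
Context {R : realType} {d : nat}.
Hypothesis d0 : (0 < d)%N.
Implicit Types (f psi : 'rV[R]_d -> R) (gamma : set 'rV[R]_d) (x y : 'rV[R]_d).

Lemma profile_le (psi1 : R -> R) t : profile psi1 -> psi1 t <= psi1 0.
Proof.
move=> [ev pos supp mon _]; have [t1|t1] := ltP 1 `|t|; first by rewrite supp.
have -> : psi1 t = psi1 `|t|.
  by have [_|_] := ger0P t; rewrite ?ev.
by apply: mon.
Qed.

(** The radius [d] serves both constructions: the radial kernel vanishes off the unit ball, the
    tensor kernel off [[-1, 1]^d], whose points have Euclidean norm at most [d]. *)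
Lemma regularizing_kernel_bounded psi : regularizing_kernel psi ->
  exists2 C : R, 0 < C & (forall x, `|psi x| <= C) /\
    (forall x, d%:R < enorm x -> psi x = 0).
Proof.
move=> [psi1 p1]; have [ev pos supp _ _] := p1.
have le1 t : `|psi1 t| <= psi1 0 by rewrite ger0_norm ?pos// profile_le.
have d1 : 1 <= d%:R :> R by rewrite ler1n.
case=> ->.
- pose I := \int[leb R d]_y psi1 (enorm y).
  exists (psi1 0 * `|I^-1| + 1); first by rewrite ltr_pwDr// mulr_ge0 ?pos.
  split=> [x|x dx]; last by rewrite /radial_kernel supp ?mul0r// ger0_norm ?enorm_ge0// (le_lt_trans d1).
  rewrite /radial_kernel -/I normrM (le_trans (ler_wpM2r (normr_ge0 _) (le1 _)))//.
  by rewrite lerDl.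
- exists (psi1 0 ^+ d + 1); first by rewrite ltr_pwDr// exprn_ge0 ?pos.
  split=> [x|x dx].
    rewrite /tensor_kernel normr_prod; apply: (@le_trans _ _ (psi1 0 ^+ d)); last by rewrite lerDl.
    rewrite -[in leRHS](card_ord d) -prodr_const.
    by apply: ler_prod => i _; rewrite normr_ge0 le1.
  have [i xi] : exists i, 1 < `|x ord0 i|.
    apply: contrapT => /forallNP h; have := dx; rewrite ltNge => /negP; apply.
    rewrite -[leRHS]mulr1; apply: enorm_le_coord => i.
    by rewrite leNgt; apply/negP/h.
  by rewrite /tensor_kernel (bigD1 i)//= supp// mul0r.
Qed.

Lemma Linfty_norm_ae gamma f : Linfty gamma f ->
  0 <= fine (Linfty_norm gamma f) /\
  \forall y \ae surf R d, gamma y -> `|f y| <= fine (Linfty_norm gamma f).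
Proof.
move=> [_]; rewrite /Linfty_norm unlock.
case: ifPn => [T0 foo|/negP T0 _]; last first.
  split=> //; exists setT; split; [exact: (@measurableT _ (caratheodory_type (surface_om R d)))| |by []].
  by apply/eqP; rewrite eq_le measure_ge0 andbT leNgt; apply/negP.
have s0 : (0 <= ess_sup (surf R d) (abse \o (EFin \o f \_ gamma)))%E.
  apply: ess_sup_gee => //; exists set0; split; [exact: measurable0|exact: measure0|].
  by move=> x nx; apply: nx; rewrite /= lee_fin.
split; first exact: fine_ge0.
have [N [mN N0 sN]] := ess_sup_ge (surf R d) (abse \o (EFin \o f \_ gamma)).
exists N; split => // y /= /not_implyP[gy fy]; apply: sN => /= h; apply: fy.
move: h; rewrite patchE mem_set// -lee_fin fineK// ge0_fin_numE//.
Qed.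

(** The kernel is of size [r^-d] and meets a part of [gamma] of surface measure at most a multiple
    of [r^(d-1)]; their product is of order [1 / r]. *)
Lemma regularized_bound gamma psi (C : R) :
  (forall z s, 0 < s -> (surf R d (gamma `&` eball z s) <= (C * s ^+ d.-1)%:E)%E) ->
  regularizing_kernel psi -> 0 < C ->
  exists2 C' : R, 0 < C' & forall f r, Linfty gamma f -> 0 < r ->
    (forall x, `|regularized psi gamma f r x| <= C' * fine (Linfty_norm gamma f) / r) /\
    (forall x, (forall y, gamma y -> d%:R * r < enorm (x - y)) ->
      regularized psi gamma f r x = 0).
Proof.
move=> surfC /regularizing_kernel_bounded[Cp Cp0 [psiC psi0]] C0.
have dR : 0 < d%:R :> R by rewrite ltr0n.
exists (Cp * C * (2 * d%:R) ^+ d.-1); first by rewrite !mulr_gt0 ?exprn_gt0 ?mulr_gt0.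
move=> f r fL r0; have [M0 fM] := Linfty_norm_ae fL.
set M := fine _ in M0 fM *.
have supp x y : d%:R * r < enorm (y - x) -> delta_reg psi r (y - x) = 0.
  move=> xy; rewrite /delta_reg psi0 ?mulr0// enormZ gtr0_norm ?invr_gt0//.
  by rewrite mulrC ltr_pdivlMr.
split=> x; last first.
  move=> far; rewrite /regularized /Rintegral integral0_eq//= => y gy.
  by rewrite supp ?mulr0// enormBC far.
pose b : R := M * (r ^- d * Cp).
have b0 : 0 <= b by rewrite !mulr_ge0 ?invr_ge0 ?exprn_ge0 ?(ltW r0) ?(ltW Cp0).
pose k y := (f y * delta_reg psi r (y - x))%:E.
(* Stated for any minorant [u] of [|k|], in order to serve both the positive and the negative part.
   The radius is doubled because the support is a closed ball and [eball] is open. *)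
have key (u : 'rV[R]_d -> \bar R) : (forall y, 0 <= u y)%E -> (forall y, u y <= `|k y|)%E ->
    (\int[surf R d]_(y in gamma) u y <= (b * (C * (2 * d%:R * r) ^+ d.-1))%:E)%E.
  move=> u0 uk; rewrite integral_mkcond.
  apply: (@le_trans _ _ (b%:E * surf R d (gamma `&` eball x (2 * d%:R * r)))%E).
    apply: (lower_integral_le_cst (mu := surface_om R d)) => //.
    - by move=> y; rewrite patchE; case: ifP.
    - move=> y nA; rewrite patchE; case: ifPn => // /set_mem gy.
      apply/eqP; rewrite eq_le u0 andbT (le_trans (uk y))// /k supp ?mulr0 ?abse0//.
      rewrite ltNge; apply/negP => h; apply: nA; split => //; rewrite /eball/=.
      by apply: le_lt_trans h _; rewrite ltr_pM2r// ltr_pMl// ltr1n.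
    - case: fM => N [mN N0 NM]; exists N; split => // y /= h; apply: NM => /= fy; apply: h.
      rewrite patchE; case: ifPn => [/set_mem gy|_]; last by rewrite lee_fin.
      apply: le_trans (uk y) _; rewrite /k abse_EFin lee_fin normrM.
      apply: ler_pM => //; first exact: fy.
      rewrite /delta_reg normrM ger0_norm ?invr_ge0 ?exprn_ge0 ?(ltW r0)//.
      by rewrite ler_wpM2l// invr_ge0 exprn_ge0// ltW.
  rewrite [leRHS]EFinM; apply: lee_wpmul2l => //; apply: surfC.
  by rewrite !mulr_gt0.
have -> : Cp * C * (2 * d%:R) ^+ d.-1 * M / r = b * (C * (2 * d%:R * r) ^+ d.-1).
  rewrite /b -[in r ^- d](prednK d0) [in RHS]exprMn exprS.
  by field; rewrite expf_neq0 ?gt_eqF.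
set B := b * _ in key *.
rewrite /regularized /Rintegral -/(k _).
rewrite (_ : (fun y => _) = k) // integralE.
have h1 := key _ (fun y => funepos_ge0 k y) _; have h2 := key _ (fun y => funeneg_ge0 k y) _.
have {}h1 : (\int[surf R d]_(y in gamma) k^\+ y <= B%:E)%E.
  by apply: h1 => y; rewrite -[leRHS]/((abse \o k) y) fune_abse leeDl.
have {}h2 : (\int[surf R d]_(y in gamma) k^\- y <= B%:E)%E.
  by apply: h2 => y; rewrite -[leRHS]/((abse \o k) y) fune_abse leeDr.
have p1 : (0 <= \int[surf R d]_(y in gamma) k^\+ y)%E by apply: integral_ge0.
have p2 : (0 <= \int[surf R d]_(y in gamma) k^\- y)%E by apply: integral_ge0.
case: (\int[surf R d]_(y in gamma) k^\+ y)%E h1 p1 => // a; rewrite !lee_fin => h1 p1.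
case: (\int[surf R d]_(y in gamma) k^\- y)%E h2 p2 => // c; rewrite !lee_fin => h2 p2.
by rewrite -EFinB /= ler_norml; lra.
Qed.

End Regularization.

(** * Indicators in terms of the squared norm *)

Section Indicator.
Context {R : realType} {d : nat}.
Implicit Types (g : 'rV[R]_d -> R) (t : cell R d) (A : set 'rV[R]_d).

Definition energy g A : \bar R := \int[leb R d]_x ((EFin \o (fun x => (g x ^+ 2)%R)) \_ A) x.

Lemma energy_ge0 g A : (0 <= energy g A)%E.
Proof. by apply: integral_ge0 => x _; rewrite patchE; case: ifP => // _; rewrite lee_fin sqr_ge0. Qed.

Lemma energy_le g A (B : R) : 0 <= B -> (forall x, A x -> `|g x| <= B) ->
  (energy g A <= (B ^+ 2)%:E * lebesgue_outer A)%E.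
Proof.
move=> B0 gB; apply: (lower_integral_le_cst (mu := lebesgue_om R d)).
- exact: exprn_ge0.
- by move=> x; rewrite patchE; case: ifP => // _; rewrite lee_fin sqr_ge0.
- by move=> x Ax; rewrite patchE memNset.
- exists set0; split; [exact: measurable0|exact: measure0|].
  move=> x nx; apply: nx; rewrite /= patchE; case: ifPn => [/set_mem Ax|_]; last by rewrite lee_fin exprn_ge0.
  by rewrite lee_fin -[g x ^+ 2]real_normK ?num_real// lerXn2r ?nnegrE// gB.
Qed.

Lemma energy0 g A : (forall x, A x -> g x = 0) -> energy g A = 0%E.
Proof.
move=> g0; rewrite /energy integral0_eq// => x _; rewrite patchE.
by case: ifPn => // /set_mem /g0 gx; rewrite /= gx expr0n.
Qed.

Lemma hsize_ge0 t : 0 <= hsize t.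
Proof. exact: powR_ge0. Qed.

Lemma indicator_ge0 g t : 0 <= indicator g t.
Proof. by rewrite mulr_ge0 ?hsize_ge0// fine_ge0// Lnorm_ge0. Qed.

Lemma indicator_sqr g t : indicator g t ^+ 2 = hsize t ^+ 2 * fine (energy g (hull t)).
Proof.
rewrite /indicator exprMn; congr (_ * _).
have -> : ('N[leb R d]_2%:E [EFin \o (g \_ (hull t))] = energy g (hull t) `^ 2^-1)%E.
  rewrite unlock; congr (_ `^ _)%E; apply: eq_integral => x _.
  rewrite /= powR_mulrn// !patchE; case: ifPn => _ /=.
    by rewrite real_normK// num_real.
  by rewrite normr0 expr0n.
(* For infinite energy both sides vanish, [fine] being 0 at infinity. *)
have := energy_ge0 g (hull t); case: (energy g (hull t)) => [e|_|//]; last by rewrite poweRyr ?invr_eq0//= expr0n.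
by rewrite lee_fin => e0; rewrite poweR_EFin /= powR12_sqrt// sqr_sqrtr.
Qed.

End Indicator.

(** * Simplices *)

Lemma continuous_bigsum (R : realType) (T : topologicalType) (V : normedModType R)
    (I : Type) (r : seq I) (f : I -> T -> V) :
  (forall i, continuous (f i)) -> continuous (fun x => \sum_(i <- r) f i x).
Proof.
move=> cf x; elim: r => [|i r IH].
  rewrite (_ : (fun x => _) = cst 0); first exact: cvg_cst.
  by apply/funext => y; rewrite big_nil.
rewrite (_ : (fun x => _) = (f i \+ (fun x => \sum_(i <- r) f i x))).
  by apply: cvgD; [exact: cf|exact: IH].
by apply/funext => y; rewrite big_cons.
Qed.

Section Hulls.
Context {R : realType} {d : nat}.
Implicit Types (s t : cell R d) (v w x y z : 'rV[R]_d).

Lemma dot_suml (I : Type) (r : seq I) (F : I -> 'rV[R]_d) y :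
  dot (\sum_(i <- r) F i) y = \sum_(i <- r) dot (F i) y.
Proof.
apply: (big_morph (fun x => dot x y)) => [x z|]; first exact: dotDl.
by rewrite -(scale0r 0) dotZl mul0r.
Qed.

Lemma sum_fset_delta s v : v \in s -> \sum_(u <- s) (u == v)%:R = 1 :> R.
Proof.
move=> vs; rewrite (bigD1_seq v vs (fset_uniq s))/= eqxx big1 ?addr0//.
by move=> u /negbTE->.
Qed.

Lemma sum_fset_delta_scale s v : v \in s -> \sum_(u <- s) ((u == v)%:R : R) *: u = v.
Proof.
move=> vs; rewrite (bigD1_seq v vs (fset_uniq s))/= eqxx scale1r big1 ?addr0//.
by move=> u /negbTE->; rewrite scale0r.
Qed.

Lemma mem_hull s v : v \in s -> hull s v.
Proof.
move=> vs; exists (fun u => (u == v)%:R); split=> [u _||]; first exact: ler0n.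
  exact: sum_fset_delta.
by rewrite sum_fset_delta_scale.
Qed.

Lemma hull_convex s x y (l : R) : 0 <= l -> l <= 1 -> hull s x -> hull s y ->
  hull s (x + l *: (y - x)).
Proof.
move=> l0 l1 [a [a0 a1 ->]] [b [b0 b1 ->]].
exists (fun v => (1 - l) * a v + l * b v); split.
- by move=> v vs; rewrite addr_ge0// mulr_ge0// ?subr_ge0// ?a0// b0.
- by rewrite big_split/= -!mulr_sumr a1 b1; ring.
- under [RHS]eq_bigr => v _ do rewrite scalerDl -!scalerA.
  by rewrite big_split/= -!scaler_sumr; apply/rowP => i; rewrite !mxE; ring.
Qed.

Lemma hull0 x : ~ hull fset0 x.
Proof. by move=> [c [_ + _]]; rewrite big_seq_fset0 => /esym/eqP; rewrite oner_eq0. Qed.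

Lemma hull1 v x : hull [fset v]%fset x -> x = v.
Proof. by move=> [c [_ + ->]]; rewrite !big_seq_fset1 => ->; rewrite scale1r. Qed.

Lemma coord_hull_le1 s (c : 'rV[R]_d -> R) v : (forall u, u \in s -> 0 <= c u) ->
  \sum_(u <- s) c u = 1 -> v \in s -> c v <= 1.
Proof.
move=> c0 c1 vs; rewrite -c1 (bigD1_seq v vs (fset_uniq s))/= lerDl big_seq_cond.
by apply: sumr_ge0 => u /andP[us _]; exact: c0.
Qed.

(* Moving by [v - w] raises the barycentric coordinate at [v] by one. *)
Lemma simplex_edge_ge s x (rho : R) v w : simplex s -> eball x rho `<=` hull s ->
  v \in s -> w \in s -> v != w -> rho <= enorm (v - w).
Proof.
move=> [_ free] xs vs ws vw; rewrite leNgt; apply/negP => lt_rho.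
have rho0 : 0 < rho by apply: le_lt_trans lt_rho; exact: enorm_ge0.
have [c [c0 c1 cx]] : hull s x by apply: xs; exact: eball_center.
have shift (a : R) c' : \sum_(u <- s) c' u = 1 -> x + a *: (v - w) = \sum_(u <- s) c' u *: u ->
    c' v = c v + a.
  move=> c'1 c'x.
  pose e u := c' u - c u - a * (u == v)%:R + a * (u == w)%:R.
  have := free e _ _ v vs; rewrite /e eqxx (negbTE vw) => h.
  apply/eqP; rewrite -subr_eq0 -h.
  - by apply/eqP; rewrite mulr1 mulr0; ring.
  - by rewrite !big_split/= !sumrN -!mulr_sumr c1 c'1 !sum_fset_delta//; ring.
  - under eq_bigr => u _ do rewrite scalerDl !scalerBl -!scalerA.
    rewrite !big_split/= !sumrN -!scaler_sumr !sum_fset_delta_scale// -c'x -cx scalerBr.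
    by apply/rowP => i; rewrite !mxE; ring.
have inb (a : R) : `|a| = 1 -> hull s (x + a *: (v - w)).
  by move=> a1; apply: xs; rewrite /eball/= addrAC subrr add0r enormZ a1 mul1r.
have [c' [c'0 c'1 c'x]] := inb 1 (normr1 _).
have [c'' [c''0 c''1 c''x]] := inb (-1) (normrN1 _).
(* Both shifted points stay in the hull, so the coordinate at [v] would satisfy [c v + 1 <= 1] and
   [c v - 1 >= 0]. *)
have := shift _ _ c'1 c'x; have := shift _ _ c''1 c''x.
have := coord_hull_le1 c'0 c'1 vs; have := c''0 v vs; have := c0 v vs.
by lra.
Qed.

Lemma homothety_eball s p c (rho l : R) : eball c rho `<=` hull s -> hull s p ->
  0 < l -> l <= 1 -> eball (p + l *: (c - p)) (l * rho) `<=` hull s.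
Proof.
move=> cs ps l0 l1 q qc.
pose c' := c + l^-1 *: (q - (p + l *: (c - p))).
have -> : q = p + l *: (c' - p).
  by apply/rowP => i; rewrite /c' !mxE; field; rewrite gt_eqF.
apply: hull_convex => //; first exact: ltW.
apply: cs; rewrite /eball/= /c' addrAC subrr add0r enormZ gtr0_norm ?invr_gt0//.
by rewrite mulrC ltr_pdivrMr// mulrC.
Qed.

(** The hull is the continuous image of the standard simplex, which is compact. *)
Lemma hull_closed s : closed (hull s).
Proof.
pose k := size s; pose vs (j : 'I_k) := nth 0 s j.
pose S : set 'rV[R]_k := [set c | (forall j, 0 <= c ord0 j) /\ \sum_j c ord0 j = 1].
pose F (c : 'rV[R]_k) : 'rV[R]_d := \sum_j c ord0 j *: vs j.
have contc j : continuous (fun c : 'rV[R]_k => c ord0 j) by exact: coord_continuous.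
have cF : continuous F.
  apply: continuous_bigsum => j c; exact: (continuousZr_tmp (contc j c)).
have hullE : hull s = F @` S.
  have sumE (V : nmodType) (G : 'rV[R]_d -> V) : \sum_(v <- s) G v = \sum_j G (vs j).
    by rewrite (big_nth 0) big_mkord.
  apply/seteqP; split=> [x [c [c0 c1 ->]]|_ [c [c0 c1] <-]].
    exists (\row_j c (vs j)).
      split=> [j|]; first by rewrite mxE c0// mem_nth.
      by rewrite -c1 sumE; apply: eq_bigr => j _; rewrite mxE.
    by rewrite sumE; apply: eq_bigr => j _; rewrite mxE.
  pose a (v : 'rV[R]_d) : R := if insub (index v s) is Some j then c ord0 j else 0.
  have aE j : a (vs j) = c ord0 j.
    by rewrite /a /vs index_uniq ?fset_uniq// valK.
  exists a; split.
  - by move=> v _; rewrite /a; case: insub => [j|].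
  - by rewrite sumE -c1; apply: eq_bigr => j _; rewrite aE.
  - by rewrite sumE; apply: eq_bigr => j _; rewrite aE.
rewrite hullE; apply: compact_closed; first exact: norm_hausdorff.
apply: continuous_compact; first exact: continuous_subspaceT.
apply: bounded_closed_compact.
  exists 1; split; first exact: num_real.
  move=> M M1 c [c0 c1]; apply: le_trans (ltW M1).
  apply: le_trans (norm_le_enorm c) _; apply: le_trans (enorm_le_sum c) _.
  by rewrite -c1; apply: ler_sum => j _; rewrite ger0_norm.
rewrite (_ : S = (\bigcap_j [set c | 0 <= c ord0 j]) `&` [set c | \sum_j c ord0 j = 1]).
  apply: closedI.
    apply: closed_bigI => j _; rewrite (_ : [set c | _] = (fun c => c ord0 j) @^-1` [set y | 0 <= y])//.
    by have := (continuous_closedP _).1 (contc j); apply; exact: closed_ge.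
  rewrite (_ : [set c | _] = (fun c => \sum_j c ord0 j) @^-1` [set 1])//.
  by have := (continuous_closedP _).1 (continuous_bigsum (r := index_enum 'I_k) contc); apply; exact: closed_eq.
by apply/seteqP; split=> c [h1 h2]; split => // j; [move=> _; exact: h1|exact: h1].
Qed.

Lemma hull_bounded s : bounded_set (hull s).
Proof.
exists (\sum_(v <- s) `|v|); split; first exact: num_real.
move=> M M1 _ [c [c0 c1 ->]]; apply: le_trans (ltW M1).
apply: le_trans (ler_norm_sum _ _ _) _; rewrite big_seq [leRHS]big_seq.
apply: ler_sum => v vs; rewrite normrZ ger0_norm ?c0//.
by apply: ler_piMl => //; exact: coord_hull_le1 c1 vs.
Qed.

(** The coordinates of at most [d] points, bordered by a row of ones, form a matrix with [d + 1]
    rows and a nonzero left null vector [(n, a)]. It yields the hyperplane [dot x n = - a]; if [n]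
    were zero, [a] would be too. *)
Lemma hull_null s : (1 < d)%N -> (#|` s| <= d)%N -> lebesgue_outer (hull s) = 0%E.
Proof.
move=> d1 sd; have [->|s0] := eqVneq s fset0.
  rewrite (_ : hull _ = set0); first exact: (outer_measure0 (lebesgue_om R d)).
  by apply/seteqP; split=> // x /hull0.
pose k := size s; pose vs (j : 'I_k) := nth 0 s j.
have k0 : (0 < k)%N by rewrite -cardfs_gt0 in s0.
pose M : 'M[R]_(d, k) := \matrix_(i, j) vs j ord0 i.
pose A := col_mx M (const_mx 1 : 'rV_k).
have : kermx A != 0.
  rewrite -mxrank_eq0 mxrank_ker -lt0n subn_gt0.
  by apply: leq_ltn_trans (rank_leq_col A) _; rewrite addn1 ltnS.
move=> /rowV0Pn[w /sub_kermxP wA w0].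
pose n := lsubmx w; pose a := rsubmx w ord0 ord0.
have nv v : v \in s -> dot v n = - a.
  move=> vin; pose j := Ordinal (etrans (index_mem v s) vin : (index v s < k)%N).
  have vj : vs j = v by rewrite /vs /= nth_index.
  move: wA; rewrite -[w]hsubmxK mul_row_col => /rowP/(_ j); rewrite !mxE big_ord1 !mxE mulr1.
  move=> h; apply/eqP; rewrite -subr_eq0 opprK -h; apply/eqP; congr (_ + _).
    by apply: eq_bigr => i _; rewrite !mxE vj mulrC.
  by rewrite /a !mxE.
apply: (@hyperplane_null R d (hull s) n (- a) d1).
- apply: contraNneq w0 => n0; rewrite -[w]hsubmxK -/n n0.
  suff -> : rsubmx w = 0 by rewrite row_mx0.
  have [v vin] := fset0Pn _ s0.
  apply/rowP => i; rewrite (ord1 i) [RHS]mxE -/a.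
  have := nv v vin; rewrite n0 /dot big1 => [/esym/eqP|j _]; last by rewrite mxE mulr0.
  by rewrite oppr_eq0 => /eqP.
- exact: hull_bounded.
- move=> x [c [c0 c1 ->]]; rewrite -[RHS]mul1r -c1 mulr_suml dot_suml.
  by rewrite big_seq [RHS]big_seq; apply: eq_bigr => v vin; rewrite dotZl nv.
Qed.

End Hulls.

(** * Local quasi-uniformity *)

Lemma injective_avoid (T : eqType) (V : seq T) (p : nat -> T) :
  injective p -> exists n, p n \notin V.
Proof.
move=> ip; apply: contrapT => /forallNP h.
have : (size (map p (iota 0 (size V).+1)) <= size V)%N.
  apply: uniq_leq_size; first by rewrite map_inj_uniq// iota_uniq.
  by move=> _ /mapP[n _ ->]; have /negP/negPn := h n.
by rewrite size_map size_iota ltnn.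
Qed.

(** * Generic segments avoiding finitely many points *)

Section Avoiding.
Context {R : realType} {d : nat}.
Implicit Types (x y z b v w : 'rV[R]_d).

Lemma enorm_delta (i : 'I_d) : enorm (delta_mx ord0 i : 'rV[R]_d) = 1.
Proof.
rewrite /enorm /dot (bigD1 i)//= !mxE !eqxx mulr1 big1 ?addr0 ?sqrtr1// => j ji.
by rewrite !mxE (negbTE ji) andbF mulr0.
Qed.

Lemma eball_shift x (u : 'rV[R]_d) (e : R) (n : nat) : 0 < e -> enorm u = 1 ->
  eball x e (x + (e / n.+2%:R) *: u).
Proof.
move=> e0 u1; rewrite /eball/= addrAC subrr add0r enormZ u1 mulr1.
rewrite ger0_norm; last by rewrite divr_ge0// ltW.
by rewrite ltr_pdivrMr// ltr_pMr// ltr1n.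
Qed.

Lemma shift_inj (e : R) (n m : nat) : 0 < e -> e / n.+2%:R = e / m.+2%:R -> n = m.
Proof.
move=> e0 /(mulfI (lt0r_neq0 e0))/invr_inj/eqP.
by rewrite eqr_nat => /eqP[].
Qed.

Lemma eball_avoid (V : seq 'rV[R]_d) x (e : R) : (0 < d)%N -> 0 < e ->
  exists2 y, eball x e y & y \notin V.
Proof.
move=> d0 e0; pose u : 'rV[R]_d := delta_mx ord0 (Ordinal d0).
pose p (n : nat) := x + (e / n.+2%:R) *: u.
have inj : injective p.
  move=> n n' /addrI/rowP/(_ (Ordinal d0)); rewrite !mxE !eqxx !mulr1.
  exact: shift_inj.
by have [n pn] := injective_avoid V inj; exists (p n) => //; apply: eball_shift => //; exact: enorm_delta.
Qed.

(* Along a direction transverse to [s0 - b], a point [v <> b] lies on at most one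
   of the lines through [b]. *)
Lemma segment_avoid (V : seq 'rV[R]_d) b s0 (e : R) : (1 < d)%N -> 0 < e ->
  b \notin V -> s0 != b ->
  exists2 s', eball s0 e s' & forall v (l : R), v \in V -> v != b + l *: (s' - b).
Proof.
move=> d1 e0 bV sb.
have [i zi] : exists i, (s0 - b) ord0 i != 0.
  apply: contrapT => /forallNP h; move/eqP: sb; apply; apply/rowP => i.
  by have /negP/negPn := h i; rewrite !mxE subr_eq0 => /eqP.
have [j ji] : exists j : 'I_d, j != i.
  have [i0|i0] := eqVneq (val i) 0%N.
    by exists (Ordinal d1); rewrite -val_eqE /= i0.
  by exists (Ordinal (ltnW d1)); rewrite -val_eqE /= eq_sym.
pose u : 'rV[R]_d := delta_mx ord0 j.
pose p (n : nat) := s0 + (e / n.+2%:R) *: u.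
apply: contrapT => hn.
have bad n : exists v, v \in V /\ exists l : R, v = b + l *: (p n - b).
  apply: contrapT => /forallNP h; apply: hn; exists (p n).
    by apply: eball_shift => //; exact: enorm_delta.
  move=> v l vV; apply/eqP => vE; apply: (h v); split => //; by exists l.
have [v vP] := choice bad.
have injv : injective v.
  move=> n m vnm; have [vV [l vl]] := vP n; have [_ [l' vl']] := vP m.
  have : b + l *: (p n - b) = b + l' *: (p m - b) by rewrite -vl -vl' vnm.
  move/addrI => E.
  have Ei := congr1 (fun w : 'rV[R]_d => w ord0 i) E; have Ej := congr1 (fun w : 'rV[R]_d => w ord0 j) E.
  move: Ei Ej zi; rewrite /p /u !mxE !eqxx /= (negbTE (_ : i != j)) ?(eq_sym i)// !mulr0 !addr0 !mulr1.
  move=> Ei Ej zi; have ll : l = l' by exact: (mulIf zi).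
  rewrite -ll in Ej; have [l0|l0] := eqVneq l 0.
    by move: bV; rewrite -[b]addr0 -(scale0r (p n - b)) -l0 -vl vV.
  move/(mulfI l0): Ej => /addIr/addrI; exact: shift_inj.
have [n /negP] := injective_avoid V injv; apply; exact: (vP n).1.
Qed.

Lemma interior_eball_sub (A : set 'rV[R]_d) x (e : R) : eball x e `<=` A -> eball x e `<=` A°.
Proof. by move=> xA; rewrite -open_subsetE//; exact: eball_open. Qed.

Lemma eball_convex x (e : R) b y (l : R) : 0 <= l -> l <= 1 -> eball x e b -> eball x e y ->
  eball x e (b + l *: (y - b)).
Proof.
move=> l0 l1 xb xy; rewrite /eball/=.
have -> : b + l *: (y - b) - x = (1 - l) *: (b - x) + l *: (y - x).
  by apply/rowP => i; rewrite !mxE; ring.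
apply: le_lt_trans (enormD _ _) _; rewrite !enormZ !ger0_norm ?subr_ge0//.
move: xb xy; rewrite /eball/= => xb xy.
have [->|ln0] := eqVneq l 0; first by rewrite subr0 mul1r mul0r addr0.
have lp : 0 < l by rewrite lt_neqAle eq_sym ln0.
have h1 : (1 - l) * enorm (b - x) <= (1 - l) * e by rewrite ler_wpM2l ?subr_ge0// ltW.
have h2 : l * enorm (y - x) < l * e by rewrite ltr_pM2l.
by lra.
Qed.

End Avoiding.

(** If the two closed sets were disjoint along the segment, the part in [A] would be open and closed
    in [[0, 1]], hence everything, and [y] would lie in both. *)
Lemma segment_meet (R : realType) (d : nat) (A B : set 'rV[R]_d) (b y : 'rV[R]_d) :
  closed A -> closed B -> A b -> B y ->
  (forall l : R, 0 <= l <= 1 -> A (b + l *: (y - b)) \/ B (b + l *: (y - b))) ->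
  exists2 l : R, 0 <= l <= 1 & A (b + l *: (y - b)) /\ B (b + l *: (y - b)).
Proof.
move=> cA cB Ab By cov; apply: contrapT => hn.
pose phi (l : R) := b + l *: (y - b).
have cphi : continuous phi.
  move=> l; apply: cvgD; first exact: cvg_cst.
  by apply: (@continuousZr_tmp _ _ _ id _ l); exact: cvg_id.
have dis l : 0 <= l <= 1 -> A (phi l) -> ~ B (phi l).
  by move=> l01 Al Bl; apply: hn; exists l.
have clA := (continuous_closedP _).1 cphi _ cA.
have clB := (continuous_closedP _).1 cphi _ cB.
pose C := `[0, 1]%classic `&` (phi @^-1` A).
have CE : C = `[0, 1]%classic.
  apply: (@segment_connected R 0 1).
  - by exists 0; split; rewrite /= ?in_itv/= ?lexx ?ler01// /phi scale0r addr0.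
  - exists (~` (phi @^-1` B)); first by rewrite openC.
    apply/seteqP; split=> l [l01 Al]; split=> //; rewrite /= in_itv/= in l01.
      exact: dis.
    by have [|/Al] := cov l l01.
  - by exists (phi @^-1` A).
have : C 1 by rewrite CE /= in_itv/= ler01 lexx.
move=> [_]; rewrite /phi /= scale1r subrKC => Ay.
by apply: hn; exists 1; rewrite ?ler01 ?lexx// scale1r subrKC.
Qed.

Section LocalQuasiUniformity.
Context {R : realType} {d : nat}.
Variables (ctr : cell R d -> 'rV[R]_d) (rho : cell R d -> R) (kap : R).
Implicit Types (T S : mesh R d) (s t u : cell R d) (x y z : 'rV[R]_d).

(** The inscribed ball is a function of the cell, so that [rho] can serve as a measure of size
    throughout. *)
Definition shaped t : Prop := [/\ 0 < rho t, eball (ctr t) (rho t) `<=` hull t &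
  forall y z, hull t y -> hull t z -> enorm (y - z) <= kap * rho t].

Lemma shape_center t : shaped t -> hull t (ctr t).
Proof. by move=> [r0 h _]; apply: h; exact: eball_center. Qed.

Lemma disjoint_eballs s t x y (e e' : R) : (hull s)° `&` (hull t)° = set0 ->
  eball x e `<=` hull s -> eball y e' `<=` hull t -> eball x e `&` eball y e' = set0.
Proof.
move=> st xs yt; rewrite -subset0 -st => z [xz yz].
by split; [exact: (interior_eball_sub xs)|exact: (interior_eball_sub yt)].
Qed.

Lemma shape_shrink t p (l : R) : 0 <= kap -> shaped t -> hull t p -> 0 < l -> l <= 1 ->
  [/\ 0 < l * rho t, eball (p + l *: (ctr t - p)) (l * rho t) `<=` hull t &
      enorm (p + l *: (ctr t - p) - p) <= l * (kap * rho t)].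
Proof.
move=> k0 st tp l0 l1; have [r0 h diam] := st; split; first exact: mulr_gt0.
  exact: homothety_eball.
rewrite addrAC subrr add0r enormZ (ger0_norm (ltW l0)) ler_wpM2l ?(ltW l0)//.
by apply: diam => //; exact: shape_center.
Qed.

(* Number of cells of inradius at least [R0] that can meet a ball of radius [2 R0]. *)
Definition cell_bound : nat := (Num.truncn ((4 * d.+1%:R * (kap + 3)) ^+ d : R)).+1.

(** Shrinking a cell towards its point near [y] yields in it a ball of radius exactly [R0],
    contained in the ball of radius [R0 + kap R0 + 2 D <= (kap + 3) R0] about [y]. The packing bound
    then gives [(4 (d + 1) (kap + 3))^d]. *)
Lemma card_large_cells S y (D R0 : R) : (0 < d)%N -> 0 <= kap -> 0 < R0 -> D <= R0 ->
  (forall t, t \in S -> shaped t) ->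
  (forall s t, s \in S -> t \in S -> s != t -> (hull s)° `&` (hull t)° = set0) ->
  (forall t, t \in S -> R0 <= rho t /\ exists2 p, hull t p & eball y (2 * D) p) ->
  (#|` S| < cell_bound)%N.
Proof.
move=> d0 k0 R00 DR shS disj near.
have [p pP] : {p : cell R d -> 'rV[R]_d & forall t, t \in S -> hull t (p t) /\ eball y (2 * D) (p t)}.
  apply: (@choice _ _ (fun t p => t \in S -> hull t p /\ eball y (2 * D) p)) => t.
  have [tS|tS] := boolP (t \in S); last by exists 0.
  by have [_ [p h1 h2]] := near t tS; exists p.
pose l t := R0 / rho t.
pose c t := p t + l t *: (ctr t - p t).
have cP t : t \in S -> eball (c t) R0 `<=` hull t /\ enorm (c t - p t) <= kap * R0.
  move=> tS; have st := shS t tS; have [r0 _ _] := st.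
  have [Rr _] := near t tS.
  have l0 : 0 < l t by rewrite divr_gt0.
  have l1 : l t <= 1 by rewrite ler_pdivrMr// mul1r.
  have [_ h1 h2] := shape_shrink k0 st (pP t tS).1 l0 l1.
  have lr : l t * rho t = R0 by rewrite /l divfK// gt_eqF.
  by rewrite mulrCA lr in h2; rewrite lr in h1.
pose E : set 'rV[R]_d := [set x | enorm (x - y) <= (kap + 3) * R0].
have := @eball_packing R d _ S c (fun=> R0) E d0 _ _ => /(_ _ _)/le_trans h.
have : ((\sum_(i <- S) (R0 / (2 * d.+1%:R)) ^+ d)%:E <= ((2 * ((kap + 3) * R0)) ^+ d)%:E)%E.
  apply: h.
  - move=> t tS; split=> // x cx; have [h1 h2] := cP t tS; have [_ h3] := pP t tS.
    rewrite /E/=; apply: le_trans (enorm_triangle (c t) _ _) _.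
    apply: (@le_trans _ _ (R0 + (kap * R0 + 2 * D))); last by lra.
    apply: lerD; first exact: ltW.
    by apply: le_trans (enorm_triangle (p t) _ _) _; apply: lerD => //; exact: ltW.
  - move=> s t sS tS st; apply: (disjoint_eballs (disj s t sS tS st)).
      by have [] := cP s sS.
    by have [] := cP t tS.
  - apply: (lebesgue_outer_le_cube (c := y)); last by rewrite mulr_ge0 ?addr_ge0// ltW.
    move=> x Ex i; apply: le_trans Ex.
    by have := coord_le_enorm (x - y) i; rewrite !mxE.
rewrite lee_fin big_const_seq count_predT iter_addr_0 -[X in X <= _]mulr_natl.
rewrite -ler_pdivlMr ?exprn_gt0 ?divr_gt0 ?mulr_gt0// -expr_div_n.
have -> : 2 * ((kap + 3) * R0) / (R0 / (2 * d.+1%:R)) = 4 * d.+1%:R * (kap + 3).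
  have : d.+1%:R != 0 :> R by rewrite pnatr_eq0.
  by move: (d.+1%:R : R) => e e0; field; rewrite e0 gt_eqF.
move=> h'; rewrite /cell_bound ltnS truncn_ge_nat//.
by rewrite exprn_ge0// !mulr_ge0// addr_ge0.
Qed.

End LocalQuasiUniformity.

Section LocalQuasiUniformityTheorem.
Context {R : realType} {d : nat}.
Variables (ctr : cell R d -> 'rV[R]_d) (rho : cell R d -> R) (kap : R).
Implicit Types (T S : mesh R d) (s t u : cell R d) (x y z : 'rV[R]_d).

Lemma closed_cell_union (r : seq (cell R d)) (P : cell R d -> Prop) :
  closed [set p | exists2 u, u \in r /\ P u & hull u p].
Proof.
elim: r => [|a r IH].
  rewrite (_ : [set p | _] = set0); first exact: closed0.
  by apply/seteqP; split=> // p [u []].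
have [Pa|nPa] := pselect (P a).
  rewrite (_ : [set p | _] = hull a `|` [set p | exists2 u, u \in r /\ P u & hull u p]).
    by apply: closedU => //; exact: hull_closed.
  apply/seteqP; split=> [p [u [ur Pu] up]|p [ap|[u [ur Pu] up]]].
  - by move: ur; rewrite inE => /orP[/eqP<-|ur]; [left|right; exists u].
  - by exists a; rewrite // mem_head.
  - by exists u; rewrite // inE ur orbT.
rewrite (_ : [set p | _] = [set p | exists2 u, u \in r /\ P u & hull u p])//.
apply/seteqP; split=> p [u [ur Pu] up]; exists u => //; split=> //; last by rewrite inE ur orbT.
by move: ur; rewrite inE => /orP[/eqP ua|//]; rewrite ua in Pu.
Qed.

(** Shrinking by the ratio [l] towards [p] leaves a ball within [l (kap + 1) rho t] of [p]; the
    choice of [l] makes this at most [D]. *)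
Lemma shape_near t p (D : R) : 0 <= kap -> 0 < D -> shaped ctr rho kap t -> hull t p ->
  exists c e, [/\ 0 < e, eball c e `<=` hull t & eball c e `<=` eball p D].
Proof.
move=> k0 D0 st tp; have [r0 _ _] := st.
have k1 : 0 < kap + 1 by rewrite ltr_pwDr.
pose l := Num.min 1 (D / ((kap + 1) * rho t)).
have l0 : 0 < l by rewrite lt_min ltr01 divr_gt0// mulr_gt0.
have l1 : l <= 1 by rewrite ge_min lexx.
have [e0 h1 h2] := shape_shrink k0 st tp l0 l1.
exists (p + l *: (ctr t - p)), (l * rho t); split=> // q qc; rewrite /eball/=.
apply: le_lt_trans (enorm_triangle (p + l *: (ctr t - p)) _ _) _.
apply: (@lt_le_trans _ _ (l * rho t + l * (kap * rho t))); first exact: ltr_leD.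
have : l <= D / ((kap + 1) * rho t) by rewrite ge_min lexx orbT.
rewrite ler_pdivlMr ?mulr_gt0// => /(le_trans _); apply.
by rewrite le_eqVlt; apply/orP; left; apply/eqP; ring.
Qed.

(** Pigeonhole: the [N] disjoint ranges from [R0 K^(m+1)] to [R0 K^(m+2)] cannot all be hit by fewer
    than [N] inradii. *)
Lemma size_gap S (R0 K : R) (N : nat) : 0 < R0 -> 1 < K -> (#|` S| < N)%N ->
  exists2 m, (m < N)%N & forall u, u \in S -> R0 * K ^+ m.+1 < rho u -> R0 * K ^+ m.+2 <= rho u.
Proof.
move=> R00 K1 SN; apply: contrapT => hn.
have bin (m : 'I_N) : exists u, [/\ u \in S, R0 * K ^+ m.+1 < rho u & rho u < R0 * K ^+ m.+2].
  apply: contrapT => /forallNP h; apply: hn; exists m => // u uS hu.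
  by rewrite leNgt; apply/negP => hu'; apply: (h u).
have [g gP] := choice bin.
have lt_g (m m' : 'I_N) : (m < m')%N -> g m <> g m'.
  move=> mm gE; have [_ _ h1] := gP m; have [_ h2 _] := gP m'; rewrite -gE in h2.
  have : R0 * K ^+ m.+2 <= R0 * K ^+ m'.+1.
    by rewrite ler_pM2l// ler_weXn2l ?(ltW K1).
  by move/(lt_le_trans h1)/lt_trans/(_ h2); rewrite ltxx.
have ig : injective g.
  move=> m m' gE; apply/val_inj; case: (ltngtP m m') => // mm; first by case: (lt_g _ _ mm).
  by case: (lt_g _ _ mm).
have : (#|` [fset g m | m in 'I_N]%fset| <= #|` S|)%N.
  apply: fsubset_leq_card; apply/fsubsetP => _ /imfsetP[m _ ->].
  by have [] := gP m.
rewrite card_imfset//= size_enum_ord => h.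
by move: SN; rewrite ltnNge h.
Qed.

(** The exponent is one more than [cell_bound], so that an inradius above [R0 * size_ratio] lies
    beyond every gap, for which [m + 2 <= cell_bound + 1]. *)
Definition size_ratio : R := (2 + kap) ^+ (cell_bound (d := d) kap).+1.

(* Cells sharing an edge have comparable inradii. If [rho t] were much larger than
   [rho s], some range of inradii would be missing near [y], and the large and the
   small cells near [y] could only meet at vertices; but a generic segment from [t]
   to [s] avoids all vertices. *)
Lemma local_quasi_uniformity T A x y (D : R) s t : (1 < d)%N -> 0 <= kap ->
  conforming T -> triangulates T A -> (forall u, u \in T -> shaped ctr rho kap u) ->
  0 < D -> eball y (2 * D) `<=` A -> s \in T -> t \in T -> hull s y -> hull t x ->
  enorm (x - y) <= D ->
  rho t <= Num.max D (rho s) * size_ratio.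
Proof.
move=> d1 k0 confT [simT disT covT] shT D0 yA sT tT sy tx xy.
have d0 := ltnW d1.
rewrite leNgt; apply/negP => big_t.
set R0 := Num.max D (rho s) in big_t.
have R00 : 0 < R0 by rewrite lt_max D0.
have DR0 : D <= R0 by rewrite le_max lexx.
have K1 : 1 < 2 + kap by lra.
set K := 2 + kap in K1; rewrite /size_ratio -/K in big_t.
have K0 : 0 < K by exact: lt_trans K1.
pose near u := exists2 p, hull u p & eball y (2 * D) p.
pose S := [fset u in T | `[< near u >] && (R0 <= rho u)]%fset.
have SP u : u \in S -> [/\ u \in T, near u & R0 <= rho u].
  by rewrite !inE/= => /andP[uT /andP[/asboolP nu Ru]].
have cardS : (#|` S| < cell_bound (d := d) kap)%N.
  apply: (card_large_cells (ctr := ctr) (rho := rho) (y := y) (D := D)) R00 DR0 _ _ _ => //.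
  - by move=> u /SP[/shT].
  - by move=> u v /SP[uT _ _] /SP[vT _ _]; exact: disT.
  - by move=> u /SP[_ [p up yp] Ru]; split => //; exists p.
have [m mN gap] := size_gap R00 K1 cardS.
have powK k : 1 <= K ^+ k by rewrite exprn_ege1// ltW.
pose big u := R0 * K ^+ m.+2 <= rho u.
pose small u := rho u <= R0 * K ^+ m.+1.
have dich u : u \in T -> near u -> big u \/ small u.
  move=> uT nu; have [|hu] := leP (rho u) (R0 * K ^+ m.+1); first by right.
  left; apply: gap => //; rewrite !inE/= uT/=; apply/andP; split; first exact/asboolP.
  by apply: le_trans (ltW hu); rewrite ler_peMr// ltW.
pose V := flatten [seq (enum_fset u) | u <- enum_fset T].
have memV u v : u \in T -> v \in u -> v \in V.
  by move=> uT vu; apply/flattenP; exists (enum_fset u) => //; apply/mapP; exists u.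
have [ct [et [et0 ctt ctx]]] := shape_near k0 D0 (shT t tT) tx.
have [cs [es [es0 css csy]]] := shape_near k0 D0 (shT s sT) sy.
(* The segment from [b], in [t] near [x], to [y'], in [s] near [y], misses every vertex of the mesh;
   [b != cs] is the nondegeneracy required by [segment_avoid]. *)
have [b bct] := eball_avoid (cs :: V) ct d0 et0.
rewrite inE negb_or => /andP[bcs bV].
rewrite eq_sym in bcs; have [y' y'cs avoid] := segment_avoid d1 es0 bV bcs.
have yb : eball y (2 * D) b.
  have := ctx _ bct; rewrite /eball/= => bx.
  by apply: le_lt_trans (enorm_triangle x _ _) _; lra.
have yy' : eball y (2 * D) y'.
  by have := csy _ y'cs; rewrite /eball/=; lra.
(* Every point of the segment lies in a cell near [y], which is big or small; by connectedness some
   point lies in one of each kind. *)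
have [l l01 [[u [uT bu] up] [w [wT sw] wp]]] :
  exists2 l : R, 0 <= l <= 1 &
    [set p | exists2 u, u \in enum_fset T /\ big u & hull u p] (b + l *: (y' - b)) /\
    [set p | exists2 u, u \in enum_fset T /\ small u & hull u p] (b + l *: (y' - b)).
  apply: segment_meet; [exact: closed_cell_union|exact: closed_cell_union| | |].
  - exists t; last exact: ctt.
    split=> //; apply: le_trans (ltW big_t); rewrite ler_pM2l// ler_weXn2l ?(ltW K1)//.
  - exists s; last exact: css.
    split=> //; rewrite /small; apply: (@le_trans _ _ R0); first by rewrite le_max lexx orbT.
    by rewrite ler_peMr// ltW.
  - move=> l /andP[l0 l1]; have yp := eball_convex l0 l1 yb yy'.
    have := yA _ yp; rewrite -covT => -[u /= uT up].
    have nu : near u by exists (b + l *: (y' - b)).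
    by have [hu|hu] := dich u uT nu; [left|right]; exists u.
have uw : (hull u `&` hull w) (b + l *: (y' - b)) by [].
rewrite (confT u w uT wT) in uw.
have [v vuw] : exists v, v \in (u `&` w)%fset.
  by apply/fset0Pn; apply: contraPneq uw => ->; exact: hull0.
have [vu vw] : v \in u /\ v \in w by move: vuw; rewrite inE => /andP[].
(* Were the common face a single vertex, the point of the segment would be that vertex. *)
have [v' v'uw v'v] : exists2 v', v' \in (u `&` w)%fset & v != v'.
  apply: contrapT => hn; have uwv : (u `&` w)%fset = [fset v]%fset.
    apply/fsetP => v'; rewrite in_fset1; apply/idP/idP => [v'uw|/eqP-> //].
    by apply: contrapT => /negP vv'; apply: hn; exists v' => //; rewrite eq_sym.
  rewrite uwv in uw; have := avoid v l (memV u v uT vu).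
  by rewrite (hull1 uw) eqxx.
have [v'u v'w] : v' \in u /\ v' \in w by move: v'uw; rewrite inE => /andP[].
(* As an edge of [u] the segment from [v] to [v'] has length at least [R0 K^(m+2)], as an edge of
   [w] at most [kap R0 K^(m+1)]; [K = 2 + kap] excludes this. *)
have [_ uB _] := shT u uT; have [w0 _ wd] := shT w wT.
have h1 := simplex_edge_ge (simT u uT) uB vu v'u v'v.
have h2 := wd _ _ (mem_hull vw) (mem_hull v'w).
have h3 : kap * rho w <= kap * (R0 * K ^+ m.+1) by rewrite ler_wpM2l.
have h4 : rho u <= kap * (R0 * K ^+ m.+1) by lra.
have h5 : 0 < R0 * K ^+ m.+1 by rewrite mulr_gt0// exprn_gt0.
move: bu; rewrite /big exprS mulrCA {1}/K; lra.
Qed.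

End LocalQuasiUniformityTheorem.

(** * The refinement forest *)

Section RefinementForest.
Context {R : realType} {d : nat}.
Variables (q : R) (chld : cell R d -> mesh R d) (refine : mesh R d -> mesh R d -> mesh R d).
Variables (T0 : mesh R d) (A : set 'rV[R]_d).
Hypotheses (strat : refinement_strategy q chld refine T0) (triT0 : triangulates T0 A)
  (confT0 : conforming T0).
Implicit Types (s t u : cell R d) (T M S : mesh R d).

Let q1 : 1 < q := ratio_gt1 strat.
Let q0 : 0 < q. Proof. exact: lt_trans q1. Qed.

Lemma vol_ge0 t : 0 <= vol t.
Proof. exact/fine_ge0/(outer_measure_ge0 (lebesgue_om R d)). Qed.

Lemma child_hull t s : forest_cell chld T0 t -> s \in chld t -> hull s `<=` hull t.
Proof.
move=> ft sc; have [[_ _ <-] _] := children_split strat ft.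
by move=> x sx; exists s.
Qed.

(** Keeps only what the estimates use of ancestry: inclusion and, for a proper descendant, the loss
    of at least one factor [q] in volume. *)
Definition descends t t' : Prop :=
  t' = t \/ (hull t' `<=` hull t /\ q * vol t' <= vol t).

Lemma descends_hull t t' : descends t t' -> hull t' `<=` hull t.
Proof. by case=> [->|[]]. Qed.

Lemma descends_vol t t' : descends t t' -> vol t' <= vol t.
Proof.
case=> [->//|[_]]; apply: le_trans.
by rewrite ler_peMl ?vol_ge0// ltW.
Qed.

Lemma descends_trans t t' t'' : descends t t' -> descends t' t'' -> descends t t''.
Proof.
move=> tt' [->//|[h1 h2]]; right; split; first exact: subset_trans (descends_hull tt').
exact: le_trans (descends_vol tt').
Qed.

Lemma split_step_triangulates T t : (forall u, u \in T -> forest_cell chld T0 u) ->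
  triangulates T A -> t \in T -> triangulates ((T `\ t) `|` chld t)%fset A.
Proof.
move=> fT [sT dT cT] tT; have [[sc dc cc] _] := children_split strat (fT t tT).
have sub u : u \in chld t -> hull u `<=` hull t by move=> uc; rewrite -cc => x ux; exists u.
split.
- by move=> u; rewrite !inE => /orP[/andP[_ /sT]|/sc].
- move=> u v; rewrite !inE => /orP[/andP[ut uT]|uc] /orP[/andP[vt vT]|vc] uv.
  + exact: dT.
  + by rewrite -subset0 -(dT u t)// => x [h1 h2]; split => //; apply: interiorS h2; exact: sub.
  + by rewrite -subset0 -(dT t v)// 1?eq_sym// => x [h1 h2]; split => //; apply: interiorS h1; exact: sub.
  + exact: dc.
- rewrite -cT; apply/seteqP; split=> [x [u /=]|x [u /= uT ux]].
    rewrite !inE => /orP[/andP[_ uT] ux|uc /(sub _ uc) tx]; first by exists u.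
    by exists t.
  have [ut|ut] := eqVneq u t.
    move: ux; rewrite ut -cc => -[v /= vc vx]; exists v => //=.
    by rewrite !inE vc orbT.
  by exists u => //=; rewrite !inE ut uT.
Qed.

Lemma split_into_forest T T' : split_into chld T T' ->
  (forall u, u \in T -> forest_cell chld T0 u) -> triangulates T A ->
  [/\ forall u, u \in T' -> forest_cell chld T0 u, triangulates T' A &
      forall u, u \in T' -> exists2 t, t \in T & descends t u].
Proof.
elim=> [T1 fT tT|T1 t T2 tT1 _ IH fT tT].
  by split=> // u uT; exists u => //; left.
have [|f2 t2 d2] := IH _ (split_step_triangulates fT tT tT1).
  move=> u; rewrite !inE => /orP[/andP[_ /fT]|] // uc.
  exact: forest_child (fT t tT1) uc.
split=> // u /d2[v]; rewrite !inE => /orP[/andP[_ vT]|vc] vu; first by exists v.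
exists t => //; apply: descends_trans vu; right.
split; first exact: child_hull (fT t tT1) vc.
by have [_ vt] := children_split strat (fT t tT1); rewrite (vt _ vc).
Qed.

Lemma generated_forest T : generated refine T0 T ->
  (forall u, u \in T -> forest_cell chld T0 u) /\ triangulates T A.
Proof.
elim=> [|T1 M gT [fT tT] MT].
  by split=> // u uT; exact: forest_root.
have [sp _] := refine_split strat gT MT.
by have [] := split_into_forest sp fT tT.
Qed.

Lemma generated_conforming T : generated refine T0 T -> conforming T.
Proof. by case=> // T1 M gT MT; exact: (refine_conforming strat gT MT). Qed.

Lemma refine_descends T M u : generated refine T0 T -> (M `<=` T)%fset ->
  u \in refine T M -> exists2 t, t \in T & descends t u.
Proof.
move=> gT MT; have [fT tT] := generated_forest gT.
have [sp _] := refine_split strat gT MT.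
by have [_ _] := split_into_forest sp fT tT; apply.
Qed.

Definition level (j : nat) : mesh R d := uniform_refinement chld T0 j.

Lemma levelS j u : u \in level j.+1 -> exists2 t, t \in level j & u \in chld t.
Proof. by move=> /bigfcupP[t /andP[tj _] uc]; exists t. Qed.

Lemma level_forest j t : t \in level j -> forest_cell chld T0 t.
Proof.
elim: j t => [|j IH] t; first exact: forest_root.
by move=> /levelS[s /IH fs tc]; exact: forest_child tc.
Qed.

Lemma forest_level t : forest_cell chld T0 t -> exists j, t \in level j.
Proof.
elim=> [u uT|u s _ [j uj] sc]; first by exists 0%N.
exists j.+1; apply/bigfcupP; exists u; rewrite ?uj//.
Qed.

Lemma level_vol j t : t \in level j -> exists2 t0, t0 \in T0 & vol t0 = q ^+ j * vol t.
Proof.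
elim: j t => [|j IH] t tj; first by exists t; rewrite // expr0 mul1r.
have [s sj tc] := levelS tj; have [t0 t0T vE] := IH s sj; exists t0 => //.
have [_ vs] := children_split strat (level_forest sj).
by rewrite vE (vs _ tc) exprSr mulrA.
Qed.

Lemma level_disjoint j s t : s \in level j -> t \in level j -> s != t ->
  (hull s)° `&` (hull t)° = set0.
Proof.
elim: j s t => [|j IH] s t.
  by case: triT0 => _ h _; exact: h.
move=> /levelS[s' s'j sc] /levelS[t' t'j tc] st.
have [E|ne] := eqVneq s' t'.
  have [[_ dc _] _] := children_split strat (level_forest s'j).
  by apply: dc => //; rewrite E.
rewrite -subset0 -(IH s' t')// => x [xs xt]; split.
  by apply: interiorS xs; exact: child_hull (level_forest s'j) sc.
by apply: interiorS xt; exact: child_hull (level_forest t'j) tc.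
Qed.

(** Peels off the top level and uses [1 + b + ... + b^J <= b^J b / (b - 1)]. *)
Lemma card_levels_le (a b : R) (S : mesh R d) (J : nat) : 1 < b -> 0 <= a ->
  (forall t, t \in S -> exists2 j, (j <= J)%N & t \in level j) ->
  (forall j, #|` [fset t in S | t \in level j]%fset|%:R <= a * b ^+ j) ->
  #|` S|%:R <= a * b ^+ J * (b / (b - 1)).
Proof.
move=> b1 a0; have b0 : 0 < b by exact: lt_trans b1.
have b10 : 0 < b - 1 by rewrite subr_gt0.
elim: J S => [|J IH] S lS cS.
  rewrite (_ : S = [fset t in S | t \in level 0]%fset).
    apply: le_trans (cS 0%N) _; rewrite ler_peMr ?mulr_ge0//.
    by rewrite ler_pdivlMr// mul1r gerBl.
  apply/fsetP => t; rewrite !inE /=; apply/idP/andP => [tS|[]//]; split => //.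
  by have [j] := lS t tS; rewrite leqn0 => /eqP->.
pose S1 := [fset t in S | t \in level J.+1]%fset.
have S1S : (S `&` S1)%fset = S1.
  by apply/fsetP => t; rewrite !inE /= andbA andbb.
have := cardfsID S1 S; rewrite S1S => <-; rewrite natrD.
apply: (@le_trans _ _ (a * b ^+ J.+1 + a * b ^+ J * (b / (b - 1)))).
  apply: lerD; first exact: cS.
  apply: IH => [t|j].
    rewrite !inE => /andP[nt tS]; have [j jJ tj] := lS t tS.
    move: jJ; rewrite leq_eqVlt => /orP[/eqP jE|jJ]; last by exists j.
    by move: nt; rewrite tS -jE tj.
  apply: le_trans (cS j); rewrite ler_nat; apply: fsubset_leq_card.
  by apply/fsubsetP => t; rewrite !inE/= => /andP[/andP[_ ->] ->].
rewrite le_eqVlt; apply/orP; left; apply/eqP; rewrite exprS; field.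
by rewrite gt_eqF.
Qed.

(** The top level [J] is lowered until it contains a cell of [S]; that cell turns [b^J] into the
    bound [B]. *)
Lemma card_geometric_le (a b B : R) (S : mesh R d) : 1 < b -> 0 <= a -> 0 <= B ->
  (forall t, t \in S -> forest_cell chld T0 t) ->
  (forall j, #|` [fset t in S | t \in level j]%fset|%:R <= a * b ^+ j) ->
  (forall j t, t \in S -> t \in level j -> b ^+ j <= B) ->
  #|` S|%:R <= a * B * (b / (b - 1)).
Proof.
move=> b1 a0 B0 fS cS bS; have b0 : 0 < b by exact: lt_trans b1.
have b10 : 0 <= b / (b - 1) by apply: divr_ge0; rewrite ?subr_ge0 ltW.
have [J lS] : exists J, forall t, t \in S -> exists2 j, (j <= J)%N & t \in level j.
  have [f fP] : {f : cell R d -> nat & forall t, t \in S -> t \in level (f t)}.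
    apply: (@choice _ _ (fun t j => t \in S -> t \in level j)) => t.
    have [tS|tS] := boolP (t \in S); last by exists 0%N.
    by have [j tj] := forest_level (fS t tS); exists j.
  exists (\max_(t <- enum_fset S) f t) => t tS; exists (f t); last exact: fP.
  exact: leq_bigmax_seq.
elim: J lS => [|J IH] lS.
  have [->|/fset0Pn[t tS]] := eqVneq S fset0; first by rewrite cardfs0; apply: mulr_ge0 => //; exact: mulr_ge0.
  apply: le_trans (card_levels_le b1 a0 lS cS) _.
  have [j] := lS t tS; rewrite leqn0 => /eqP-> tj.
  by rewrite ler_wpM2r// ler_wpM2l//; exact: bS tj.
have [/existsP[[t tS] /= tJ]|nJ] := boolP [exists t : S, val t \in level J.+1].
  apply: le_trans (card_levels_le b1 a0 lS cS) _.
  by rewrite ler_wpM2r// ler_wpM2l//; exact: bS tJ.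
apply: IH => t tS; have [j] := lS t tS.
rewrite leq_eqVlt => /orP[/eqP-> tJ|jJ tj]; last by exists j.
by case/negP: nJ; apply/existsP; exists [` tS]%fset.
Qed.

(** Common trace of the three algorithms: the list of marked sets, in which the complexity estimate
    is expressed. *)
Inductive refine_chain : mesh R d -> seq (mesh R d) -> mesh R d -> Prop :=
| chain_nil T : refine_chain T [::] T
| chain_cons T M Ms T' : (M `<=` T)%fset -> refine_chain (refine T M) Ms T' ->
    refine_chain T (M :: Ms) T'.

Lemma chain_cat T Ms T' Ms' T'' : refine_chain T Ms T' -> refine_chain T' Ms' T'' ->
  refine_chain T (Ms ++ Ms') T''.
Proof. by elim=> [//|T1 M Ms1 T2 MT _ IH h]; apply: chain_cons => //; exact: IH. Qed.

Lemma chain_rcons T Ms T' M : refine_chain T Ms T' -> (M `<=` T')%fset ->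
  refine_chain T (rcons Ms M) (refine T' M).
Proof. by move=> h MT; rewrite -cats1; apply: chain_cat h _; apply: chain_cons => //; exact: chain_nil. Qed.

Lemma chain_generated T Ms T' : generated refine T0 T -> refine_chain T Ms T' ->
  generated refine T0 T'.
Proof. by move=> + h; elim: h => // T1 M Ms1 T2 MT _ IH gT; apply: IH; exact: generated_step. Qed.

Lemma chain_descends T Ms T' u : generated refine T0 T -> refine_chain T Ms T' ->
  u \in T' -> exists2 t, t \in T & descends t u.
Proof.
move=> + h; elim: h u => [T1|T1 M Ms1 T2 MT _ IH] u gT; first by move=> uT; exists u => //; left.
move=> /(IH u (generated_step gT MT))[v vT vu].
have [t tT tv] := refine_descends gT MT vT; exists t => //; exact: descends_trans vu.
Qed.

Lemma chain_complexity : exists2 Cc : R, 1 <= Cc & forall Ms T, refine_chain T0 Ms T ->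
  #|` T|%:R <= #|` T0|%:R + Cc * \sum_(M <- Ms) #|` M|%:R.
Proof.
have [Cc Cc1 hC] := refine_complexity strat; exists Cc => // Ms T h.
have step Ms1 T1 T2 : refine_chain T1 Ms1 T2 ->
    T2 = foldl refine T1 Ms1 /\
    forall j, (j < size Ms1)%N -> (nth fset0 Ms1 j `<=` foldl refine T1 (take j Ms1))%fset.
  elim=> [T3|T3 M Ms3 T4 MT _ [-> hj]]; first by split.
  by split=> // -[|j]//=; exact: hj.
have [TE hj] := step _ _ _ h.
have := hC (fun j => foldl refine T0 (take j Ms)) (fun j => nth fset0 Ms j) (size Ms).
rewrite take0 take_size -TE lerBlDl => /(_ erefl) hC'.
rewrite (big_nth fset0) big_mkord; apply: hC' => j jM; split; first exact: hj.
by rewrite (take_nth fset0)// -cats1 foldl_cat.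
Qed.

End RefinementForest.

(** * Sizes, volumes and marks in shape regular meshes *)

Section ShapeRegularMeshes.
Context {R : realType} {d : nat}.
Variables (q : R) (chld : cell R d -> mesh R d) (refine : mesh R d -> mesh R d -> mesh R d).
Variables (T0 : mesh R d) (A : set 'rV[R]_d).
Hypotheses (d1 : (1 < d)%N) (strat : refinement_strategy q chld refine T0)
  (triT0 : triangulates T0 A) (confT0 : conforming T0).
Variables (ctr : cell R d -> 'rV[R]_d) (rho : cell R d -> R) (kap : R).
Hypotheses (kap0 : 0 < kap)
  (shT : forall T t, generated refine T0 T -> t \in T -> shaped ctr rho kap t).
Implicit Types (s t u : cell R d) (T M S : mesh R d).

Let d0 : (0 < d)%N. Proof. exact: ltnW. Qed.
Let dR : 0 < d%:R :> R. Proof. by rewrite ltr0n. Qed.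

Lemma hull_volE t : lebesgue_outer (hull t) = (vol t)%:E.
Proof.
rewrite /vol fineK//.
rewrite ge0_fin_numE; last exact: (outer_measure_ge0 (lebesgue_om R d)).
have [M M0 tM] := bounded_sub_eball (hull_bounded t).
apply: le_lt_trans (lebesgue_outer_le_cube (c := 0) (s := M) _ (ltW M0)) _; last exact: ltry.
move=> x /tM; rewrite /eball/= => /ltW xM i; apply: le_trans xM.
by have := coord_le_enorm (x - 0) i; rewrite !mxE.
Qed.

Lemma hsizeX t : hsize t ^+ d = vol t.
Proof.
rewrite /hsize -powR_mulrn ?powR_ge0// -powRrM mulVf ?gt_eqF// powRr1//.
exact: vol_ge0.
Qed.

Lemma shaped_vol_ge t : shaped ctr rho kap t -> rho t / (2 * d.+1%:R) <= hsize t.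
Proof.
move=> [r0 ct _].
have := @eball_packing R d _ [fset t]%fset ctr rho (hull t) d0.
rewrite big_seq_fset1 hull_volE lee_fin -hsizeX => h.
rewrite -(@ler_pXn2r _ d)// ?nnegrE ?hsize_ge0//; last by rewrite divr_ge0 ?mulr_ge0 ?ltW.
apply: h; first by move=> u; rewrite inE => /eqP->.
by move=> u v; rewrite !inE => /eqP-> /eqP->; rewrite eqxx.
Qed.

Lemma shaped_vol_le t : shaped ctr rho kap t -> hsize t <= 2 * kap * rho t.
Proof.
move=> st; have [r0 _ dt] := st.
have k0 : 0 <= kap * rho t by rewrite mulr_ge0 ?ltW.
rewrite -(@ler_pXn2r _ d)// ?nnegrE ?hsize_ge0//; last by rewrite -mulrA mulr_ge0.
rewrite hsizeX -lee_fin -hull_volE -mulrA.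
apply: (lebesgue_outer_le_cube (c := ctr t)) => // x tx i.
have := coord_le_enorm (x - ctr t) i; rewrite !mxE => /le_trans; apply.
by apply: dt => //; exact: (shape_center st).
Qed.

Lemma shaped_hsize_gt0 t : shaped ctr rho kap t -> 0 < hsize t.
Proof.
move=> st; apply: lt_le_trans (shaped_vol_ge st); have [r0 _ _] := st.
by rewrite divr_gt0// mulr_gt0.
Qed.

Lemma shaped_vol_gt0 t : shaped ctr rho kap t -> 0 < vol t.
Proof. by move=> /shaped_hsize_gt0 h; rewrite -hsizeX exprn_gt0. Qed.

Lemma hsize_le_vol s t : vol s <= vol t -> hsize s <= hsize t.
Proof. by move=> st; rewrite -(@ler_pXn2r _ d)// ?nnegrE ?hsize_ge0// !hsizeX. Qed.

(** The diameter is at most [kap * rho t], and the packing bound gives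
    [rho t <= 2 (d + 1) hsize t]. *)
Definition diam_cst : R := kap * (2 * d.+1%:R).

Lemma diam_cst_gt0 : 0 < diam_cst.
Proof. by rewrite /diam_cst !mulr_gt0. Qed.

Lemma shaped_diam t x y : shaped ctr rho kap t -> hull t x -> hull t y ->
  enorm (x - y) <= diam_cst * hsize t.
Proof.
move=> st tx ty; have [r0 _ dt] := st; apply: le_trans (dt x y tx ty) _.
rewrite /diam_cst -mulrA ler_wpM2l ?(ltW kap0)// mulrC -ler_pdivrMr ?mulr_gt0//.
exact: shaped_vol_ge.
Qed.

(** Ratio of the upper volume bound [(2 kap rho)^d] to the packing bound [(rho / (2 (d + 1)))^d]. *)
Definition vol_cst : R := (2 * kap * (2 * d.+1%:R)) ^+ d.

Lemma vol_cst_gt0 : 0 < vol_cst.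
Proof. by rewrite exprn_gt0// !mulr_gt0. Qed.

Lemma sum_vol_le S (E : set 'rV[R]_d) : (forall t, t \in S -> shaped ctr rho kap t) ->
  (forall s t, s \in S -> t \in S -> s != t -> (hull s)° `&` (hull t)° = set0) ->
  (forall t, t \in S -> hull t `<=` E) ->
  ((\sum_(t <- S) vol t)%:E <= vol_cst%:E * lebesgue_outer E)%E.
Proof.
move=> sS dS SE.
apply: (@le_trans _ _ (vol_cst%:E * (\sum_(t <- S) (rho t / (2 * d.+1%:R)) ^+ d)%:E)%E); last first.
  apply: lee_wpmul2l; first by rewrite lee_fin ltW// vol_cst_gt0.
  apply: (eball_packing (c := ctr)) => //.
    by move=> t tS; have [r0 ct _] := sS t tS; split => //; exact: subset_trans (SE t tS).
  move=> s t sS' tS st; apply: (disjoint_eballs (dS s t sS' tS st)).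
    by have [] := sS s sS'.
  by have [] := sS t tS.
rewrite -EFinM lee_fin mulr_sumr big_seq [leRHS]big_seq; apply: ler_sum => t tS.
rewrite /vol_cst -exprMn -hsizeX.
have st := sS t tS; have [r0 _ _] := st.
rewrite -(_ : 2 * kap * rho t = 2 * kap * (2 * d.+1%:R) * (rho t / (2 * d.+1%:R))).
  by rewrite lerXn2r ?nnegrE ?hsize_ge0 ?mulr_ge0 ?(ltW kap0) ?(ltW r0)// shaped_vol_le.
have e0 : 2 * d.+1%:R != 0 :> R by rewrite mulf_neq0.
by move: (2 * d.+1%:R : R) e0 => e e0; field.
Qed.

(** By conformity the overlap is the hull of the common vertices, and distinct simplices share at
    most [d] of them. *)
Lemma generated_overlap_null T s t : generated refine T0 T -> s \in T -> t \in T -> s != t ->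
  lebesgue_outer (hull s `&` hull t) = 0%E.
Proof.
move=> gT sT tT st; have [_ [simT _ _]] := generated_forest strat triT0 gT.
rewrite (generated_conforming strat confT0 gT sT tT); apply: hull_null => //.
have [cs _] := simT s sT; have [ct _] := simT t tT.
rewrite -ltnS -cs ltnNge; apply/negP => h; move/eqP: st; apply.
have /eqP E1 : (s `&` t == s)%fset by rewrite eqEfcard fsubsetIl.
have /eqP E2 : (s `&` t == t)%fset by rewrite eqEfcard fsubsetIr ct -cs.
by rewrite -E1 E2.
Qed.

(** Invariant behind single marking: [m \notin T] alone need not survive refinement, whereas this
    property does. *)
Definition avoids T m := forall u, u \in T ->
  (hull u)° `&` (hull m)° = set0 \/ (hull u `<=` hull m /\ vol u < vol m).

Lemma interior_ne0 t : shaped ctr rho kap t -> (hull t)° (ctr t).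
Proof. by move=> [r0 h _]; apply: (interior_eball_sub h); exact: eball_center. Qed.

Lemma avoids_notin T m : generated refine T0 T -> shaped ctr rho kap m -> avoids T m -> m \notin T.
Proof.
move=> gT sm aT; apply/negP => /aT[h|[_]]; last by rewrite ltxx.
have := interior_ne0 sm => hm; have : ((hull m)° `&` (hull m)°) (ctr m) by [].
by rewrite h.
Qed.

Lemma refine_avoids T M m : generated refine T0 T -> (M `<=` T)%fset ->
  m \in M \/ avoids T m -> avoids (refine T M) m.
Proof.
move=> gT MT hm u uT'; have [t tT tu] := refine_descends strat triT0 gT MT uT'.
have tut := descends_hull tu.
have [mM|aT] := hm; last first.
  have [h|[h1 h2]] := aT t tT.
    by left; rewrite -subset0 -h => x [ux mx]; split => //; exact: interiorS ux.
  by right; split; [exact: subset_trans h1|exact: le_lt_trans (descends_vol strat tu) h2].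
have mT : m \in T by exact: (fsubsetP MT).
have [tm|tm] := eqVneq t m; last first.
  left; have [_ [_ disT _]] := generated_forest strat triT0 gT.
  by rewrite -subset0 -(disT t m)// => x [ux mx]; split => //; exact: interiorS ux.
have [_ /fdisjointP/(_ m mM) mT'] := refine_split strat gT MT.
right; rewrite -tm; split=> //; case: tu => [ut|[_ qv]].
  by move: mT'; rewrite -tm -ut uT'.
apply: lt_le_trans qv; rewrite ltr_pMl ?(ratio_gt1 strat)//.
by apply: shaped_vol_gt0; apply: shT uT'; exact: generated_step.
Qed.

Lemma chain_marks_avoided T Ms T' M m : generated refine T0 T -> refine_chain refine T Ms T' ->
  avoids T m -> shaped ctr rho kap m -> M \in Ms -> m \notin M.
Proof.
move=> + h; elim: h => // T1 M1 Ms1 T2 MT _ IH gT aT sm.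
rewrite inE => /orP[/eqP->|].
  by apply/negP => /(fsubsetP MT); exact/negP/avoids_notin.
apply: IH => //; first exact: generated_step.
by apply: refine_avoids => //; right.
Qed.

Lemma chain_marks_generated T Ms T' M m : generated refine T0 T -> refine_chain refine T Ms T' ->
  M \in Ms -> m \in M -> exists2 T'', generated refine T0 T'' & m \in T''.
Proof.
move=> + h; elim: h => // T1 M1 Ms1 T2 MT _ IH gT.
rewrite inE => /orP[/eqP-> mM|]; first by exists T1 => //; exact: (fsubsetP MT).
by apply: IH; exact: generated_step.
Qed.

(* A marked cell is never marked again. *)
Lemma chain_marks_card T Ms T' : generated refine T0 T -> refine_chain refine T Ms T' ->
  \sum_(M <- Ms) #|` M| = #|` \bigcup_(M <- Ms) M|%fset.
Proof.
move=> + h; elim: h => [T1|T1 M1 Ms1 T2 MT h IH] gT; first by rewrite !big_nil cardfs0.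
rewrite !big_cons cardfsU IH; last exact: generated_step.
rewrite (_ : (M1 `&` _)%fset = fset0) ?cardfs0 ?subn0//.
apply/fsetP => m; rewrite !inE; apply/negP => /andP[mM /bigfcupP[M /andP[MMs _] mM']].
have sm : shaped ctr rho kap m by apply: shT gT _; exact: (fsubsetP MT).
have av : avoids (refine T1 M1) m by apply: refine_avoids => //; left.
by have := chain_marks_avoided (generated_step gT MT) h av sm MMs; rewrite mM'.
Qed.

End ShapeRegularMeshes.

(** * Cells near the interface *)

Lemma fset_lower_bound (R : realType) (I : choiceType) (S : {fset I}) (f : I -> R) :
  (forall i, i \in S -> 0 < f i) -> exists2 m : R, 0 < m & forall i, i \in S -> m <= f i.
Proof.
move=> f0; have [m m0 mP] : exists2 m : R, 0 < m & forall i, i \in enum_fset S -> m <= f i.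
  have : forall i, i \in enum_fset S -> 0 < f i by [].
  elim: (enum_fset S) => [|i s IH] fs; first by exists 1.
  have [m m0 mP] := IH (fun j js => fs j (mem_behead (s := i :: s) js)).
  exists (Num.min m (f i)); first by rewrite lt_min m0 fs// mem_head.
  by move=> j; rewrite inE ge_min => /orP[/eqP->|/mP->//]; rewrite lexx orbT.
by exists m.
Qed.

Lemma fset_upper_bound (R : realType) (I : choiceType) (S : {fset I}) (f : I -> R) :
  exists2 m : R, 0 < m & forall i, i \in S -> f i <= m.
Proof.
exists (1 + \sum_(i <- S) `|f i|); first by rewrite ltr_pwDl// sumr_ge0.
move=> i iS; rewrite (bigD1_seq i iS (fset_uniq S))/=.
have : f i <= `|f i| by exact: ler_norm.
have : 0 <= \sum_(j <- S | j != i) `|f j| by rewrite sumr_ge0.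
lra.
Qed.

Section InterfaceCells.
Context {R : realType} {d : nat}.
Variables (q : R) (chld : cell R d -> mesh R d) (refine : mesh R d -> mesh R d -> mesh R d).
Variables (T0 : mesh R d) (A gamma : set 'rV[R]_d) (cg : R).
Hypotheses (d1 : (1 < d)%N) (strat : refinement_strategy q chld refine T0)
  (triT0 : triangulates T0 A) (confT0 : conforming T0).
Variables (ctr : cell R d -> 'rV[R]_d) (rho : cell R d -> R) (kap : R).
Hypotheses (kap0 : 0 < kap)
  (shT : forall T t, generated refine T0 T -> t \in T -> shaped ctr rho kap t).
Hypotheses (cg0 : 0 < cg) (ballA : forall y, gamma y -> eball y cg `<=` A).
Hypothesis thick : forall rmax : R, exists2 C : R, 0 < C &
  forall e, 0 < e -> e <= rmax -> (lebesgue_outer (thickening gamma e) <= (C * e)%:E)%E.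
Implicit Types (s t u : cell R d) (T M S : mesh R d).

Let d0 : (0 < d)%N. Proof. exact: ltnW. Qed.
Let dR : 0 < d%:R :> R. Proof. by rewrite ltr0n. Qed.
Let q1 : 1 < q := ratio_gt1 strat.
Let q0 : 0 < q. Proof. exact: lt_trans q1. Qed.

Definition meets_nbhd (D : R) t := exists2 x, hull t x & exists2 y, gamma y & enorm (x - y) <= D.

Lemma level_hsize : exists2 p : R, 1 < p & p ^+ d = q /\
  forall j t, t \in level chld T0 j -> exists2 t0, t0 \in T0 & hsize t0 = p ^+ j * hsize t.
Proof.
pose p := q `^ (d%:R^-1).
have p0 : 0 <= p by exact: powR_ge0.
have pd : p ^+ d = q by rewrite /p -powR_mulrn// -powRrM mulVf ?gt_eqF// powRr1// ltW.
exists p.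
  by rewrite ltNge; apply/negP => p1; have := q1; rewrite ltNge -pd exprn_ile1.
split=> // j t tj; have [t0 t0T vE] := level_vol strat tj; exists t0 => //.
apply/eqP; rewrite -(@eqrXn2 _ d)// ?mulr_ge0 ?hsize_ge0 ?exprn_ge0//.
by rewrite exprMn !hsizeX// vE -exprM mulnC exprM pd.
Qed.

(** The point [y] of [gamma] lies in a cell of size at most [r / 2], and local quasi-uniformity with
    [D = d r] carries this to [t]. It needs the ball of radius [2 d r] inside the domain; if
    [2 d r > cg], then [r] is bounded below and the largest initial size suffices. *)
Lemma near_hsize : exists2 C : R, 0 < C & forall T r, generated refine T0 T ->
  0 < r -> r < cg -> diamG gamma T <= r / 2 ->
  forall t, t \in T -> meets_nbhd (d%:R * r) t -> hsize t <= C * r.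
Proof.
have [hm hm0 hmP] := fset_upper_bound T0 (@hsize R d).
have [Q [Q0 QE]] : exists Q : R, 0 < Q /\ size_ratio (d := d) kap = Q.
  by exists (size_ratio (d := d) kap); rewrite exprn_gt0// ltr_pwDl// ltW.
exists (2 * kap * d.+1%:R * Q + 2 * d%:R * hm / cg).
  by apply: addr_gt0; rewrite !mulr_gt0 ?invr_gt0.
move=> T r gT r0 rc dG t tT [x tx [y gy xy]].
have [fT [simT disT covT]] := generated_forest strat triT0 gT.
have [small|big] := leP (2 * (d%:R * r)) cg; last first.
  have [p p1 [_ pP]] := level_hsize.
  have [j tj] := forest_level (fT t tT).
  have [t0 /hmP h0 hE] := pP j t tj.
  have : hsize t <= hm.
    by apply: le_trans h0; rewrite hE ler_peMl ?hsize_ge0// exprn_ege1// ltW.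
  move=> ht; apply: (le_trans ht); rewrite mulrDl; apply: (@le_trans _ _ (2 * d%:R * hm / cg * r)).
    rewrite mulrAC ler_pdivlMr// (_ : 2 * d%:R * hm * r = hm * (2 * (d%:R * r))); last by ring.
    by rewrite ler_pM2l// ltW.
  by rewrite lerDr !mulr_ge0 ?(ltW kap0) ?(ltW Q0) ?(ltW r0).
have yA : A y by apply: (ballA gy); exact: eball_center.
have [s /= sT sy] : (\bigcup_(t in [set` T]) hull t) y by rewrite covT.
have hs : hsize s <= r / 2.
  apply: le_trans dG; rewrite /diamG; apply: le_bigmax_seq => //.
  by rewrite !inE sT/=; apply/asboolP; exists y.
have rs : rho s <= d.+1%:R * r.
  have := shaped_vol_ge d1 (shT gT sT); rewrite ler_pdivrMr ?mulr_gt0// => /le_trans; apply.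
  by rewrite mulrCA mulrA [leLHS]mulrC; apply: ler_wpM2l => //; lra.
have := local_quasi_uniformity (ctr := ctr) (rho := rho) d1 (ltW kap0)
  (generated_conforming strat confT0 gT) (And3 simT disT covT) (fun u => shT gT) _ _ sT tT sy tx xy.
rewrite QE => hr.
have {}hr : rho t <= Num.max (d%:R * r) (rho s) * Q.
  apply: hr; first by rewrite mulr_gt0.
  by move=> z yz; apply: (ballA gy); apply: lt_le_trans yz _.
have hr' : rho t <= d.+1%:R * r * Q.
  apply: le_trans hr _; rewrite ler_wpM2r ?(ltW Q0)// ge_max rs andbT.
  by rewrite ler_wpM2r ?(ltW r0)// ler_nat.
apply: le_trans (shaped_vol_le d1 kap0 (shT gT tT)) _.
apply: (@le_trans _ _ (2 * kap * (d.+1%:R * r * Q))).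
  by rewrite ler_wpM2l// mulr_ge0// ltW.
rewrite [leRHS]mulrDl (_ : 2 * kap * (d.+1%:R * r * Q) = 2 * kap * d.+1%:R * Q * r); last by ring.
by rewrite lerDl !mulr_ge0 ?invr_ge0 ?(ltW hm0) ?(ltW cg0) ?(ltW r0).
Qed.

Lemma near_thickening t (D h : R) : shaped ctr rho kap t -> meets_nbhd D t -> hsize t <= h ->
  hull t `<=` thickening gamma (D + diam_cst (d := d) kap * h).
Proof.
move=> st [x tx [y gy xy]] th z tz; exists y => //.
apply: le_trans (enorm_triangle x _ _) _; rewrite [leRHS]addrC; apply: lerD => //.
apply: le_trans (shaped_diam d1 kap0 st tz tx) _.
by rewrite ler_wpM2l// ltW// diam_cst_gt0.
Qed.

(* Cells that, as in the output of INTERFACE, reach the support of the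
   regularization and have size at most [C * r]. *)
Definition tame (C r : R) t :=
  [/\ shaped ctr rho kap t, meets_nbhd (d%:R * r) t & hsize t <= C * r].

Lemma tame_sum_vol (C : R) : 0 < C -> exists2 C' : R, 0 < C' & forall r S, 0 < r -> r < cg ->
  (forall t, t \in S -> tame C r t) ->
  (forall s t, s \in S -> t \in S -> s != t -> (hull s)° `&` (hull t)° = set0) ->
  \sum_(t <- S) vol t <= C' * r.
Proof.
(* A tame cell lies in the [e r]-thickening of [gamma]: distance [d r] plus a diameter of at most
   [diam_cst * C * r]. *)
move=> C0; pose e := d%:R + diam_cst (d := d) kap * C.
have k0 := diam_cst_gt0 (d := d) kap0.
have e0 : 0 < e by rewrite addr_gt0// mulr_gt0.
have [Cg Cg0 hCg] := thick (e * cg).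
exists (vol_cst (d := d) kap * (Cg * e)); first by rewrite !mulr_gt0// vol_cst_gt0.
move=> r S r0 rc tS dS.
rewrite -lee_fin -mulrA EFinM -mulrA.
have er : d%:R * r + diam_cst (d := d) kap * (C * r) = e * r by rewrite mulrDl mulrA.
apply: (@le_trans _ _ ((vol_cst (d := d) kap)%:E * lebesgue_outer (thickening gamma (e * r)))%E).
  apply: (sum_vol_le d1 kap0) => // t /tS[st nt ht]; first exact: st.
  by rewrite -er; exact: near_thickening.
apply: lee_wpmul2l; first by rewrite lee_fin ltW// vol_cst_gt0.
apply: hCg; first by rewrite mulr_gt0.
by rewrite ler_pM2l// ltW.
Qed.

Lemma card_level_le S j (m V : R) : 0 < m ->
  (forall t0, t0 \in T0 -> m <= vol t0) ->
  \sum_(t <- [fset t in S | t \in level chld T0 j]%fset) vol t <= V ->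
  #|` [fset t in S | t \in level chld T0 j]%fset|%:R <= V / m * q ^+ j.
Proof.
move=> m0 mP; set Sj := [fset t in S | _]%fset => VS.
rewrite mulrAC ler_pdivlMr// -ler_pdivrMr ?exprn_gt0//; apply: le_trans VS.
apply: (@le_trans _ _ (\sum_(t <- Sj) m / q ^+ j)).
  by rewrite big_const_seq count_predT iter_addr_0 -[leRHS]mulr_natl mulrA.
rewrite big_seq [leRHS]big_seq; apply: ler_sum => t; rewrite !inE /= => /andP[_ tj].
have [t0 /mP mt0 vE] := level_vol strat tj.
by rewrite ler_pdivrMr ?exprn_gt0// mulrC -vE.
Qed.

Lemma root_vol_ge : exists2 m : R, 0 < m & forall t0, t0 \in T0 -> m <= vol t0.
Proof.
apply: fset_lower_bound => t tT; apply: (shaped_vol_gt0 d1 (ctr := ctr) (rho := rho) (kap := kap)).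
by apply: shT tT; exact: generated_init.
Qed.

Lemma card_tame_le (C : R) : 0 < C -> exists2 C' : R, 0 < C' & forall r eta S,
  0 < r -> r < cg -> 0 < eta ->
  (forall t, t \in S -> [/\ forest_cell chld T0 t, tame C r t & eta <= hsize t]) ->
  #|` S|%:R <= C' * (r / eta ^+ d).
Proof.
move=> C0; have [C3 C30 hC3] := tame_sum_vol C0.
have [m m0 mP] := root_vol_ge.
have [hm hm0 hmP] := fset_upper_bound T0 (@vol R d).
have qq : 0 < q / (q - 1) by rewrite divr_gt0// subr_gt0.
exists (C3 / m * hm * (q / (q - 1))); first by rewrite (mulr_gt0 _ qq)// mulr_gt0// divr_gt0.
move=> r eta S r0 rc eta0 SP.
have ed : 0 < eta ^+ d by rewrite exprn_gt0.
have -> : C3 / m * hm * (q / (q - 1)) * (r / eta ^+ d) =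
          (C3 * r / m) * (hm / eta ^+ d) * (q / (q - 1)).
  by field; rewrite !gt_eqF// subr_gt0.
apply: card_geometric_le => //.
- by apply: divr_ge0; rewrite ?mulr_ge0 ?(ltW C30) ?(ltW r0) ?(ltW m0).
- by apply: divr_ge0; rewrite ?(ltW hm0) ?(ltW ed).
- by move=> t /SP[ft _ _]; exact: ft.
- move=> j; apply: card_level_le => //; apply: hC3 => //.
    by move=> t; rewrite !inE /= => /andP[/SP[_ tt _] _]; exact: tt.
  move=> s t; rewrite !inE /= => /andP[_ sj] /andP[_ tj].
  exact: (level_disjoint strat triT0 sj tj).
(* Occupied levels are bounded through [q^j eta^d <= q^j vol t], the volume of the root. *)
- move=> j t tS tj; have [_ _ et] := SP t tS; have [t0 /hmP ht0 vE] := level_vol strat tj.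
  rewrite ler_pdivlMr//; apply: le_trans ht0; rewrite vE.
  by rewrite ler_wpM2l ?exprn_ge0 ?(ltW q0)// -hsizeX// lerXn2r ?nnegrE ?hsize_ge0// ltW.
Qed.

(** Cells of level [j] meeting [gamma] have size of order [p^-j], hence fill a thickening of volume
    of order [p^-j], and number at most [C p^-j q^j = C p^(j (d-1))]. The condition
    [r / 2 < hsize t] gives [p^j <= 2 hm / r] on the finest level. *)
Lemma card_interface_le : exists2 C : R, 0 < C & forall r S, 0 < r ->
  (forall t, t \in S -> [/\ forest_cell chld T0 t, shaped ctr rho kap t,
     hull t `&` gamma !=set0 & r / 2 < hsize t]) ->
  #|` S|%:R <= C / r ^+ d.-1.
Proof.
have [m m0 mP] := root_vol_ge.
have [hm hm0 hmP] := fset_upper_bound T0 (@hsize R d).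
have [p p1 [pd pP]] := level_hsize.
have p0 : 0 < p by exact: lt_trans p1.
have k0 := diam_cst_gt0 (d := d) kap0.
pose K := diam_cst (d := d) kap * hm.
have K0 : 0 < K by rewrite mulr_gt0.
have [Cg Cg0 hCg] := thick K.
pose b := p ^+ d.-1.
have b1 : 1 < b by rewrite exprn_egt1// -lt0n -ltnS prednK.
have bb : 0 < b / (b - 1) by rewrite divr_gt0 ?subr_gt0// (lt_trans _ b1).
pose a := vol_cst (d := d) kap * (Cg * K) / m.
have a0 : 0 < a by rewrite !mulr_gt0 ?invr_gt0// vol_cst_gt0.
exists (a * (2 * hm) ^+ d.-1 * (b / (b - 1))); first by rewrite (mulr_gt0 _ bb)// mulr_gt0// exprn_gt0// mulr_gt0.
move=> r S r0 SP.
have -> : a * (2 * hm) ^+ d.-1 * (b / (b - 1)) / r ^+ d.-1 =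
          a * (2 * hm / r) ^+ d.-1 * (b / (b - 1)).
  by rewrite expr_div_n mulrAC; ring.
apply: card_geometric_le => //.
- exact: ltW.
- by apply: exprn_ge0; apply: divr_ge0; rewrite ?mulr_ge0 ?(ltW hm0) ?(ltW r0).
- by move=> t /SP[ft _ _ _]; exact: ft.
- move=> j; have pj : 0 < p ^+ j by rewrite exprn_gt0.
  have -> : a * b ^+ j = vol_cst (d := d) kap * (Cg * (K / p ^+ j)) / m * q ^+ j.
    have -> : q ^+ j = p ^+ j * b ^+ j by rewrite -exprMn /b -exprS prednK// pd.
    by rewrite /a; field; rewrite !gt_eqF.
  have small t : t \in S -> t \in level chld T0 j -> hsize t <= hm / p ^+ j.
    by move=> tS tj; have [t0 /hmP h hE] := pP j t tj; rewrite ler_pdivlMr// mulrC -hE.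
  apply: card_level_le => //; rewrite -lee_fin EFinM.
  apply: (@le_trans _ _ ((vol_cst (d := d) kap)%:E * lebesgue_outer (thickening gamma (K / p ^+ j)))%E).
    apply: (sum_vol_le d1 kap0) => //.
    + by move=> t; rewrite !inE /= => /andP[/SP[_ st _ _] _]; exact: st.
    + move=> s t; rewrite !inE /= => /andP[_ sj] /andP[_ tj].
      exact: (level_disjoint strat triT0 sj tj).
    + move=> t; rewrite !inE /= => /andP[tS tj]; have [_ st [x [tx gx]] _] := SP t tS.
      have nt : meets_nbhd 0 t by exists x => //; exists x => //; rewrite subrr enorm0.
      have := near_thickening st nt (small t tS tj).
      by rewrite add0r mulrA.
  apply: lee_wpmul2l; first by rewrite lee_fin ltW// vol_cst_gt0.
  apply: hCg; first by rewrite divr_gt0.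
  by rewrite ler_pdivrMr// ler_peMr ?exprn_ege1 ?(ltW K0)// ltW.
- move=> j t tS tj; have [_ _ _ rt] := SP t tS; have [t0 /hmP h hE] := pP j t tj.
  rewrite /b -exprM mulnC exprM lerXn2r ?nnegrE ?exprn_ge0 ?(ltW p0)//.
    by rewrite divr_ge0 ?mulr_ge0// ltW.
  rewrite ler_pdivlMr//; rewrite hE in h.
  have pj : 0 <= p ^+ j by rewrite exprn_ge0// ltW.
  have := ler_wpM2l pj (ltW rt); lra.
Qed.

End InterfaceCells.

(** * Marking strategies *)

Section ErrorReduction.
Context {R : realType} {d : nat}.
Variables (q : R) (chld : cell R d -> mesh R d) (refine : mesh R d -> mesh R d -> mesh R d).
Variables (T0 : mesh R d) (A : set 'rV[R]_d).
Hypotheses (d1 : (1 < d)%N) (strat : refinement_strategy q chld refine T0)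
  (triT0 : triangulates T0 A) (confT0 : conforming T0).
Implicit Types (s t u : cell R d) (T M S : mesh R d) (g : 'rV[R]_d -> R).

Let d0 : (0 < d)%N. Proof. exact: ltnW. Qed.

Lemma data_error_ge0 g T : 0 <= data_error g T.
Proof. exact: sqrtr_ge0. Qed.

Lemma data_error_sqr g T : data_error g T ^+ 2 = \sum_(t <- T) indicator g t ^+ 2.
Proof. by rewrite sqr_sqrtr// sumr_ge0// => t _; exact: sqr_ge0. Qed.

Lemma energy_fin g t (B : R) : (forall x, `|g x| <= B) -> energy g (hull t) \is a fin_num.
Proof.
move=> gB; have B0 : 0 <= B by apply: le_trans (gB 0).
rewrite ge0_fin_numE ?energy_ge0//.
apply: le_lt_trans (energy_le (B := B) (A := hull t) B0 _) _; first by move=> x _; exact: gB.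
by rewrite hull_volE// -EFinM ltry.
Qed.

Lemma indicator_sqr_le g t (B : R) : (forall x, `|g x| <= B) ->
  indicator g t ^+ 2 <= B ^+ 2 * (hsize t ^+ 2 * vol t).
Proof.
move=> gB; have B0 : 0 <= B by apply: le_trans (gB 0).
rewrite indicator_sqr mulrCA; apply: ler_wpM2l; first by rewrite exprn_ge0// hsize_ge0.
rewrite -lee_fin fineK; last exact: energy_fin gB.
by rewrite EFinM -hull_volE//; apply: energy_le.
Qed.

Lemma sum_energy_le g (B : R) T t (r : seq (cell R d)) : (forall x, `|g x| <= B) ->
  generated refine T0 T -> uniq r -> {subset r <= T} -> (forall u, u \in r -> hull u `<=` hull t) ->
  \sum_(u <- r) fine (energy g (hull u)) <= fine (energy g (hull t)).
Proof.
move=> gB gT ur rT rt; rewrite -lee_fin fineK; last exact: energy_fin gB.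
rewrite -sumEFin (eq_bigr (fun u => energy g (hull u))); last first.
  by move=> u _; rewrite fineK//; exact: energy_fin gB.
apply: (lower_integral_almost_disjoint (mu := lebesgue_om R d)) => //.
  by move=> x; rewrite lee_fin sqr_ge0.
move=> u v /rT uT /rT vT uv; exact: (generated_overlap_null d1 strat triT0 confT0 gT).
Qed.

(** Each new cell is charged to an ancestor in [T]. The energies charged to one cell add up to at
    most its own; below a marked cell every size has dropped by the factor [p = q^(1/d)], so its
    squared indicator is reduced by [p^-2]. *)
Lemma refine_error g (B p : R) T M : (forall x, `|g x| <= B) -> 1 < p -> p ^+ d = q ->
  generated refine T0 T -> (M `<=` T)%fset ->
  data_error g (refine T M) ^+ 2 <=
  data_error g T ^+ 2 - (1 - p ^- 2) * data_error g M ^+ 2.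
Proof.
move=> gB p1 pd gT MT; rewrite !data_error_sqr.
have gT' := generated_step gT MT; set T' := refine T M in gT' *.
have p0 : 0 < p by exact: lt_trans p1.
have p2 : 0 <= p ^- 2 by rewrite invr_ge0 exprn_ge0// ltW.
have [a aP] : {a : cell R d -> cell R d & forall u, u \in T' -> a u \in T /\ descends q (a u) u}.
  apply: (@choice _ _ (fun u t => u \in T' -> t \in T /\ descends q t u)) => u.
  have [uT'|uT'] := boolP (u \in T'); last by exists u.
  by have [t tT tu] := refine_descends strat triT0 gT MT uT'; exists t.
pose c t : R := if t \in M then p ^- 2 else 1.
have c0 t : 0 <= c t by rewrite /c; case: ifP.
have hc u : u \in T' -> hsize u ^+ 2 <= c (a u) * hsize (a u) ^+ 2.
  move=> uT'; have [aT au] := aP u uT'; rewrite /c; case: ifPn => aM; last first.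
    by rewrite mul1r lerXn2r ?nnegrE ?hsize_ge0// hsize_le_vol//; exact: (descends_vol strat au).
  rewrite mulrC ler_pdivlMr ?exprn_gt0// mulrC -exprMn lerXn2r ?nnegrE ?mulr_ge0 ?hsize_ge0 ?(ltW p0)//.
  have [_ /fdisjointP/(_ _ aM) aT'] := refine_split strat gT MT.
  case: au => [uE|[_ qv]]; first by move: aT'; rewrite -uE uT'.
  rewrite -(@ler_pXn2r _ d)// ?nnegrE ?mulr_ge0 ?hsize_ge0 ?(ltW p0)//.
  by rewrite exprMn !hsizeX// pd.
have -> : \sum_(u <- T') indicator g u ^+ 2 =
    \sum_(t <- T) \sum_(u <- T' | a u == t) indicator g u ^+ 2.
  rewrite (exchange_big_dep xpredT)//= big_seq [RHS]big_seq; apply: eq_bigr => u uT'.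
  have [aT _] := aP u uT'; rewrite -big_filter (_ : [seq t <- T | a u == t] = [:: a u]) ?big_seq1//.
  apply: perm_small_eq => //; apply: uniq_perm; rewrite ?filter_uniq ?fset_uniq//.
  by move=> t; rewrite mem_filter inE eq_sym; case: eqP => // ->.
have -> : \sum_(t <- T) indicator g t ^+ 2 - (1 - p ^- 2) * \sum_(t <- M) indicator g t ^+ 2 =
    \sum_(t <- T) c t * indicator g t ^+ 2.
  have -> : \sum_(t <- M) indicator g t ^+ 2 = \sum_(t <- T | t \in M) indicator g t ^+ 2.
    rewrite -[RHS]big_filter; apply: perm_big; apply: uniq_perm; rewrite ?filter_uniq ?fset_uniq//.
    move=> t; rewrite mem_filter; apply/idP/andP => [tM|[]//]; split => //.
    exact: (fsubsetP MT).
  rewrite mulr_sumr [X in _ - X]big_mkcond -sumrB; apply: eq_bigr => t _.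
  by rewrite /c; case: ifP => _; ring.
rewrite big_seq [leRHS]big_seq; apply: ler_sum => t tT.
rewrite -big_filter; set r := [seq u <- T' | a u == t].
have rP u : u \in r -> u \in T' /\ a u = t by rewrite mem_filter => /andP[/eqP].
apply: (@le_trans _ _ (\sum_(u <- r) c t * hsize t ^+ 2 * fine (energy g (hull u)))).
  rewrite big_seq [leRHS]big_seq; apply: ler_sum => u /rP[uT' uE].
  rewrite indicator_sqr ler_wpM2r ?fine_ge0 ?energy_ge0//.
  by have := hc u uT'; rewrite uE.
rewrite -mulr_sumr indicator_sqr mulrA ler_wpM2l ?mulr_ge0 ?exprn_ge0 ?hsize_ge0//.
apply: (sum_energy_le gB gT'); first by rewrite filter_uniq// fset_uniq.
  by move=> u /rP[].
by move=> u /rP[uT' <-]; have [_ /descends_hull] := aP u uT'.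
Qed.

End ErrorReduction.

Lemma fset_argmax (R : realDomainType) (I : choiceType) (T : {fset I}) (f : I -> R) :
  T != fset0 -> exists2 t, t \in T & forall s, s \in T -> f s <= f t.
Proof.
move=> T0; have : forall s, (s \in T) = (s \in enum_fset T) by [].
have : enum_fset T != [::] by apply: contra_neq T0 => T0; apply/fsetP => s; rewrite inE -[LHS]/(s \in enum_fset T) T0.
suff h (l : seq I) : l != [::] -> exists2 t, t \in l & forall s, s \in l -> f s <= f t.
  by move=> /h[t tl tmax] _; exists t.
elim: l => // a l IH _; have [->|/IH[t tl tmax]] := eqVneq l [::].
  by exists a; rewrite ?mem_head// => s; rewrite inE => /eqP->.
have [at_|ta] := leP (f a) (f t).
  by exists t; rewrite ?inE ?tl ?orbT// => s; rewrite inE => /orP[/eqP->//|/tmax].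
exists a; rewrite ?mem_head// => s; rewrite inE => /orP[/eqP->//|/tmax st].
exact: le_trans st (ltW ta).
Qed.

(** * Counting marks and proving termination *)

Section Algorithms.
Context {R : realType} {d : nat}.
Variables (q : R) (chld : cell R d -> mesh R d) (refine : mesh R d -> mesh R d -> mesh R d).
Variables (T0 : mesh R d) (A gamma : set 'rV[R]_d) (cg : R).
Hypotheses (d1 : (1 < d)%N) (strat : refinement_strategy q chld refine T0)
  (triT0 : triangulates T0 A) (confT0 : conforming T0).
Variables (ctr : cell R d -> 'rV[R]_d) (rho : cell R d -> R) (kap : R).
Hypotheses (kap0 : 0 < kap)
  (shT : forall T t, generated refine T0 T -> t \in T -> shaped ctr rho kap t).
Implicit Types (s t u : cell R d) (T M S : mesh R d) (g : 'rV[R]_d -> R).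

Let d0 : (0 < d)%N. Proof. exact: ltnW. Qed.

Lemma size_le_sum_card (Ms : seq (mesh R d)) : (forall M, M \in Ms -> M != fset0) ->
  (size Ms <= \sum_(M <- Ms) #|` M|)%N.
Proof.
elim: Ms => [|M Ms IH] ne; first by rewrite big_nil.
rewrite big_cons /= -add1n leq_add ?cardfs_gt0 ?ne ?mem_head//.
by apply: IH => M' M'Ms; apply: ne; rewrite inE M'Ms orbT.
Qed.

(** Nonempty marked sets make the number of marked cells a bound for the number of steps, which
    yields termination. *)
Definition marks (P : cell R d -> Prop) (Ms : seq (mesh R d)) :=
  forall M, M \in Ms -> M != fset0 /\ forall m, m \in M -> P m.

Lemma marks_rcons P Ms M : marks P Ms -> M != fset0 -> (forall m, m \in M -> P m) ->
  marks P (rcons Ms M).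
Proof. by move=> mP M0 MP M'; rewrite mem_rcons inE => /orP[/eqP->//|/mP]. Qed.

Lemma marks_cons P Ms M : marks P Ms -> M != fset0 -> (forall m, m \in M -> P m) ->
  marks P (M :: Ms).
Proof. by move=> mP M0 MP M'; rewrite inE => /orP[/eqP->//|/mP]. Qed.

(** Since no cell is marked twice, the marks of a run form a set, and a bound on finite sets of
    admissible cells applies to them. *)
Lemma marks_card_le P T Ms T' (b : R) : generated refine T0 T -> refine_chain refine T Ms T' ->
  marks P Ms ->
  (forall S, (forall t, t \in S -> [/\ forest_cell chld T0 t, shaped ctr rho kap t & P t]) ->
    #|` S|%:R <= b) ->
  (\sum_(M <- Ms) #|` M|)%:R <= b.
Proof.
move=> gT ch mP; rewrite (chain_marks_card d1 strat triT0 shT gT ch); apply.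
move=> t /bigfcupP[M /andP[MMs _] tM].
have [T'' gT'' tT''] := chain_marks_generated gT ch MMs tM.
have [fT'' _] := generated_forest strat triT0 gT''.
by split; [exact: fT''|exact: shT tT''|have [_] := mP M MMs; apply].
Qed.

Definition interface_mark (r : R) t := hull t `&` gamma !=set0 /\ r / 2 < hsize t.

Lemma interface_step T r : 0 < r -> r / 2 < diamG gamma T ->
  let M := [fset t in interface_cells gamma T | r / 2 < hsize t]%fset in
  [/\ (M `<=` T)%fset, M != fset0 & forall m, m \in M -> interface_mark r m].
Proof.
move=> r0 dG M; split.
- by apply/fsubsetP => t; rewrite !inE /= => /andP[/andP[]].
- apply/negP => /eqP M0; move: dG; rewrite ltNge => /negP; apply.
  rewrite /diamG big_seq; apply: bigmax_le => [|t tG]; first by rewrite divr_ge0// ltW.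
  rewrite leNgt; apply/negP => ht; have : t \in M by move: tG; rewrite !inE /= => ->.
  by rewrite M0.
- by move=> m; rewrite !inE /= => /andP[/andP[_ /asboolP h1] h2].
Qed.

Lemma interface_chain T r T' : 0 < r -> INTERFACE refine gamma r T T' ->
  exists Ms, [/\ refine_chain refine T Ms T', marks (interface_mark r) Ms & diamG gamma T' <= r / 2].
Proof.
move=> r0; elim=> [T1 h|T1 T2 h _ [Ms [ch mk dG]]]; first by exists [::]; split => //; exact: chain_nil.
have [M1 M2 M3] := interface_step r0 h.
by eexists (_ :: Ms); split => //; [exact: chain_cons ch|exact: marks_cons].
Qed.

(** Induction on fuel: a run of more than [b] steps would mark more than [b] distinct admissible
    cells. *)
Lemma interface_terminates r (b : R) : 0 < r ->
  (forall S, (forall t, t \in S -> [/\ forest_cell chld T0 t, shaped ctr rho kap t & interface_mark r t]) ->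
    #|` S|%:R <= b) ->
  exists T', INTERFACE refine gamma r T0 T'.
Proof.
move=> r0 hb; have g0 := generated_init refine T0.
have loop n : forall Ms T, refine_chain refine T0 Ms T -> marks (interface_mark r) Ms ->
    b < (size Ms + n)%:R -> exists T', INTERFACE refine gamma r T T'.
  elim: n => [|n IH] Ms T ch mk.
    rewrite addn0 => bS; have := marks_card_le g0 ch mk hb.
    have := size_le_sum_card (fun M MMs => (mk M MMs).1); rewrite -(ler_nat R) => h1 h2.
    by have := lt_le_trans bS (le_trans h1 h2); rewrite ltxx.
  move=> bS; have [h|h] := leP (diamG gamma T) (r / 2); first by exists T; exact: interface_stop.
  have [M1 M2 M3] := interface_step r0 h.
  have [] := IH _ _ (chain_rcons ch M1) (marks_rcons mk M2 M3).
    by rewrite size_rcons addSnnS.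
  by move=> T' hT'; exists T'; exact: interface_loop.
apply: (loop (Num.truncn b).+1 [::] T0) => //; first exact: chain_nil.
by rewrite add0n; exact: truncnS_gt.
Qed.

Section FixedData.
Variables (g : 'rV[R]_d -> R) (r B C1 C3 C4 : R) (Tt : mesh R d).
Hypotheses (r0 : 0 < r) (gT : generated refine T0 Tt) (B0 : 0 <= B)
  (gB : forall x, `|g x| <= B)
  (gsupp : forall x, (forall y, gamma y -> d%:R * r < enorm (x - y)) -> g x = 0)
  (C10 : 0 < C1) (C30 : 0 < C3) (C40 : 0 < C4)
  (size_near : forall t, t \in Tt -> meets_nbhd gamma (d%:R * r) t -> hsize t <= C1 * r)
  (sum_tame : forall S, (forall t, t \in S -> tame gamma ctr rho kap C1 r t) ->
    (forall s t, s \in S -> t \in S -> s != t -> (hull s)° `&` (hull t)° = set0) ->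
    \sum_(t <- S) vol t <= C3 * r)
  (card_tame : forall eta S, 0 < eta ->
    (forall t, t \in S -> [/\ forest_cell chld T0 t, tame gamma ctr rho kap C1 r t & eta <= hsize t]) ->
    #|` S|%:R <= C4 * (r / eta ^+ d)).

(** Bound for the L2 norm of [g]: [|g| <= B], and the cells where [g] can be nonzero have total
    volume at most [C3 r]. *)
Definition reach : R := B * Num.sqrt (C3 * r).

Lemma reach_ge0 : 0 <= reach.
Proof. by rewrite mulr_ge0 ?sqrtr_ge0. Qed.

Lemma reach_sqr : reach ^+ 2 = B ^+ 2 * (C3 * r).
Proof. by rewrite exprMn sqr_sqrtr// mulr_ge0// ltW. Qed.

Lemma indicator_far t : ~ meets_nbhd gamma (d%:R * r) t -> indicator g t = 0.
Proof.
move=> nt; have := indicator_sqr g t.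
rewrite energy0 ?mulr0; first by move/eqP; rewrite sqrf_eq0 => /eqP.
move=> x tx; apply: gsupp => y gy; rewrite ltNge; apply/negP => xy.
by apply: nt; exists x => //; exists y.
Qed.

Lemma chain_tame Ms T t : refine_chain refine Tt Ms T -> t \in T ->
  meets_nbhd gamma (d%:R * r) t -> tame gamma ctr rho kap C1 r t.
Proof.
move=> ch tT nt; split => //; first exact: (shT (chain_generated gT ch)).
have [a aT at_] := chain_descends strat triT0 gT ch tT.
apply: (@le_trans _ _ (hsize a)).
  by apply: (hsize_le_vol d1); exact: (descends_vol strat at_).
apply: size_near => //; have [x tx [y gy xy]] := nt.
by exists x; [exact: (descends_hull at_ tx)|exists y].
Qed.

Lemma chain_disjoint Ms T s t : refine_chain refine Tt Ms T -> s \in T -> t \in T -> s != t ->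
  (hull s)° `&` (hull t)° = set0.
Proof.
move=> ch; have [_ [_ dT _]] := generated_forest strat triT0 (chain_generated gT ch).
exact: dT.
Qed.

(** The assumption bounds indicators rather than sizes, because GREEDY applies it also to cells
    larger than the maximizer. *)
Lemma error_part_le Ms T S (h : R) : refine_chain refine Tt Ms T -> (S `<=` T)%fset ->
  (forall t, t \in S -> meets_nbhd gamma (d%:R * r) t ->
     indicator g t ^+ 2 <= B ^+ 2 * (h ^+ 2 * vol t)) ->
  \sum_(t <- S) indicator g t ^+ 2 <= reach ^+ 2 * h ^+ 2.
Proof.
move=> ch ST hS; pose Sn := [fset t in S | `[< meets_nbhd gamma (d%:R * r) t >]]%fset.
have SnP t : t \in Sn -> t \in S /\ meets_nbhd gamma (d%:R * r) t.
  by rewrite !inE /= => /andP[tS /asboolP].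
have -> : \sum_(t <- S) indicator g t ^+ 2 = \sum_(t <- Sn) indicator g t ^+ 2.
  rewrite [LHS](bigID (fun t => `[< meets_nbhd gamma (d%:R * r) t >])) /= [X in _ + X]big1 ?addr0.
    rewrite -[LHS]big_filter; apply: perm_big; apply: uniq_perm; rewrite ?filter_uniq ?fset_uniq//.
    by move=> t; rewrite mem_filter !inE /= andbC.
  by move=> t /asboolP/indicator_far->; rewrite expr0n.
apply: (@le_trans _ _ (\sum_(t <- Sn) B ^+ 2 * h ^+ 2 * vol t)).
  rewrite big_seq [leRHS]big_seq; apply: ler_sum => t /SnP[tS nt].
  by rewrite -mulrA; exact: hS.
rewrite -mulr_sumr reach_sqr [leRHS]mulrAC; apply: ler_wpM2l; first by apply: mulr_ge0; exact: sqr_ge0.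
apply: sum_tame => [t /SnP[tS nt]|s t /SnP[sS _] /SnP[tS _]].
  by apply: (chain_tame ch) => //; exact: (fsubsetP ST).
by apply: (chain_disjoint ch); exact: (fsubsetP ST).
Qed.

(** Besides bounding the error, this gives [tau < reach * (C1 * r)] as soon as a loop runs, on which
    [total_count] relies. *)
Lemma chain_error_le Ms T : refine_chain refine Tt Ms T -> data_error g T <= reach * (C1 * r).
Proof.
move=> ch; rewrite -ler_sqr ?nnegrE ?data_error_ge0 ?mulr_ge0 ?reach_ge0 ?(ltW C10) ?(ltW r0)//.
rewrite data_error_sqr exprMn.
apply: (error_part_le ch); first exact: fsubset_refl.
move=> t tT nt; apply: le_trans (indicator_sqr_le t gB) _.
rewrite ler_wpM2l ?sqr_ge0// ler_wpM2r ?vol_ge0//.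
have [_ _ ht] := chain_tame ch tT nt.
by rewrite lerXn2r ?nnegrE ?hsize_ge0 ?mulr_ge0 ?(ltW C10) ?(ltW r0).
Qed.

Section Greedy.
Variable tau : R.
Hypothesis tau0 : 0 < tau.

Definition greedy_mark t := tame gamma ctr rho kap C1 r t /\ tau < reach * hsize t.

(* Any other cell [s] satisfies [indicator g s ^+ 2 <= B ^+ 2 * hsize t ^+ 2 * vol s],
   whether [s] is larger or smaller than the maximizer [t]. *)
Lemma greedy_marked Ms T t : refine_chain refine Tt Ms T -> tau < data_error g T ->
  t \in T -> (forall s, s \in T -> indicator g s <= indicator g t) -> greedy_mark t.
Proof.
move=> ch tD tT tmax.
have nt : meets_nbhd gamma (d%:R * r) t.
  apply: contrapT => /indicator_far it0; move: tD; rewrite ltNge => /negP; apply.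
  rewrite /data_error big_seq big1 ?sqrtr0 ?ltW// => s sT.
  have := tmax s sT; rewrite it0 => is0.
  have -> : indicator g s = 0 by apply/eqP; rewrite eq_le is0 indicator_ge0.
  by rewrite expr0n.
split; first exact: (chain_tame ch).
apply: lt_le_trans tD _.
rewrite -ler_sqr ?nnegrE ?data_error_ge0 ?mulr_ge0 ?reach_ge0 ?hsize_ge0//.
rewrite data_error_sqr exprMn; apply: (error_part_le ch); first exact: fsubset_refl.
move=> s sT _; have [st|ts] := leP (hsize s) (hsize t).
  apply: le_trans (indicator_sqr_le s gB) _.
  by rewrite ler_wpM2l ?sqr_ge0// ler_wpM2r ?vol_ge0// lerXn2r ?nnegrE ?hsize_ge0.
apply: (@le_trans _ _ (indicator g t ^+ 2)).
  by rewrite lerXn2r ?nnegrE ?indicator_ge0// tmax.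
apply: le_trans (indicator_sqr_le t gB) _.
rewrite ler_wpM2l ?sqr_ge0// ler_wpM2l ?sqr_ge0//.
by rewrite -!(hsizeX d1) lerXn2r ?nnegrE ?hsize_ge0// ltW.
Qed.

Lemma greedy_marks_card Ms T : refine_chain refine Tt Ms T -> marks greedy_mark Ms ->
  (\sum_(M <- Ms) #|` M|)%:R <= C4 * (r * reach ^+ d / tau ^+ d).
Proof.
move=> ch mk; apply: (marks_card_le gT ch mk) => S SP.
have [->|/fset0Pn[t tS]] := eqVneq S fset0.
  rewrite cardfs0; apply: mulr_ge0; first exact: ltW.
  by rewrite divr_ge0 ?mulr_ge0 ?exprn_ge0 ?reach_ge0 ?(ltW r0) ?(ltW tau0).
have k0 : 0 < reach.
  rewrite lt_neqAle reach_ge0 andbT eq_sym; apply/negP => /eqP k0.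
  have [_ _ [_]] := SP t tS; rewrite k0 mul0r => /(lt_trans tau0).
  by rewrite ltxx.
(* A greedy mark has size above [tau / reach], which serves as [eta]. *)
have -> : r * reach ^+ d / tau ^+ d = r / (tau / reach) ^+ d.
  by rewrite expr_div_n invf_div mulrA.
apply: card_tame; first by rewrite divr_gt0.
move=> u /SP[fu su [tu hu]]; split => //.
by rewrite ler_pdivrMr// mulrC ltW.
Qed.

Lemma greedy_chain Ms0 T T' : refine_chain refine Tt Ms0 T -> GREEDY refine g tau T T' ->
  exists Ms, [/\ refine_chain refine T Ms T', marks greedy_mark Ms &
    T' = T \/ tau < data_error g T].
Proof.
move=> + h; elim: h Ms0 => [T1 _|T1 t T2 tD tT tmax _ IH] Ms0 ch.
  by exists [::]; split => //; [exact: chain_nil|left].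
have tT' : ([fset t]%fset `<=` T1)%fset by rewrite fsub1set.
have [Ms [ch' mk _]] := IH _ (chain_rcons ch tT').
exists ([fset t]%fset :: Ms); split; [exact: chain_cons| |by right].
apply: marks_cons => //; first by apply/fset0Pn; exists t; rewrite inE.
by move=> m; rewrite inE => /eqP->; exact: (greedy_marked ch).
Qed.

Lemma greedy_terminates : exists T', GREEDY refine g tau Tt T'.
Proof.
pose b := C4 * (r * reach ^+ d / tau ^+ d).
have loop n : forall Ms T, refine_chain refine Tt Ms T -> marks greedy_mark Ms ->
    b < (size Ms + n)%:R -> exists T', GREEDY refine g tau T T'.
  elim: n => [|n IH] Ms T ch mk.
    rewrite addn0 => bS; have := greedy_marks_card ch mk.
    have := size_le_sum_card (fun M MMs => (mk M MMs).1); rewrite -(ler_nat R) => h1 h2.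
    by have := lt_le_trans bS (le_trans h1 h2); rewrite ltxx.
  move=> bS; have [h|h] := leP (data_error g T) tau; first by exists T; exact: greedy_stop.
  have [t tT tmax] : exists2 t, t \in T & forall s, s \in T -> indicator g s <= indicator g t.
    apply: fset_argmax; apply/eqP => T00; move: h.
    by rewrite /data_error T00 big_seq_fset0 sqrtr0 ltNge ltW.
  have tT' : ([fset t]%fset `<=` T)%fset by rewrite fsub1set.
  have mk' : marks greedy_mark (rcons Ms [fset t]%fset).
    apply: marks_rcons => //; first by apply/fset0Pn; exists t; rewrite inE.
    by move=> m; rewrite inE => /eqP->; exact: (greedy_marked ch).
  have [] := IH _ _ (chain_rcons ch tT') mk'; first by rewrite size_rcons addSnnS.
  by move=> T' hT'; exists T'; exact: greedy_loop hT'.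
apply: (loop (Num.truncn b).+1 [::] Tt) => //; first exact: chain_nil.
by rewrite add0n; exact: truncnS_gt.
Qed.

End Greedy.

Section Bulk.
Variables (theta p : R).
Hypotheses (theta0 : 0 < theta) (theta1 : theta < 1) (p1 : 1 < p) (pd : p ^+ d = q).

(** Comes from the count [C3 r / h^d] with [h = sqrt (1 - theta^2) D / reach], where [D] is the
    current error. *)
Definition bulk_cst : R := C3 / Num.sqrt (1 - theta ^+ 2) ^+ d.

(** Bulk marking inserts [theta^2 D^2] into [refine_error]; the root of the resulting factor
    contracts the error. *)
Definition decay : R := Num.sqrt (1 - (1 - p ^- 2) * theta ^+ 2).

Let theta2 : 0 < theta ^+ 2 < 1.
Proof. by apply/andP; split; [exact: exprn_gt0|apply: exprn_ilt1 => //; exact: ltW]. Qed.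

Let p2 : 0 < p ^- 2 < 1.
Proof.
have p0 : 0 < p by exact: lt_trans p1.
by rewrite invr_gt0 exprn_gt0//= invf_lt1 ?exprn_gt0// exprn_egt1.
Qed.

Lemma decay_bounds : 0 < decay < 1.
Proof.
move: theta2 p2 => /andP[t0 t1] /andP[a0 a1].
have h1 : 0 < (1 - p ^- 2) * theta ^+ 2 by rewrite mulr_gt0// subr_gt0.
have h2 : (1 - p ^- 2) * theta ^+ 2 < 1.
  by rewrite -[ltRHS]mulr1; apply: ltr_pM; rewrite ?subr_ge0 ?(ltW a1) ?(ltW t0)//; lra.
rewrite sqrtr_gt0 subr_gt0 h2/= -[ltRHS]sqrtr1 ltr_sqrt//; lra.
Qed.

Lemma bulk_cst_gt0 : 0 < bulk_cst.
Proof.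
by move: theta2 => /andP[t0 t1]; rewrite divr_gt0// exprn_gt0// sqrtr_gt0 subr_gt0.
Qed.

(* The cells near the interface of size at least [h] satisfy the bulk criterion
   for a suitable [h] proportional to the error. *)
Lemma bulk_card_le Ms T M : refine_chain refine Tt Ms T -> 0 < data_error g T ->
  (forall M', bulk g theta T M' -> (#|` M| <= #|` M'|)%N) ->
  #|` M|%:R <= bulk_cst * (r * reach ^+ d) / data_error g T ^+ d.
Proof.
move=> ch D0 Mmin; set D := data_error g T in D0 *.
move: theta2 => /andP[t0 t1].
pose e := Num.sqrt (1 - theta ^+ 2).
have e0 : 0 < e by rewrite sqrtr_gt0 subr_gt0.
have e2 : e ^+ 2 = 1 - theta ^+ 2 by rewrite sqr_sqrtr// subr_ge0 ltW.
have k0 : 0 < reach.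
  rewrite lt_neqAle reach_ge0 andbT eq_sym; apply/negP => /eqP k0.
  by have := chain_error_le ch; rewrite k0 mul0r leNgt D0.
(* With this [h] the cells of size below [h] carry at most [reach^2 h^2 = (1 - theta^2) D^2],
   leaving [theta^2 D^2] for the others. *)
pose h := e * D / reach.
have h0 : 0 < h by apply: divr_gt0 => //; exact: mulr_gt0.
pose M' := [fset t in T | `[< meets_nbhd gamma (d%:R * r) t >] && (h <= hsize t)]%fset.
have M'P t : t \in M' -> [/\ t \in T, meets_nbhd gamma (d%:R * r) t & h <= hsize t].
  by rewrite !inE /= => /andP[tT /andP[/asboolP nt ht]].
have M'T : (M' `<=` T)%fset by apply/fsubsetP => t /M'P[].
have bM' : bulk g theta T M'.
  split=> //; rewrite -/D -ler_sqr ?nnegrE ?data_error_ge0 ?mulr_ge0 ?(ltW theta0) ?(ltW D0)//.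
  have rest : \sum_(t <- (T `\` M')%fset) indicator g t ^+ 2 <= reach ^+ 2 * h ^+ 2.
    apply: (error_part_le ch); first exact: fsubsetDl.
    move=> t; rewrite inE => /andP[ntM' tT] nt.
    apply: le_trans (indicator_sqr_le t gB) _.
    rewrite ler_wpM2l ?sqr_ge0// ler_wpM2r ?vol_ge0// lerXn2r ?nnegrE ?hsize_ge0 ?(ltW h0)//.
    rewrite leNgt; apply/negP => ht; move/negP: ntM'; apply.
    by rewrite !inE /= tT /= ltW// andbT; apply/asboolP.
  have split_sum : \sum_(t <- T) indicator g t ^+ 2 =
      \sum_(t <- M') indicator g t ^+ 2 + \sum_(t <- (T `\` M')%fset) indicator g t ^+ 2.
    rewrite (bigID (fun t => t \in M')) /=; congr (_ + _); rewrite -[LHS]big_filter;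
      apply: perm_big; apply: uniq_perm; rewrite ?filter_uniq ?fset_uniq// => t.
      rewrite mem_filter; apply/andP/idP => [[]//|tM']; split => //.
      exact: (fsubsetP M'T).
    by rewrite mem_filter in_fsetD.
  have reachh : reach ^+ 2 * h ^+ 2 = (1 - theta ^+ 2) * D ^+ 2.
    by rewrite -e2 -!exprMn /h; congr (_ ^+ 2); field; rewrite gt_eqF.
  have DE : D ^+ 2 = \sum_(t <- M') indicator g t ^+ 2 +
      \sum_(t <- (T `\` M')%fset) indicator g t ^+ 2.
    by rewrite -split_sum; exact: data_error_sqr.
  rewrite reachh in rest; rewrite -/D exprMn [leRHS]data_error_sqr.
  by move: rest DE; lra.
have MM' : #|` M|%:R <= #|` M'|%:R :> R by rewrite ler_nat (Mmin _ bM').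
apply: (le_trans MM').
have -> : bulk_cst * (r * reach ^+ d) / D ^+ d = C3 * r / h ^+ d.
  have -> : h ^+ d = e ^+ d * D ^+ d / reach ^+ d by rewrite /h expr_div_n (exprMn d e D).
  have [De ee ke] : [/\ D ^+ d != 0, e ^+ d != 0 & reach ^+ d != 0] by rewrite !expf_neq0// gt_eqF.
  rewrite /bulk_cst -/e; move: (D ^+ d) (e ^+ d) (reach ^+ d) De ee ke => x y z x0 y0 z0.
  by field; rewrite x0 y0 z0.
rewrite ler_pdivlMr ?exprn_gt0//.
apply: (@le_trans _ _ (\sum_(t <- M') vol t)).
  apply: (@le_trans _ _ (\sum_(t <- M') h ^+ d)).
    by rewrite big_const_seq count_predT iter_addr_0 mulr_natl.
  rewrite big_seq [leRHS]big_seq; apply: ler_sum => t /M'P[_ _ ht].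
  by rewrite -(hsizeX d1) lerXn2r ?nnegrE ?hsize_ge0 ?(ltW h0).
apply: sum_tame => [t /M'P[tT nt _]|s t /M'P[sT _ _] /M'P[tT _ _]].
  exact: (chain_tame ch).
exact: (chain_disjoint ch).
Qed.

Lemma bulk_decay Ms T M : refine_chain refine Tt Ms T -> bulk g theta T M ->
  data_error g (refine T M) <= decay * data_error g T.
Proof.
move=> ch [MT bM]; have /andP[dec0 _] := decay_bounds.
move: theta2 p2 => /andP[t0 t1] /andP[a0 a1].
rewrite -ler_sqr ?nnegrE ?data_error_ge0 ?mulr_ge0 ?data_error_ge0 ?(ltW dec0)//.
apply: le_trans (refine_error d1 strat triT0 confT0 gB p1 pd (chain_generated gT ch) MT) _.
have h2 : (1 - p ^- 2) * theta ^+ 2 < 1.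
  by rewrite -[ltRHS]mulr1; apply: ltr_pM; rewrite ?subr_ge0 ?(ltW a1) ?(ltW t0)//; lra.
have dec2 : decay ^+ 2 = 1 - (1 - p ^- 2) * theta ^+ 2.
  by rewrite /decay sqr_sqrtr// subr_ge0 ltW.
have h3 : theta ^+ 2 * data_error g T ^+ 2 <= data_error g M ^+ 2.
  by rewrite -exprMn lerXn2r ?nnegrE ?mulr_ge0 ?data_error_ge0 ?(ltW theta0).
have a1' : 0 <= 1 - p ^- 2 by rewrite subr_ge0 ltW.
have h4 := ler_wpM2l a1' h3.
rewrite exprMn dec2; lra.
Qed.

Lemma bulk_exists T : exists2 M, bulk g theta T M &
  forall M', bulk g theta T M' -> (#|` M| <= #|` M'|)%N.
Proof.
have bT : bulk g theta T T.
  by split; [exact: fsubset_refl|rewrite ler_piMl ?data_error_ge0// ltW].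
have ex : exists n, `[< exists2 M, bulk g theta T M & #|` M| = n >].
  by exists #|` T|; apply/asboolP; exists T.
case: (ex_minnP ex) => n /asboolP[M bM Mn] nmin; exists M => // M' bM'.
by rewrite Mn; apply: nmin; apply/asboolP; exists M'.
Qed.

Variable tau : R.
Hypothesis tau0 : 0 < tau.

Let beta := (decay ^+ d)^-1.

Let beta1 : 1 < beta.
Proof.
have /andP[dec0 dec1] := decay_bounds.
by rewrite /beta invf_gt1 ?exprn_gt0// exprn_ilt1// ?ltW// -lt0n.
Qed.

(** Before each marking [D^-d] is below [tau^-d], and it grows by at least [beta] per step; so these
    terms sum to at most [tau^-d beta / (beta - 1)]. *)
Definition data_cst : R := bulk_cst / (beta - 1) * beta.

Lemma data_cst_gt0 : 0 < data_cst.
Proof.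
apply: mulr_gt0; last exact: lt_trans ltr01 beta1.
by apply: divr_gt0; [exact: bulk_cst_gt0|rewrite subr_gt0].
Qed.

(* The number of marked cells is bounded by a geometric sum; the potential
   [beta / tau ^+ d - 1 / data_error g T ^+ d] absorbs one step. *)
Lemma data_chain Ms0 T T' : refine_chain refine Tt Ms0 T -> DATA refine g tau theta T T' ->
  exists Ms, refine_chain refine T Ms T' /\
    ((Ms = [::] /\ T' = T) \/
     (tau < data_error g T /\ (\sum_(M <- Ms) #|` M|)%:R <=
        bulk_cst / (beta - 1) * (r * reach ^+ d) * (beta / tau ^+ d - (data_error g T ^+ d)^-1))).
Proof.
move=> + h; elim: h Ms0 => [T1 _|T1 M T2 tD bM Mmin _ IH] Ms0 ch.
  by exists [::]; split; [exact: chain_nil|left].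
have MT := bM.1; have [Ms [ch' hMs]] := IH _ (chain_rcons ch MT).
exists (M :: Ms); split; [exact: chain_cons|right; split => //].
have D0 : 0 < data_error g T1 by exact: lt_trans tD.
have hM := bulk_card_le ch D0 Mmin; have hD := bulk_decay ch bM.
have /andP[dec0 dec1] := decay_bounds.
set D := data_error g T1 in tD D0 hM hD *.
set Y := r * reach ^+ d in hM hMs *.
have Y0 : 0 <= Y by rewrite mulr_ge0 ?exprn_ge0 ?reach_ge0 ?(ltW r0).
pose c := bulk_cst / (beta - 1) * Y.
have c0 : 0 <= c.
  by apply: mulr_ge0 => //; apply: divr_ge0; [exact/ltW/bulk_cst_gt0|rewrite subr_ge0 ltW].
have b10 : beta - 1 != 0 by rewrite subr_eq0 gt_eqF.
have bY : bulk_cst * Y = c * (beta - 1) by rewrite /c; field.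
rewrite bY in hM.
have x0 : 0 < (D ^+ d)^-1 by rewrite invr_gt0 exprn_gt0.
have tx : (D ^+ d)^-1 <= (tau ^+ d)^-1.
  by rewrite lef_pV2 ?posrE ?exprn_gt0// lerXn2r ?nnegrE ?(ltW D0) ?(ltW tau0) ?(ltW tD).
rewrite big_cons natrD -/c.
have cb0 : 0 <= c * beta by rewrite mulr_ge0// (le_trans ler01)// ltW.
case: hMs => [[-> _]|[tD1 hMs]].
  rewrite big_nil addr0; apply: le_trans hM _.
  have := ler_wpM2l cb0 tx; lra.
apply: le_trans (lerD hM hMs) _; rewrite -/c.
have D10 : 0 < data_error g (refine T1 M) by exact: lt_trans tD1.
(* The decay of the error makes the increase of the potential pay for the cells marked in this
   step. *)
have hx : beta * (D ^+ d)^-1 <= (data_error g (refine T1 M) ^+ d)^-1.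
  rewrite /beta -invfM -exprMn lef_pV2 ?posrE ?exprn_gt0 ?mulr_gt0//.
  by rewrite lerXn2r ?nnegrE ?mulr_ge0 ?(ltW dec0) ?(ltW D0) ?(ltW D10).
have := ler_wpM2l c0 hx; lra.
Qed.

Lemma data_output T' : DATA refine g tau theta Tt T' ->
  exists Ms, refine_chain refine Tt Ms T' /\
    (T' = Tt \/ (tau < data_error g Tt /\
       (\sum_(M <- Ms) #|` M|)%:R <= data_cst * (r * reach ^+ d / tau ^+ d))).
Proof.
move=> /(data_chain (chain_nil _ _))[Ms [ch [[_ TE]|[tD nM]]]]; exists Ms; split => //; first by left.
right; split => //; apply: le_trans nM _.
have c0 : 0 <= bulk_cst / (beta - 1) * (r * reach ^+ d).
  apply: mulr_ge0; last by rewrite mulr_ge0 ?exprn_ge0 ?reach_ge0 ?(ltW r0).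
  by apply: divr_ge0; [exact/ltW/bulk_cst_gt0|rewrite subr_ge0 ltW].
rewrite (_ : data_cst * _ = bulk_cst / (beta - 1) * (r * reach ^+ d) * (beta / tau ^+ d)).
  by rewrite ler_wpM2l// gerBl invr_ge0 exprn_ge0// data_error_ge0.
by rewrite /data_cst; ring.
Qed.

(** The fuel is an [n] with [decay^n D <= tau] for the initial error [D]; each step uses up one
    power of [decay]. *)
Lemma data_terminates : exists T', DATA refine g tau theta Tt T'.
Proof.
have /andP[dec0 dec1] := decay_bounds.
have loop n : forall Ms T, refine_chain refine Tt Ms T -> decay ^+ n * data_error g T <= tau ->
    exists T', DATA refine g tau theta T T'.
  elim: n => [|n IH] Ms T ch; first by rewrite mul1r => h; exists T; exact: data_stop.
  move=> hn; have [h|h] := leP (data_error g T) tau; first by exists T; exact: data_stop.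
  have [M bM Mmin] := bulk_exists T.
  have [] := IH _ _ (chain_rcons ch bM.1).
    apply: le_trans hn; rewrite exprSr -mulrA ler_wpM2l ?exprn_ge0 ?(ltW dec0)//.
    exact: bulk_decay ch bM.
  by move=> T' hT'; exists T'; exact: data_loop hT'.
have [n hn] : exists n, decay ^+ n * data_error g Tt <= tau.
  have : (fun n => decay ^+ n * data_error g Tt) @ \oo --> (0 : R).
    rewrite -(mul0r (data_error g Tt)); apply: cvgMr_tmp; apply: cvg_expr.
    by rewrite ger0_norm ?ltW.
  move=> /cvgrPdist_le/(_ tau tau0)[n _ /(_ n (leqnn n))].
  rewrite sub0r normrN => h; exists n; exact: le_trans (ler_norm _) h.
exact: loop (chain_nil _ _) hn.
Qed.

End Bulk.

End FixedData.

End Algorithms.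

(** * Choice of inscribed balls, and balls about the interface *)

Section Assembly.
Context {R : realType} {d : nat}.

Lemma shaped_choice (q : R) (chld : cell R d -> mesh R d) refine (T0 : mesh R d) :
  refinement_strategy q chld refine T0 ->
  exists (ctr : cell R d -> 'rV[R]_d) (rho : cell R d -> R) (kap : R), 0 < kap /\
    forall T t, generated refine T0 T -> t \in T -> shaped ctr rho kap t.
Proof.
move=> strat; have [kap kap0 sh] := shape_regular strat.
pose P (t : cell R d) (p : 'rV[R]_d * R) := [/\ 0 < p.2, eball p.1 p.2 `<=` hull t &
  forall y z, hull t y -> hull t z -> enorm (y - z) <= kap * p.2].
have [f fP] : {f : cell R d -> 'rV[R]_d * R &
    forall t, (exists2 T, generated refine T0 T & t \in T) -> P t (f t)}.
  apply: (@choice _ _ (fun t p => (exists2 T, generated refine T0 T & t \in T) -> P t p)) => t.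
  have [[T gT tT]|nT] := pselect (exists2 T, generated refine T0 T & t \in T); last by exists (0, 0).
  by have [x [e [e0 h1 h2]]] := sh T t gT tT; exists (x, e).
exists (fun t => (f t).1), (fun t => (f t).2), kap; split=> // T t gT tT.
by apply: fP; exists T.
Qed.

Lemma powR_half (r : R) : 0 < r -> r `^ (1 - d%:R / 2) = r / Num.sqrt r ^+ d.
Proof.
move=> r0; have rd : Num.sqrt r ^+ d = r `^ (d%:R / 2).
  by rewrite -powR12_sqrt ?(ltW r0)// -powR_mulrn ?powR_ge0// -powRrM mulrC.
have sd : Num.sqrt r ^+ d != 0 by rewrite expf_neq0// gt_eqF// sqrtr_gt0.
apply: (mulIf sd); rewrite divfK// rd -powRD ?subrK ?powRr1 ?(ltW r0)//.
by rewrite gt_eqF ?implybT.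
Qed.

(** A segment from [y] to a point outside the closure crosses the boundary of [Omega] at a point no
    farther from [y], contradicting the distance of [gamma] to that boundary. *)
Lemma eball_sub_closure (Omega gamma : set 'rV[R]_d) (c : R) y :
  gamma `<=` closure Omega -> c < set_dist gamma (boundary Omega) -> gamma y ->
  eball y c `<=` closure Omega.
Proof.
move=> gO cd gy x yx; apply: contrapT => nx.
have [l /andP[l0 l1] [cz niz]] : exists2 l : R, 0 <= l <= 1 &
    closure Omega (y + l *: (x - y)) /\ (~` Omega°) (y + l *: (x - y)).
  apply: segment_meet; [exact: closed_closure| |exact: gO| |].
  - by apply: open_closedC; exact: open_interior.
  - by move=> ix; apply: nx; apply: subset_closure; exact: interior_subset.
  - move=> l _; have [ci|nci] := pselect (closure Omega (y + l *: (x - y))); first by left.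
    by right=> ix; apply: nci; apply: subset_closure; exact: interior_subset.
set z := y + _ in cz niz.
have : set_dist gamma (boundary Omega) <= enorm (y - z).
  apply: ge_inf; last by exists (y, z).
  by exists 0 => _ [p _ <-]; exact: enorm_ge0.
have : enorm (y - z) <= enorm (x - y).
  rewrite /z opprD addrA subrr add0r enormN enormZ ger0_norm//.
  by rewrite ler_piMl ?enorm_ge0.
by move: yx cd; rewrite /eball/=; lra.
Qed.

Lemma sub_bounded_set (A B : set 'rV[R]_d) : A `<=` B -> bounded_set B -> bounded_set A.
Proof. by move=> AB [M [Mr h]]; exists M; split=> // N MN x /AB; exact: h. Qed.

End Assembly.

(** * Passing from marks to cells *)

Section TotalCount.
Context {R : realType} {d : nat}.
Variables (q : R) (chld : cell R d -> mesh R d) (refine : mesh R d -> mesh R d -> mesh R d).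
Variables (T0 : mesh R d) (cg C1 C3 C5 CF Cc : R).
Hypotheses (d0 : (0 < d)%N) (cg0 : 0 < cg) (C10 : 0 < C1) (C30 : 0 < C3) (C50 : 0 < C5) (CF0 : 0 < CF)
  (Cc1 : 1 <= Cc).
Hypothesis complexity : forall Ms T, refine_chain refine T0 Ms T ->
  #|` T|%:R <= #|` T0|%:R + Cc * \sum_(M <- Ms) #|` M|%:R.

(** The three terms stem from the cells of [T0], the marks of INTERFACE and the marks of the second
    algorithm; the last factor comes from [reach_pow]. *)
Definition total_cst (b : R) : R :=
  ((#|` T0|%:R * cg ^+ d.-1 + Cc * C5) * C1 ^+ d + Cc * b) * (CF * Num.sqrt C3) ^+ d.

Lemma total_cst_gt0 b : 0 < b -> 0 < total_cst b.
Proof.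
move=> b0; have Cc0 : 0 < Cc by exact: lt_le_trans Cc1.
apply: mulr_gt0; last by rewrite exprn_gt0// mulr_gt0// sqrtr_gt0.
apply: ltr_wpDl; last exact: mulr_gt0.
by rewrite mulr_ge0 ?exprn_ge0 ?(ltW C10)// addr_ge0 ?mulr_ge0 ?exprn_ge0 ?(ltW cg0) ?(ltW Cc0) ?(ltW C50).
Qed.

(** Origin of the exponent [1 - d/2]: [CF m / r] times [sqrt (C3 r)] is a multiple of
    [m r^(-1/2)]. *)
Lemma reach_pow (r m : R) : 0 < r -> 0 <= m ->
  r * reach r (CF * m / r) C3 ^+ d =
  (CF * Num.sqrt C3) ^+ d * (r `^ (1 - d%:R / 2) * m ^+ d).
Proof.
move=> r0 m0; rewrite powR_half//.
have s0 : Num.sqrt r != 0 by rewrite gt_eqF// sqrtr_gt0.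
rewrite /reach sqrtrM ?(ltW C30)//.
have -> : CF * m / r * (Num.sqrt C3 * Num.sqrt r) = CF * Num.sqrt C3 * m / Num.sqrt r.
  by rewrite -{1}(sqr_sqrtr (ltW r0)); field.
by rewrite expr_div_n (exprMn d (CF * Num.sqrt C3) m); field; rewrite expf_neq0.
Qed.

(** The complexity bound is applied to the concatenated chain from [T0]. Its first two contributions
    are of order [r^(1-d)], and [tau < k C1 r] turns them into multiples of [r k^d / tau^d]; the
    count of [Tt] is merely nonnegative. *)
Lemma total_count (r m tau b : R) MsI Ms Tt T' : 0 < r -> r < cg -> 0 <= m -> 0 < tau ->
  refine_chain refine T0 MsI Tt -> refine_chain refine Tt Ms T' ->
  (\sum_(M <- MsI) #|` M|)%:R <= C5 / r ^+ d.-1 ->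
  tau < reach r (CF * m / r) C3 * (C1 * r) ->
  (\sum_(M <- Ms) #|` M|)%:R <= b * (r * reach r (CF * m / r) C3 ^+ d / tau ^+ d) ->
  #|` T'|%:R - #|` Tt|%:R <= total_cst b * (r `^ (1 - d%:R / 2) * m ^+ d) * tau ^- d.
Proof.
move=> r0 rc m0 tau0 chI ch nI tr nM.
set k := reach _ _ _ in tr nM.
have Cc0 : 0 < Cc by exact: lt_le_trans Cc1.
have Y := reach_pow r0 m0; rewrite -/k in Y.
have -> : total_cst b * (r `^ (1 - d%:R / 2) * m ^+ d) * tau ^- d =
   ((#|` T0|%:R * cg ^+ d.-1 + Cc * C5) * C1 ^+ d + Cc * b) * (r * k ^+ d / tau ^+ d).
  by rewrite Y /total_cst; ring.
set y := r * k ^+ d / tau ^+ d in nM *.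
have rd : 0 < r ^+ d.-1 by rewrite exprn_gt0.
have ry : 1 / r ^+ d.-1 <= C1 ^+ d * y.
  have td : 0 < tau ^+ d by rewrite exprn_gt0.
  rewrite /y mulrA ler_pdivlMr// mul1r [leLHS]mulrC ler_pdivrMr//.
  have -> : C1 ^+ d * (r * k ^+ d) * r ^+ d.-1 = (k * (C1 * r)) ^+ d.
    by rewrite !exprMn -[in r ^+ d](prednK d0) exprS; ring.
  by rewrite lerXn2r ?nnegrE ?(ltW tau0) ?(ltW tr)// (le_trans (ltW tau0))// ltW.
(* [r < cg] lets the constant count of [T0] be written as a multiple of [r^(1-d)]. *)
have n0 : #|` T0|%:R <= #|` T0|%:R * cg ^+ d.-1 * (1 / r ^+ d.-1).
  rewrite -mulrA ler_peMr// mul1r ler_pdivlMr// mul1r.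
  by rewrite lerXn2r ?nnegrE ?(ltW r0) ?(ltW cg0) ?(ltW rc).
have := complexity (chain_cat chI ch); rewrite big_cat/= -!natr_sum => h.
have h1 : Cc * (\sum_(M <- MsI) #|` M|)%:R <= Cc * C5 * (1 / r ^+ d.-1).
  by rewrite mul1r -mulrA ler_wpM2l// ltW.
have h2 := ler_wpM2l (ltW Cc0) nM.
have a0 : 0 <= #|` T0|%:R * cg ^+ d.-1 + Cc * C5.
  by rewrite addr_ge0 ?mulr_ge0 ?exprn_ge0 ?(ltW cg0) ?(ltW Cc0) ?(ltW C50).
have h3 := ler_wpM2l a0 ry.
have h4 : 0 <= #|` Tt|%:R :> R by [].
move: (1 / r ^+ d.-1) n0 h1 h3 => w n0 h1 h3.
lra.
Qed.

End TotalCount.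

Theorem lemma4p7 (R : realType) (d : nat)
  (Omega omega : set 'rV[R]_d) (c_gamma : R) (psi : 'rV[R]_d -> R)
  (T0 : mesh R d) (q : R) (chld : cell R d -> mesh R d)
  (refine : mesh R d -> mesh R d -> mesh R d) :
  let gamma := boundary omega in
  d = 2%N \/ d = 3%N ->
  lipschitz_polytope Omega ->
  lipschitz_domain omega ->
  omega `<=` Omega ->
  0 < c_gamma ->
  c_gamma < set_dist gamma (boundary Omega) ->
  regularizing_kernel psi ->
  triangulates T0 (closure Omega) ->
  conforming T0 ->
  refinement_strategy q chld refine T0 ->
  initial_grid q chld T0 gamma ->
  (exists K0 : R, forall (f : 'rV[R]_d -> R) (r : R),
     Linfty gamma f -> piecewise_signed gamma f -> 0 < r -> r < c_gamma ->
     outputs (INTERFACE refine gamma r T0) (fun Tt =>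
       forall tau : R, 0 < tau ->
       outputs (GREEDY refine (regularized psi gamma f r) tau Tt) (fun Ts =>
         #|` Ts|%:R - #|` Tt|%:R <=
           K0 * r `^ (1 - d%:R / 2) * fine (Linfty_norm gamma f) ^+ d
              * tau ^- d)))
  /\
  (forall theta : R, 0 < theta -> theta < 1 ->
   exists c1 c2 : R, [/\ 0 < c1, 0 < c2 &
   forall (f : 'rV[R]_d -> R) (r : R),
     Linfty gamma f -> piecewise_signed gamma f -> 0 < r -> r < c_gamma ->
     outputs (INTERFACE refine gamma r T0) (fun Tt =>
       exists2 G : R,
         sim c1 c2 G (r `^ (1 - d%:R / 2) * fine (Linfty_norm gamma f) ^+ d) &
         forall tau : R, 0 < tau ->
         outputs (DATA refine (regularized psi gamma f r) tau theta Tt)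
           (fun Ts => #|` Ts|%:R - #|` Tt|%:R <= G * tau ^- d))]).
Proof.
move=> gamma d23 [_ bO _ _] [_ _ _ lo] oO cg0 cgd psiK triT0 confT0 strat _.
have d1 : (1 < d)%N by case: d23 => ->.
have d0 : (0 < d)%N by exact: ltnW.
have bo : bounded_set omega by exact: sub_bounded_set bO.
have ballA y : gamma y -> eball y c_gamma `<=` closure Omega.
  by apply: eball_sub_closure cgd => z [cz _]; exact: closure_subset cz.
have thick := lebesgue_boundary_thickening d0 bo lo.
have [Cs Cs0 surfC] := surface_boundary_eball d0 bo lo.
have [CF CF0 hF] := regularized_bound d0 surfC psiK Cs0.
have [ctr [rho [kap [kap0 shT]]]] := shaped_choice strat.
have [C1 C10 hC1] := near_hsize d1 strat triT0 confT0 kap0 shT cg0 ballA.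
have [C3 C30 hC3] := @tame_sum_vol R d gamma c_gamma d1 ctr rho kap kap0 thick C1 C10.
have [C4 C40 hC4] := @card_tame_le R d q chld refine T0 _ gamma c_gamma d1 strat triT0 ctr rho kap kap0 shT thick C1 C10.
have [C5 C50 hC5] := card_interface_le d1 strat triT0 kap0 shT thick.
have [Cc Cc1 hCc] := chain_complexity strat.
have [p p1 [pd _]] := level_hsize d1 strat.
have interface r : 0 < r -> outputs (INTERFACE refine gamma r T0) (fun Tt =>
    diamG gamma Tt <= r / 2 /\ exists2 Ms, refine_chain refine T0 Ms Tt &
      (\sum_(M <- Ms) #|` M|)%:R <= C5 / r ^+ d.-1).
  move=> r0.
  have bound S : (forall t, t \in S -> [/\ forest_cell chld T0 t, shaped ctr rho kap t &
      interface_mark gamma r t]) -> #|` S|%:R <= C5 / r ^+ d.-1.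
    by move=> SP; apply: hC5 => // t /SP[ft st [tg rt]].
  split; first exact: (interface_terminates d1 strat triT0 shT r0 bound).
  move=> Tt /(interface_chain r0)[Ms [ch mk dG]]; split => //; exists Ms => //.
  exact: (marks_card_le d1 strat triT0 shT (generated_init refine T0) ch mk bound).
split.
- pose K := total_cst T0 c_gamma C1 C3 C5 CF Cc C4.
  have K0 : 0 < K by exact: total_cst_gt0.
  exists K => f r fL _ r0 rc.
  have [IE IP] := interface r r0; split => // Tt /IP[dG [MsI chI nI]] tau tau0.
  have gT := chain_generated (generated_init refine T0) chI.
  have [Fb F0] := hF f r fL r0; have [m0 _] := Linfty_norm_ae fL.
  set m := fine _ in Fb m0 *; set F := regularized psi gamma f r in Fb F0 *.
  have B0 : 0 <= CF * m / r by rewrite divr_ge0 ?mulr_ge0 ?(ltW CF0) ?(ltW r0).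
  have size_near t : t \in Tt -> meets_nbhd gamma (d%:R * r) t -> hsize t <= C1 * r.
    exact: hC1 gT r0 rc dG t.
  have sum_tame S := hC3 r S r0 rc.
  have card_tame eta S := hC4 r eta S r0 rc.
  split.
    exact: (greedy_terminates d1 strat triT0 shT r0 gT B0 Fb F0 C30 C40 size_near sum_tame card_tame tau0).
  move=> T' hT'.
  (* If no step is made, the difference is zero and the bound nonnegative; otherwise [tau] is below
     the initial error, as [total_count] demands. *)
  have [Ms [ch mk [->|tD]]] := greedy_chain d1 strat triT0 shT r0 gT B0 Fb F0 C30 size_near sum_tame tau0 (chain_nil _ _) hT'.
    rewrite subrr; apply: mulr_ge0; last by rewrite invr_ge0 exprn_ge0// ltW.
    by rewrite -mulrA; apply: mulr_ge0; [exact: ltW|rewrite mulr_ge0 ?powR_ge0 ?exprn_ge0].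
  have nM := greedy_marks_card d1 strat triT0 shT r0 gT B0 C40 card_tame tau0 ch mk.
  rewrite -(mulrA K); apply: (total_count d0 cg0 C30 C50 Cc1 hCc r0 rc m0 tau0 chI ch nI _ nM).
  apply: lt_le_trans tD _.
  exact: (chain_error_le d1 strat triT0 shT r0 gT B0 Fb F0 C10 C30 size_near sum_tame (chain_nil _ _)).
- move=> theta theta0 theta1.
  pose b := data_cst (d := d) C3 theta p.
  have b0 : 0 < b by exact: data_cst_gt0.
  pose K := total_cst T0 c_gamma C1 C3 C5 CF Cc b.
  have K0 : 0 < K by exact: total_cst_gt0.
  (* [G] will be exactly [K] times the quantity it is compared with, so both comparison constants
     are [K^-1]; [K] depends on [theta] but not on [f], [r] or [tau]. *)
  exists K^-1, K^-1; split; rewrite ?invr_gt0// => f r fL _ r0 rc.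
  have [IE IP] := interface r r0; split => // Tt /IP[dG [MsI chI nI]].
  have gT := chain_generated (generated_init refine T0) chI.
  have [Fb F0] := hF f r fL r0; have [m0 _] := Linfty_norm_ae fL.
  set m := fine _ in Fb m0 *; set F := regularized psi gamma f r in Fb F0 *.
  have B0 : 0 <= CF * m / r by rewrite divr_ge0 ?mulr_ge0 ?(ltW CF0) ?(ltW r0).
  have size_near t : t \in Tt -> meets_nbhd gamma (d%:R * r) t -> hsize t <= C1 * r.
    exact: hC1 gT r0 rc dG t.
  have sum_tame S := hC3 r S r0 rc.
  have card_tame eta S := hC4 r eta S r0 rc.
  exists (K * (r `^ (1 - d%:R / 2) * m ^+ d)).
    by rewrite /sim mulKf ?lexx// gt_eqF.
  move=> tau tau0; split.
    exact: (data_terminates d1 strat triT0 confT0 gT Fb theta0 theta1 p1 pd tau0).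
  move=> T' hT'.
  have [Ms [ch [->|[tD nM]]]] := data_output d1 strat triT0 confT0 shT r0 gT B0 Fb F0 C10 C30 size_near sum_tame theta0 theta1 p1 pd tau0 hT'.
    rewrite subrr; apply: mulr_ge0; last by rewrite invr_ge0 exprn_ge0// ltW.
    by apply: mulr_ge0; [exact: ltW|rewrite mulr_ge0 ?powR_ge0 ?exprn_ge0].
  apply: (total_count d0 cg0 C30 C50 Cc1 hCc r0 rc m0 tau0 chI ch nI _ nM).
  apply: lt_le_trans tD _.
  exact: (chain_error_le d1 strat triT0 shT r0 gT B0 Fb F0 C10 C30 size_near sum_tame (chain_nil _ _)).
Qed.
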